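(* (a) For any constant $c\ge 1$, unless $\mathsf{FPT}=\mathsf{W[1]}$, there is no algorithm running in time $f(k)\cdot n^{\mathcal{O}(1)}$ for a computable function $f$ that, given an $n$-vertex graph $G$ and a positive integer $k$, can distinguish between the cases $\mathsf{tree}\text{-}\alpha(G)\le k$ and $\mathsf{tree}\text{-}\alpha(G)>ck$. (b) Assuming Gap-ETH, for any computable function $g$ with $g(k)\ge k$, there is no algorithm running in time $f(k)\cdot n^{o(k)}$ for a computable function $f$ that, given an $n$-vertex graph $G$ and a positive integer $k$, can distinguish between the cases $\mathsf{tree}\text{-}\alpha(G)\le k$ and $\mathsf{tree}\text{-}\alpha(G)>g(k)$.
   Context: A tree decomposition of $G$ is a tree $T$ with bags $X_t\subseteq V(G)$ such that every vertex is in some bag, every edge has both endpoints in some bag, and for each vertex the nodes containing it form a subtree; its independence number is the maximum over bags of the independence number of $G[X_t]$, and $\mathsf{tree}\text{-}\alpha(G)$ is the minimum independence number over all tree decompositions of $G$. ''Distinguish between the cases'' means answering yes on inputs with the first property and no on inputs with the second. Gap-ETH is the Gap Exponential Time Hypothesis. *)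

(* Defs.v *)
From HB Require Import structures.
From mathcomp Require Import all_boot all_order all_algebra.
From mathcomp Require Import all_classical all_reals all_analysis.

Set Implicit Arguments.
Unset Strict Implicit.
Unset Printing Implicit Defensive.

Import Order.TTheory GRing.Theory Num.Theory numFieldNormedType.Exports.

(** * Graphs, tree decompositions, tree-independence number *)

Record graph (V : finType) := Graph {
  edge :> rel V;
  edge_sym : symmetric edge;
  edge_irr : irreflexive edge }.

Definition stable (V : finType) (G : graph V) (A : {set V}) : bool :=
  [forall u in A, forall v in A, ~~ G u v].

Definition alpha (V : finType) (G : graph V) : nat :=
  \max_(A : {set V} | stable G A) #|A|.

Lemma induced_sym (V : finType) (G : graph V) (X : {set V}) :
  symmetric (fun u v : {x | x \in X} => G (val u) (val v)).
Proof. by move=> u v; apply: edge_sym. Qed.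

Lemma induced_irr (V : finType) (G : graph V) (X : {set V}) :
  irreflexive (fun u v : {x | x \in X} => G (val u) (val v)).
Proof. by move=> u; apply: edge_irr. Qed.

Definition induced (V : finType) (G : graph V) (X : {set V}) :
  graph {x | x \in X} := Graph (@induced_sym V G X) (@induced_irr V G X).

Definition connected_graph (V : finType) (G : graph V) : Prop :=
  forall u v : V, connect G u v.

(* A pair [:: u; v] of adjacent vertices is a [ucycle] of the symmetric
   relation [G], hence the bound 3. *)
Definition acyclic_graph (V : finType) (G : graph V) : Prop :=
  forall p : seq V, ucycle G p -> size p < 3.

Definition is_tree (V : finType) (G : graph V) : Prop :=
  [/\ 0 < #|V|, connected_graph G & acyclic_graph G].

Record tree_decomposition (V : finType) (G : graph V) := TreeDecomposition {
  td_node : finType;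
  td_tree : graph td_node;
  td_bag : td_node -> {set V};
  td_is_tree : is_tree td_tree;
  td_vertex : forall v : V, exists t, v \in td_bag t;
  td_edge : forall u v : V, G u v ->
    exists t, (u \in td_bag t) && (v \in td_bag t);
  (* connected induced subgraphs of a tree are its subtrees; nonemptiness is
     [td_vertex] *)
  td_subtree : forall v : V,
    connected_graph (induced td_tree [set t | v \in td_bag t]) }.

Definition td_alpha (V : finType) (G : graph V) (D : tree_decomposition G) :
  nat := \max_(t : td_node D) alpha (induced G (td_bag t)).

Lemma no_edge_sym : symmetric (fun _ _ : unit => false). Proof. by []. Qed.
Lemma no_edge_irr : irreflexive (fun _ _ : unit => false). Proof. by []. Qed.

Lemma tree_decomposition_exists (V : finType) (G : graph V) :
  exists m, `[< exists D : tree_decomposition G, td_alpha D = m >].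
Proof.
pose T := Graph no_edge_sym no_edge_irr.
have tT : is_tree T.
  split; first by rewrite card_unit.
  - by move=> [] []; apply: connect0.
  - by move=> [|[] [|[] p]].
have D : tree_decomposition G.
  apply: (@TreeDecomposition V G _ T (fun _ => [set: V]) tT).
  - by move=> v; exists tt; rewrite inE.
  - by move=> u v _; exists tt; rewrite !inE.
  - move=> v [[] su] [[] sv].
    by rewrite (bool_irrelevance su sv); apply: connect0.
by exists (td_alpha D); apply/asboolP; exists D.
Qed.

Definition tree_alpha (V : finType) (G : graph V) : nat :=
  ex_minn (tree_decomposition_exists G).

(** * Deterministic multitape Turing machines *)

Inductive move := MoveLeft | MoveStay | MoveRight.

(* Cell contents: [None] is the blank, [Some (inl b)] an input/output bit,
   [Some (inr a)] a work symbol. *)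
Definition symbol (A : finType) : finType := option (bool + A).

Record TM := MkTM {
  tm_work : finType;
  tm_state : finType;
  (* the machine has [tm_tapes.+1] tapes *)
  tm_tapes : nat;
  tm_start : tm_state;
  (* [None] means that the machine halts *)
  tm_trans : tm_state -> tm_tapes.+1.-tuple (symbol tm_work) ->
    option (tm_state * tm_tapes.+1.-tuple (symbol tm_work * move)) }.

(* A tape infinite in both directions: the cells to the left of the head, in
   order of increasing distance, and the cells from the head on rightwards;
   all cells that are not listed are blank. *)
Definition tape (A : finType) : Type := (seq (symbol A) * seq (symbol A))%type.

Definition tape_read (A : finType) (tp : tape A) : symbol A :=
  head None tp.2.

Definition tape_act (A : finType) (tp : tape A) (act : symbol A * move) :
  tape A :=
  let r := behead tp.2 in
  match act.2 with
  | MoveLeft => (behead tp.1, head None tp.1 :: act.1 :: r)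
  | MoveStay => (tp.1, act.1 :: r)
  | MoveRight => (act.1 :: tp.1, r)
  end.

Definition config (M : TM) : Type :=
  (tm_state M * (tm_tapes M).+1.-tuple (tape (tm_work M)))%type.

Definition tm_init (M : TM) (x : seq bool) : config M :=
  (tm_start M,
   [tuple if i == ord0 then ([::], [seq Some (inl b) | b <- x])
          else ([::], [::]) | i < (tm_tapes M).+1]).

Definition tm_step (M : TM) (c : config M) : option (config M) :=
  if tm_trans c.1 (map_tuple (@tape_read _) c.2) is Some (q, acts) then
    Some (q, [tuple tape_act (tnth c.2 i) (tnth acts i)
             | i < (tm_tapes M).+1])
  else None.

Fixpoint tm_exec (M : TM) (t : nat) (c : config M) : option (config M) :=
  if tm_step c is Some c' then
    if t is t'.+1 then tm_exec t' c' else None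
  else Some c.

Fixpoint leading_bits (A : finType) (s : seq (symbol A)) : seq bool :=
  if s is Some (inl b) :: s' then b :: leading_bits s' else [::].

(* The output is the maximal bit string starting at the head of tape 0. *)
Definition tm_output (M : TM) (c : config M) : seq bool :=
  leading_bits (tnth c.2 ord0).2.

(* [M] on input [x] halts after at most [t] steps with output [y]. *)
Definition computes_within (M : TM) (t : nat) (x y : seq bool) : Prop :=
  omap (@tm_output M) (tm_exec t (tm_init M x)) = Some y.

(** * Encodings *)

Definition enc_nat (n : nat) : seq bool := rcons (nseq n true) false.

Definition enc_nats (s : seq nat) : seq bool := flatten (map enc_nat s).

Definition computable (f : nat -> nat) : Prop :=
  exists M : TM, forall n, exists t,
    computes_within M t (enc_nat n) (enc_nat (f n)).

(* The parameter in unary, then the adjacency matrix, row by row. *)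
Definition enc_graph_param (n : nat) (G : graph 'I_n) (k : nat) : seq bool :=
  enc_nat k ++ enc_nat n ++
  [seq G u v | u <- enum 'I_n, v <- enum 'I_n].

(** * Parameterized complexity: FPT and W[1] *)

Definition param_problem : Type := seq bool -> nat -> Prop.

Definition enc_param (x : seq bool) (k : nat) : seq bool := enc_nat k ++ x.

(* Since [enc_nat k] has length [k.+1], bounds in terms of the length of
   [enc_param x k] are bounds in terms of the instance size |x| + k. *)
Definition FPT (L : param_problem) : Prop :=
  exists (M : TM) (f : nat -> nat) (d : nat), computable f /\
    forall x k, exists b : bool,
      computes_within M (f k * size (enc_param x k) ^ d) (enc_param x k)
        [:: b] /\ (b <-> L x k).

Definition fpt_reducible (L L' : param_problem) : Prop :=
  exists (M : TM) (f g : nat -> nat) (d : nat),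
    [/\ computable f, computable g &
    forall x k, exists (x' : seq bool) (k' : nat),
      [/\ computes_within M (f k * size (enc_param x k) ^ d) (enc_param x k)
            (enc_param x' k'),
          k' <= g k & (L x k <-> L' x' k')]].

Inductive gate := Neg of nat | And of seq nat | Or of seq nat.

(* Nodes are numbered in a topological order: [0 .. inputs - 1] are the input
   nodes and [inputs + i] is the i-th gate; a gate lists its in-neighbours. *)
Record circuit := Circuit {
  inputs : nat;
  gates : seq gate;
  output : nat }.

Definition fanin (g : gate) : seq nat :=
  match g with Neg u => [:: u] | And us => us | Or us => us end.

Definition is_neg (g : gate) : bool := if g is Neg _ then true else false.

Definition wf_circuit (C : circuit) : Prop :=
  output C < inputs C + size (gates C) /\
  forall i, i < size (gates C) ->
    let g := nth (Neg 0) (gates C) i in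
    [/\ all (fun u => u < inputs C + i) (fanin g),
        uniq (fanin g) & is_neg g || (1 < size (fanin g))].

(* Label of the output node, when the input nodes are labelled by [base] and
   [rule vs g] is the label of a gate [g] all of whose predecessors are
   labelled in [vs]. *)
Definition output_label (T : Type) (x0 : T) (rule : seq T -> gate -> T)
    (base : seq T) (C : circuit) : T :=
  nth x0 (foldl (fun vs g => rcons vs (rule vs g)) base (gates C)) (output C).

Definition gate_value (vs : seq bool) (g : gate) : bool :=
  match g with
  | Neg u => ~~ nth false vs u
  | And us => all (nth false vs) us
  | Or us => has (nth false vs) us
  end.

Definition circuit_value (C : circuit) (a : (inputs C).-tuple bool) : bool :=
  output_label false gate_value a C.

(* The maximal length of a path from an input node to the output node. *)
Definition depth (C : circuit) : nat :=
  output_label 0 (fun vs g => (\max_(u <- fanin g) nth 0 vs u).+1)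
    (nseq (inputs C) 0) C.

(* The maximal number of large nodes (indegree more than 2) on a path from an
   input node to the output node. *)
Definition weft (C : circuit) : nat :=
  output_label 0
    (fun vs g => (\max_(u <- fanin g) nth 0 vs u) + (2 < size (fanin g)))
    (nseq (inputs C) 0) C.

Definition code_gate (g : gate) : seq nat :=
  match g with
  | Neg u => [:: 0; u]
  | And us => [:: 1, size us & us]
  | Or us => [:: 2, size us & us]
  end.

Definition enc_circuit (C : circuit) : seq bool :=
  enc_nats [:: inputs C, output C, size (gates C)
            & flatten (map code_gate (gates C))].

(* Weighted circuit satisfiability for circuits of weft at most [t] and depth
   at most [d]: is there a satisfying assignment with exactly [k] ones? *)
Definition WCS (t d : nat) : param_problem := fun x k =>
  exists C : circuit,
    [/\ wf_circuit C, weft C <= t, depth C <= d, x = enc_circuit C &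
     exists a : (inputs C).-tuple bool, count id a = k /\ circuit_value a].

Definition W (t : nat) (L : param_problem) : Prop :=
  exists d, 0 < d /\ fpt_reducible L (WCS t d).

(** * Gap-ETH *)

(* The literal (i, b) is true under [a] when [a i = b]. *)
Definition literal (n : nat) : Type := ('I_n * bool)%type.
Definition cnf3 (n : nat) : Type := seq (3.-tuple (literal n)).

Definition satisfied_clauses (n : nat) (phi : cnf3 n) (a : {ffun 'I_n -> bool})
  : nat := count (fun C : 3.-tuple (literal n) =>
    has (fun l : literal n => a l.1 == l.2) C) phi.

Definition max_sat (n : nat) (phi : cnf3 n) : nat :=
  \max_(a : {ffun 'I_n -> bool}) satisfied_clauses phi a.

Definition enc_cnf3 (n : nat) (phi : cnf3 n) : seq bool :=
  enc_nats [:: n, size phi &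
    flatten [seq [:: nat_of_ord l.1; nat_of_bool l.2]
            | l <- flatten (map (@tval _ _) phi)]].

Local Open Scope ring_scope.

(* For some delta, eps > 0 no algorithm, given a 3-CNF formula with n variables
   and m = O(n) clauses, distinguishes in time O(2^(delta n)) between all m
   clauses being satisfiable and fewer than (1 - eps) m being simultaneously
   satisfiable.  This is the deterministic form, which is implied by the form
   for randomized algorithms. *)
Definition Gap_ETH (R : realType) : Prop :=
  exists (delta eps : R) (B : nat), [/\ 0 < delta, 0 < eps &
    ~ exists (M : TM) (K : R),
      forall (n : nat) (phi : cnf3 n), (size phi <= B * n)%N ->
        exists (t : nat) (y : seq bool),
          [/\ t%:R <= K * 2 `^ (delta * n%:R),
              computes_within M t (enc_cnf3 phi) y,
              max_sat phi = size phi -> y = [:: true] &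
              (max_sat phi)%:R < (1 - eps) * (size phi)%:R ->
                y = [:: false]]].

(** * The gap problem *)

(* [M] runs in time [time n k] on every n-vertex graph and every parameter k,
   and distinguishes tree-alpha <= k from tree-alpha > gap k.  Graphs are
   nonempty, so that bounds such as f(k) n^d are meaningful. *)
Definition distinguishes_tree_alpha (R : realType) (M : TM)
    (time : nat -> nat -> R) (gap : nat -> R) : Prop :=
  forall (n : nat) (G : graph 'I_n) (k : nat), (0 < n)%N -> (0 < k)%N ->
    exists (t : nat) (y : seq bool),
      [/\ t%:R <= time n k,
          computes_within M t (enc_graph_param G k) y,
          (tree_alpha G <= k)%N -> y = [:: true] &
          gap k < (tree_alpha G)%:R -> y = [:: false]].

(* Main.v *)
(* The join of two copies of a graph H satisfies tree-alpha = alpha(H), so both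
   parts are about gaps for cliques, in the graph of compatible partial guesses.

   (a) For a circuit of weft 1 and bounded depth, having a satisfying assignment
   with k ones amounts to the existence of k + 3 numbers (the positions of the
   ones, with sentinels at both ends, and a list of nodes witnessing the value of
   the output) all of whose boundedly large subfamilies pass a test: whenever
   the assignment is not satisfying, boundedly many nodes and input values
   already refute it. The numbers are coded by a linear function on F_2^(k+3);
   a vertex claims the values of this function at boundedly many points and
   passes all the tests that these points allow. Cliques with nearly the maximal
   number of vertices decode to a linear function by linearity testing, and a
   fixed power of the graph turns this gap into any constant factor.

   (b) For fixed t, a vertex guesses the values of the literals in one of q
   pseudorandom samples, each containing a 1/t fraction of the clauses, so the
   graph has 2^O(n/t) vertices. Cliques of size q = g(k) + 1 exist when the
   formula is satisfiable; cliques of size k + 1 with k = ct give an assignment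
   satisfying all clauses met by k + 1 samples, all but a 2 / 2^c fraction. As
   s(k) = o(k), time n^s(k) is 2^(delta n) for t large. *)

From mathcomp Require Import all_boot all_order all_algebra.
From mathcomp Require Import all_classical all_reals all_analysis.
From mathcomp Require Import zify lra ring.
From mathcomp Require Import finset perm.
From Stdlib Require PeanoNat.
Require Import Defs.

Set Implicit Arguments.
Unset Strict Implicit.
Unset Printing Implicit Defensive.

(** * Programs on stacks and their compilation to Turing machines *)

(** Reductions have to be carried out by machines: stack programs are compiled to machines step for
    step, and numbers are kept in unary, so that time polynomial in the values is enough and closure
    under sums, loops and bounded quantifiers does the rest. The join is useful because every tree
    decomposition of it has a bag that contains one whole side. In (a) the obstacle is that the new
    parameter may depend on [k] only while the graph stays polynomial in the instance: the domain
    F_2^(k+3) of the linear function fixes the clique size, and its values, in F_2^h with 2^h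
    polynomial, only enlarge the graph. Tests compare differences of two vertices because the value
    at a unit vector has to be recovered from typical pairs of points, as in self-correction of
    linear functions. In (b) the samples are deterministic: membership in sample i is read off digit
    i of the clause index in base t, and over full periods of t^q the digits are independent and
    uniform. There t is chosen after the exponent of the polynomial overhead, which must therefore
    not depend on t. *)

Section Commands.
Variable A : finType.
Notation G := (bool + A)%type.

(** The registers are stacks. Branches and loop tests are functions of the top symbol; the alphabet
    is finite, so they amount to finite tables. *)
Inductive cmd :=
| Skip
| Push of nat & G
| Pop of nat
| Seq of cmd & cmd
| Case of nat & (option G -> cmd)
| While of nat & (option G -> bool) & cmd.

Definition st := nat -> seq G.
Definition upd (s : st) (r : nat) (v : seq G) : st :=
  fun i => if i == r then v else s i.

(** The costs are exactly the numbers of steps of the compiled machine. *)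
Inductive run : cmd -> st -> nat -> st -> Prop :=
| RSkip s : run Skip s 1 s
| RPush r g s : run (Push r g) s 2 (upd s r (g :: s r))
| RPop r s : run (Pop r) s 1 (upd s r (behead (s r)))
| RSeq a b s s' s'' t t' :
    run a s t s' -> run b s' t' s'' -> run (Seq a b) s (t + t').+1 s''
| RCase r k s s' t :
    run (k (ohead (s r))) s t s' -> run (Case r k) s t.+1 s'
| RWhileF r (p : option G -> bool) c s : ~~ p (ohead (s r)) -> run (While r p c) s 1 s
| RWhileT r (p : option G -> bool) c s s' s'' t t' :
    p (ohead (s r)) -> run c s t s' -> run (While r p c) s' t' s'' ->
    run (While r p c) s (t + t').+1 s''.

Fixpoint maxreg (c : cmd) : nat :=
  match c with
  | Skip => 0
  | Push r _ => r
  | Pop r => r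
  | Seq a b => maxn (maxreg a) (maxreg b)
  | Case r k => maxn r (\max_(g : option G) maxreg (k g))
  | While r _ c => maxn r (maxreg c)
  end.

(* The control state of the compiled machine is the stack of commands that
   remain to be executed; [conts c K] lists those that occur while [c] is
   executed on top of [K]. *)
Fixpoint conts (c : cmd) (K : seq cmd) : seq {classic (seq cmd)} :=
  (c :: K) ::
  match c with
  | Seq a b => conts a (b :: K) ++ conts b K
  | Case r k => flatten [seq conts (k g) K | g <- enum [set: option G]]
  | While _ _ b => conts b (c :: K)
  | _ => [::]
  end.

(** The flag [second] is set between the two halves of a [Push]: the first step rewrites the current
    symbol and moves left, the second writes the new top. [Pop] blanks the cell that it leaves, so
    everything to the left of the head stays blank. *)
Definition next (K : seq cmd) (second : bool) (rd : nat -> option G) :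
  option (seq cmd * bool * option (nat * (option G * move))) :=
  match K with
  | [::] => None
  | c :: K' =>
    match c with
    | Skip => Some (K', false, None)
    | Push r g =>
        if second then Some (K', false, Some (r, (Some g, MoveStay)))
        else Some (K, true, Some (r, (rd r, MoveLeft)))
    | Pop r => Some (K', false, Some (r, (None, MoveRight)))
    | Seq a b => Some (a :: b :: K', false, None)
    | Case r k => Some (k (rd r) :: K', false, None)
    | While r p b => Some (if p (rd r) then b :: K else K', false, None)
    end
  end.

Section Compile.
Variables (c0 : cmd) (m : nat).
Hypothesis m_gt : maxreg c0 <= m.

Definition all_conts : seq {classic (seq cmd)} := conts c0 [::] ++ [:: [::]].

Lemma conts_head c K : ((c :: K) : {classic (seq cmd)}) \in conts c K.
Proof. by case: c => *; rewrite inE eqxx. Qed.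

Definition start_cont : seq_sub all_conts.
Proof. by exists (c0 :: [::]); rewrite mem_cat conts_head. Defined.

Definition mk_cont (K : seq cmd) : seq_sub all_conts :=
  insubd start_cont (K : {classic (seq cmd)}).

Lemma mk_contK (K : seq cmd) :
  (K : {classic (seq cmd)}) \in all_conts -> val (mk_cont K) = K.
Proof. by move=> KL; rewrite /mk_cont insubdK. Qed.

(** Commands contain functions, hence the classical equality on continuations; only the finitely
    many in [all_conts] occur, and they form the set of states. *)
Definition tm_of : TM :=
  @MkTM A (seq_sub all_conts * bool)%type m (start_cont, false)
    (fun q rds =>
       let rd r := tnth rds (inord r) in
       if next (val q.1) q.2 rd is Some (K, fl, act) then
         Some ((mk_cont K, fl),
               [tuple (if act is Some (r, a) then
                         if i == inord r then a else (tnth rds i, MoveStay)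
                       else (tnth rds i, MoveStay)) | i < m.+1])
       else None).

(** A tape determines a stack only up to blanks: staying put on an unlisted cell lists it, and a
    [Pop] leaves a blank behind. *)
Definition blank_ext (l : seq (option G)) (s : seq G) :=
  exists j, l = map Some s ++ nseq j None.

Definition tape_stack (tp : tape A) (s : seq G) :=
  blank_ext tp.1 [::] /\ blank_ext tp.2 s.

Lemma blank_ext_behead l s : blank_ext l s -> blank_ext (behead l) (behead s).
Proof.
case=> j ->; case: s => [|x s] /=; last by exists j.
by case: j => [|j]; [exists 0|exists j].
Qed.

Lemma blank_ext_head l s : blank_ext l s -> head None l = ohead s.
Proof. by case=> j ->; case: s => [|x s] //=; case: j. Qed.

Lemma blank_ext_cons l s g : blank_ext l s -> blank_ext (Some g :: l) (g :: s).
Proof. by case=> j ->; exists j. Qed.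

Lemma blank_ext_hb l s : blank_ext l s ->
  blank_ext (head None l :: behead l) s.
Proof. by case=> j ->; case: s j => [|x s] [|j]; [exists 1|exists j.+1|exists 0|exists j.+1]. Qed.

Lemma blank_ext_none l : blank_ext l [::] -> blank_ext (None :: l) [::].
Proof. by case=> j ->; exists j.+1. Qed.

Definition rel_tapes (T : m.+1.-tuple (tape A)) (s : st) :=
  forall i : 'I_m.+1, tape_stack (tnth T i) (s i).

Definition step_res (q : seq cmd * bool) (T : m.+1.-tuple (tape A)) : config tm_of :=
  ((mk_cont q.1, q.2), T).

Lemma step_eq (K : seq cmd) fl (T : m.+1.-tuple (tape A)) (s : st) :
  (K : {classic (seq cmd)}) \in all_conts -> rel_tapes T s ->
  tm_step (step_res (K, fl) T) =
  omap (fun z => step_res z.1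
    [tuple (tape_act (tnth T i)
      (if z.2 is Some (r, a) then
         if i == inord r then a else (ohead (s i), MoveStay)
       else (ohead (s i), MoveStay))) | i < m.+1])
   (next K fl (fun r => ohead (s (@inord m r)))).
Proof.
move=> KL TS; rewrite /tm_step /= mk_contK //.
have rdE i : tnth (map_tuple (@tape_read A) T) i = ohead (s i).
  by rewrite tnth_map /tape_read (blank_ext_head (TS i).2).
have -> : (fun r => tnth (map_tuple (@tape_read A) T) (inord r)) =
          (fun r => ohead (s (@inord m r))).
  by apply/funext => r; rewrite rdE.
case: next => [[[K' fl'] act]|] //=.
congr Some; rewrite /step_res /=; congr (_, _).
apply: eq_from_tnth => i; rewrite !tnth_mktuple; congr tape_act.
by case: act => [[r a]|]; rewrite rdE.
Qed.

Lemma stay_rel tp s : tape_stack tp s ->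
  tape_stack (tape_act tp (ohead s, MoveStay)) s.
Proof.
case=> h1 h2; split => //=; rewrite -(blank_ext_head h2).
exact: blank_ext_hb.
Qed.

Fixpoint nsteps (M : TM) (t : nat) (c : config M) : option (config M) :=
  if t is t'.+1 then obind (@nsteps M t') (tm_step c) else Some c.

Lemma nsteps_add (M : TM) t t' (c : config M) :
  nsteps (t + t') c = obind (@nsteps M t') (nsteps t c).
Proof. by elim: t c => //= t IH c; case: tm_step => //= c'. Qed.

(** Induction on the run. The continuation [K] is arbitrary, so that the hypotheses compose for
    [Seq] and for a loop body, whose continuation begins with the loop itself. *)
Lemma run_nsteps c s t s' : run c s t s' -> forall (K : seq cmd) T,
  {subset conts c K <= all_conts} ->
  (K : {classic (seq cmd)}) \in all_conts ->
  maxreg c <= m -> rel_tapes T s ->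
  exists2 T', rel_tapes T' s' &
    nsteps t (step_res (c :: K, false) T) = Some (step_res (K, false) T').
Proof.
elim => {c s t s'}.
- move=> s K T sub KL _ TS.
  have hL : ((Skip :: K) : {classic (seq cmd)}) \in all_conts by apply: sub; exact: conts_head.
  rewrite /= (step_eq false hL TS) /=; eexists; last by [].
  by move=> i; rewrite tnth_mktuple; apply: stay_rel.
- move=> r g s K T sub KL rm TS.
  have hL : ((Push r g :: K) : {classic (seq cmd)}) \in all_conts by apply: sub; exact: conts_head.
  rewrite /= (step_eq false hL TS) /=.
  set T1 := [tuple _ | _ < _].
  (* After the move to the left, the head of tape [r] stands on a blank. *)
  have T1E i : tnth (map_tuple (@tape_read A) T1) i = if i == inord r then None else ohead (s i).
    rewrite tnth_map /T1 tnth_mktuple /tape_read; case: eqP => [->|_].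
      by case: (TS (inord r)) => h1 _; rewrite /= (blank_ext_head h1).
    by have [_ h] := stay_rel (TS i); rewrite (blank_ext_head h).
  rewrite /tm_step /= mk_contK //=.
  eexists; last by [].
  move=> i; rewrite !tnth_mktuple T1E.
  case: eqP => [->|ne].
    rewrite inordK ?ltnS //= /upd eqxx.
    case: (TS (inord r)); rewrite inordK ?ltnS // => h1 h2; split => /=.
      exact: (blank_ext_behead h1).
    by apply: blank_ext_cons; rewrite -(blank_ext_head h2); apply: blank_ext_hb.
  have ir : (i : nat) != r by apply/eqP => e; apply: ne; apply: val_inj; rewrite /= inordK // ltnS.
  by rewrite /upd (negbTE ir); do 2!apply: stay_rel.
- move=> r s K T sub KL rm TS.
  have hL : ((Pop r :: K) : {classic (seq cmd)}) \in all_conts by apply: sub; exact: conts_head.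
  rewrite /= (step_eq false hL TS) /=; eexists; last by [].
  move=> i; rewrite tnth_mktuple; case: eqP => [->|ne].
    rewrite inordK ?ltnS // /upd eqxx /=.
    case: (TS (inord r)); rewrite inordK ?ltnS // => h1 h2; split => /=.
      exact: blank_ext_none.
    exact: blank_ext_behead.
  have ir : (i : nat) != r by apply/eqP => e; apply: ne; apply: val_inj; rewrite /= inordK // ltnS.
  by rewrite /upd (negbTE ir); apply: stay_rel.
- move=> a b s s' s'' t t' _ IHa _ IHb K T sub KL rm TS.
  have hL : ((Seq a b :: K) : {classic (seq cmd)}) \in all_conts by apply: sub; exact: conts_head.
  rewrite /= (step_eq false hL TS) /=.
  set T1 := [tuple _ | _ < _].
  have T1S : rel_tapes T1 s by move=> i; rewrite /T1 tnth_mktuple; apply: stay_rel.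
  move: rm => /=; rewrite geq_max => /andP[ra rb].
  have suba : {subset conts a (b :: K) <= all_conts}.
    by move=> k hk; apply: sub; rewrite /= inE mem_cat hk orbT.
  have subb : {subset conts b K <= all_conts}.
    by move=> k hk; apply: sub; rewrite /= inE mem_cat hk !orbT.
  have [T2 T2S e2] := IHa _ _ suba (subb _ (conts_head _ _)) ra T1S.
  have [T3 T3S e3] := IHb _ _ subb KL rb T2S.
  by exists T3 => //; rewrite nsteps_add e2.
- move=> r k s s' t _ IH K T sub KL rm TS.
  have hL : ((Case r k :: K) : {classic (seq cmd)}) \in all_conts by apply: sub; exact: conts_head.
  rewrite /= (step_eq false hL TS) /=.
  set T1 := [tuple _ | _ < _].
  have T1S : rel_tapes T1 s by move=> i; rewrite /T1 tnth_mktuple; apply: stay_rel.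
  move: rm => /=; rewrite geq_max => /andP[rr rk].
  rewrite inordK ?ltnS //.
  apply: IH => //.
    move=> x hx; apply: sub; rewrite /= inE; apply/orP; right.
    by apply/flattenP; exists (conts (k (ohead (s r))) K) => //; apply: map_f; rewrite mem_enum inE.
  by apply: leq_trans rk; apply: (@leq_bigmax_cond _ _ (fun g => maxreg (k g))).
- move=> r p c s np K T sub KL rm TS.
  have hL : ((While r p c :: K) : {classic (seq cmd)}) \in all_conts by apply: sub; exact: conts_head.
  move: rm => /=; rewrite geq_max => /andP[rr rk].
  rewrite /= (step_eq false hL TS) /= inordK ?ltnS // (negbTE np); eexists; last by [].
  by move=> i; rewrite tnth_mktuple; apply: stay_rel.
move=> r p c s s' s'' t t' ps _ IHc _ IHw K T sub KL rm TS.
have hL : ((While r p c :: K) : {classic (seq cmd)}) \in all_conts by apply: sub; exact: conts_head.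
move: (rm) => /=; rewrite geq_max => /andP[rr rk].
rewrite /= (step_eq false hL TS) /= inordK ?ltnS // ps.
set T1 := [tuple _ | _ < _].
have T1S : rel_tapes T1 s by move=> i; rewrite /T1 tnth_mktuple; apply: stay_rel.
have subc : {subset conts c (While r p c :: K) <= all_conts}.
  by move=> k hk; apply: sub; rewrite /= inE hk orbT.
have [T2 T2S e2] := IHc _ _ subc hL rk T1S.
have [T3 T3S e3] := IHw _ _ sub KL rm T2S.
by exists T3 => //; rewrite nsteps_add e2.
Qed.

End Compile.

Definition init_st (x : seq bool) : st :=
  fun r => if r == 0 then [seq inl b | b <- x] else [::].

Definition lead (s : seq G) : seq bool := leading_bits [seq Some g | g <- s].

Lemma lead_bits y (s : seq G) : lead ([seq inl b | b <- y] ++ s) = y ++ lead s.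
Proof. by elim: y => //= b y IH; rewrite /lead /= -IH. Qed.

Lemma lead_inl y : lead [seq inl b | b <- y] = y.
Proof. by rewrite -[map _ _]cats0 lead_bits cats0. Qed.

Lemma nsteps_exec (M : TM) t t' (c c' : config M) : t <= t' ->
  nsteps t c = Some c' -> tm_step c' = None -> tm_exec t' c = Some c'.
Proof.
elim: t t' c => [|t IH] [|t'] c //=.
- by move=> _ [->] ->.
- by move=> _ [->] ->.
- by case: tm_step => //= c1 lt; apply: IH.
Qed.

Definition compile (c : cmd) : TM := tm_of c (maxreg c).

Lemma compileP c x s' t t' : run c (init_st x) t s' -> t <= t' ->
  computes_within (compile c) t' x (lead (s' 0)).
Proof.
move=> rn le; rewrite /computes_within /compile.
set M := tm_of _ _.
have e0 : tm_init M x = step_res c (c :: [::], false) (tm_init M x).2.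
  rewrite /tm_init /step_res /=; congr (_, _, _).
  by apply: val_inj; rewrite /= mk_contK ?mem_cat ?conts_head.
have TS : rel_tapes (tm_init M x).2 (init_st x).
  move=> i; rewrite tnth_mktuple /init_st; case: eqP => [->|ne] /=.
    by split; exists 0; rewrite //= cats0 -map_comp.
  by rewrite ifN; [split; exists 0|apply/eqP => h; apply: ne; apply: val_inj].
have [||T' T'S e] := run_nsteps rn (m := maxreg c) _ _ (leqnn _) TS (K := [::]) (c0 := c).
- by move=> k hk; rewrite mem_cat hk.
- by rewrite mem_cat inE eqxx orbT.
rewrite e0 (nsteps_exec le e) /=.
  congr Some; case: (T'S ord0) => _ [j]; rewrite /tm_output /= => ->.
  rewrite /lead; elim: (s' 0) => [|[b|a] s IH] //=; first by case: j.
  by rewrite IH.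
by rewrite /tm_step /= mk_contK ?mem_cat ?inE ?eqxx ?orbT.
Qed.

End Commands.

(** * Running times, and calling a Turing machine as a subroutine *)

Section Macros.
Variable A : finType.
Notation G := (bool + A)%type.
Notation cmd := (cmd A).
Notation st := (st A).

(** Upper bounds can be weakened, unlike the exact costs of [run]. *)
Definition runs (c : cmd) (s : st) (T : nat) (s' : st) : Prop :=
  exists2 t, t <= T & run c s t s'.

Lemma runs_le c s T T' s' : T <= T' -> runs c s T s' -> runs c s T' s'.
Proof. by move=> le [t tT r]; exists t => //; apply: leq_trans le. Qed.

Lemma runs_eq c s T s' s'' : s' =1 s'' -> runs c s T s' -> runs c s T s''.
Proof. by move=> /funext ->. Qed.

Lemma runs_skip s : runs (Skip A) s 1 s.
Proof. by exists 1 => //; constructor. Qed.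

Lemma runs_push r g s : runs (Push r g) s 2 (upd s r (g :: s r)).
Proof. by exists 2 => //; constructor. Qed.

Lemma runs_pop r s : runs (Pop A r) s 1 (upd s r (behead (s r))).
Proof. by exists 1 => //; constructor. Qed.

Lemma runs_seq a b s s' s'' T T' :
  runs a s T s' -> runs b s' T' s'' -> runs (Seq a b) s (T + T').+1 s''.
Proof.
move=> [t tT r] [t' tT' r']; exists (t + t').+1; first by rewrite ltnS leq_add.
exact: RSeq r r'.
Qed.

Lemma runs_case r (k : option G -> cmd) s s' T :
  runs (k (ohead (s r))) s T s' -> runs (Case r k) s T.+1 s'.
Proof. by move=> [t tT rn]; exists t.+1 => //; apply: RCase. Qed.

Lemma runs_whileF r (p : option G -> bool) c s :
  ~~ p (ohead (s r)) -> runs (While r p c) s 1 s.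
Proof. by move=> np; exists 1 => //; constructor. Qed.

Lemma runs_whileT r (p : option G -> bool) c s s' s'' T T' :
  p (ohead (s r)) -> runs c s T s' -> runs (While r p c) s' T' s'' ->
  runs (While r p c) s (T + T').+1 s''.
Proof.
move=> ps [t tT r1] [t' tT' r2]; exists (t + t').+1; first by rewrite ltnS leq_add.
exact: RWhileT ps r1 r2.
Qed.

Lemma updE (s : st) r v i : upd s r v i = if i == r then v else s i.
Proof. by []. Qed.

Lemma upd_id (s : st) r : upd s r (s r) = s.
Proof. by apply/funext => i; rewrite updE; case: eqP => [->|]. Qed.

Lemma upd_upd (s : st) r v w : upd (upd s r v) r w = upd s r w.
Proof. by apply/funext => i; rewrite !updE; case: eqP. Qed.

Lemma upd_same (s : st) r v : upd s r v r = v.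
Proof. by rewrite updE eqxx. Qed.

Lemma upd_other (s : st) r v i : i != r -> upd s r v i = s i.
Proof. by rewrite updE => /negbTE ->. Qed.

Definition clear (r : nat) : cmd := While r isSome (Pop A r).

Lemma runs_clear r s : runs (clear r) s (2 * size (s r)).+1 (upd s r [::]).
Proof.
move e: (s r) => l; elim: l s e => [|g l IH] s e.
  by have := upd_id s r; rewrite e => ->; apply: runs_whileF; rewrite e.
have h := runs_pop r s.
have /IH h2 : upd s r (behead (s r)) r = l by rewrite upd_same e.
rewrite upd_upd in h2.
apply: runs_le (runs_whileT _ h h2); last by rewrite e.
by rewrite /=; lia.
Qed.

Definition put (r : nat) (g : option G) : cmd :=
  if g is Some g' then Push r g' else Skip A.

Definition transfer (p : option G -> bool) (src dst : nat) : cmd :=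
  While src (fun g => isSome g && p g) (Case src (fun g => Seq (put dst g) (Pop A src))).

Definition stops (p : option G -> bool) (l : seq G) : bool :=
  if l is g :: _ then ~~ p (Some g) else true.

Lemma runs_transfer (p : option G -> bool) src dst s (l1 l2 : seq G) : src != dst ->
  s src = l1 ++ l2 -> all (fun g => p (Some g)) l1 ->
  stops p l2 ->
  runs (transfer p src dst) s (6 * size l1).+1
    (upd (upd s src l2) dst (rev l1 ++ s dst)).
Proof.
move=> ne; elim: l1 s => [|g l1 IH] s e /=.
  move=> _ h; have -> : upd (upd s src l2) dst (s dst) = s.
    apply/funext => i; rewrite !updE; case: eqP => [->|] //; case: eqP => [->|] //.
  by rewrite muln0; apply: runs_whileF; rewrite e /=; case: l2 h {e}.
move=> /andP[pg pl] h2.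
pose s1 := upd (upd s dst (g :: s dst)) src (l1 ++ l2).
have h1 : runs (Case src (fun g => Seq (put dst g) (Pop A src))) s 5 s1.
  apply: runs_case; rewrite e /=.
  have -> : s1 = upd (upd s dst (g :: s dst)) src (behead (upd s dst (g :: s dst) src)).
    by rewrite upd_other // e.
  by apply: runs_le (runs_seq (runs_push _ _ _) (runs_pop _ _)).
have := IH s1 _ pl h2; rewrite /s1 upd_same => /(_ erefl) h3.
have ps : (fun g => isSome g && p g) (ohead (s src)) by rewrite e /= pg.
have h4 := runs_whileT ps h1 h3.
have le : (5 + (6 * size l1).+1).+1 <= (6 * (size l1).+1).+1 by lia.
apply: runs_eq (runs_le le h4) => i; rewrite !updE rev_cons cat_rcons eqxx.
rewrite [dst == src]eq_sym (negbTE ne).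
by case: (i == dst); case: (i == src).
Qed.

Definition move_all := transfer xpredT.

Lemma runs_move src dst s : src != dst ->
  runs (move_all src dst) s (6 * size (s src)).+1
    (upd (upd s src [::]) dst (rev (s src) ++ s dst)).
Proof.
move=> ne; apply: (@runs_transfer xpredT src dst s (s src) [::]) => //.
  by rewrite cats0.
by apply/allP.
Qed.

Fixpoint reads (rs : seq nat) (k : seq (option G) -> cmd) : cmd :=
  if rs is r :: rs' then Case r (fun g => reads rs' (fun gs => k (g :: gs)))
  else k [::].

Lemma runs_reads rs k s T s' : runs (k [seq ohead (s r) | r <- rs]) s T s' ->
  runs (reads rs k) s (T + size rs) s'.
Proof.
elim: rs k => [|r rs IH] k /=; first by rewrite addn0.
by move=> /(IH (fun gs => k (_ :: gs))) h; rewrite addnS; apply: runs_case.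
Qed.

Definition seqs (cs : seq cmd) : cmd := foldr (@Seq A) (Skip A) cs.

Lemma runs_seqs (I : Type) (F : I -> cmd) (Inv : seq I -> st) (D : nat) (done es : seq I) :
  (forall d i es', done ++ es = d ++ i :: es' ->
     runs (F i) (Inv d) D (Inv (rcons d i))) ->
  runs (seqs [seq F i | i <- es]) (Inv done) (size es * D.+1).+1 (Inv (done ++ es)).
Proof.
elim: es done => [|i es IH] done h /=.
  by rewrite cats0; apply: runs_skip.
have h1 := h done i es erefl.
have h2 : runs (seqs [seq F i | i <- es]) (Inv (rcons done i)) (size es * D.+1).+1 (Inv (done ++ i :: es)).
  by rewrite -cat_rcons; apply: IH => d j js e; apply: (h d j js); rewrite -e cat_rcons.
by apply: runs_le (runs_seq h1 h2); rewrite mulSn; lia.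
Qed.

Lemma runs_clears (a n : nat) s (N : nat) :
  (forall i, a <= i < a + n -> size (s i) <= N) ->
  runs (seqs [seq clear i | i <- iota a n]) s (n * (2 * N).+2).+1
    (fun i => if a <= i < a + n then [::] else s i).
Proof.
move=> hN.
have e : s = (fun i => if i \in ([::] : seq nat) then [::] else s i) by [].
have := @runs_seqs nat clear (fun d i => if i \in d then [::] else s i) (2 * N).+1 [::] (iota a n).
rewrite size_iota -e => h.
apply: runs_eq (h _) => [i|d i es' /= ed]; first by rewrite mem_iota.
set s1 := (fun j => if j \in d then _ else _).
apply: runs_eq (runs_le _ (runs_clear i s1)).
  by move=> j; rewrite updE /s1 mem_rcons inE; case: eqP.
rewrite ltnS leq_mul2l /= /s1; case: (i \in d) => //; apply: hN.
by rewrite -mem_iota ed mem_cat inE eqxx orbT.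
Qed.

(** * Simulation of a Turing machine by a stack program *)

Section Simulation.
Variable M : TM.
Notation Wk := (tm_work M).
Notation m := (tm_tapes M).
Variable e : symbol Wk + tm_state M -> A.
Hypothesis e_inj : injective e.

(** Bits represent themselves, so input and output strings pass between program and machine without
    translation; all other symbols, the blank included, go through [e]. *)
Definition em (y : symbol Wk) : G :=
  match y with Some (inl b) => inl b | _ => inr (e (inl y)) end.

Lemma em_inj : injective em.
Proof.
move=> [[b|a]|] [[b'|a']|] //=.
- by case=> ->.
- by case=> /e_inj [->].
- by case=> /e_inj.
- by case=> /e_inj.
Qed.

(** The empty stack and the coded blank both decode to the blank. *)
Definition de (g : option G) : symbol Wk :=
  if g is Some x then odflt None [pick y | em y == x] else None.

Lemma deK (R : seq (symbol Wk)) : de (ohead (map em R)) = head None R.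
Proof.
case: R => [|y R] //=; case: pickP => [z /eqP /em_inj -> //|/(_ y)].
by rewrite eqxx.
Qed.

Definition dq (g : option G) : tm_state M :=
  if g is Some (inr a) then odflt (tm_start M) [pick q | e (inr q) == a]
  else tm_start M.

Lemma dqK q : dq (Some (inr (e (inr q)))) = q.
Proof.
rewrite /dq; case: pickP => [z /eqP /e_inj [->] //|/(_ q)].
by rewrite eqxx.
Qed.

(** A tape is a pair of stacks whose tops meet at the head; a left move out of the listed cells
    creates a coded blank. *)
Definition act_cmd (l r : nat) (a : symbol Wk * move) : cmd :=
  match a.2 with
  | MoveLeft => Seq (Pop A r) (Seq (Push r (em a.1))
      (Seq (Case l (fun g => Push r (if g is Some g' then g' else em None))) (Pop A l)))
  | MoveStay => Seq (Pop A r) (Push r (em a.1))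
  | MoveRight => Seq (Pop A r) (Push l (em a.1))
  end.

Lemma runs_act l r a s (tp : tape Wk) : l != r ->
  s l = map em tp.1 -> s r = map em tp.2 ->
  runs (act_cmd l r a) s 12
    (upd (upd s l (map em (tape_act tp a).1)) r (map em (tape_act tp a).2)).
Proof.
case: tp => L R /= ne sl sr; case: a => a mv; have ne' : r != l by rewrite eq_sym.
case: mv; rewrite /act_cmd /tape_act /=.
- apply: runs_eq; last first.
    apply: runs_le; last first.
      apply: runs_seq (runs_pop _ _) _; apply: runs_seq (runs_push _ _ _) _.
      by apply: runs_seq (runs_pop _ _); apply: runs_case; apply: runs_push.
    by [].
  move=> i; rewrite !(updE, eqxx, negbTE ne) sr sl.
  case: (eqVneq i r) => [->|nir].
    by rewrite (negbTE ne'); case: L R {sl sr} => [|x L] [|y R].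
  by case: eqP => // _; case: (L).
- apply: runs_eq; last first.
    apply: runs_le; last exact: runs_seq (runs_pop _ _) (runs_push _ _ _).
    by [].
  move=> i; rewrite !(updE, eqxx) sr.
  case: (eqVneq i r) => // nir; last by case: eqP => // ->; rewrite sl.
  by case: (R).
apply: runs_eq; last first.
  apply: runs_le; last exact: runs_seq (runs_pop _ _) (runs_push _ _ _).
  by [].
move=> i; rewrite !(updE, negbTE ne) sr sl.
case: (eqVneq i r) => [->|nir]; last by case: eqP.
by rewrite (negbTE ne'); case: (R).
Qed.

Section AtBase.
Variable b : nat.

Definition rreg (i : nat) := b + i.*2.
Definition lreg (i : nat) := (b + i.*2).+1.
Definition qreg := b + m.+1.*2.

(** From [b] on, right and left halves of the tapes alternate; they are followed by the state
    register, which is empty once the simulated machine has halted. *)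
Definition sim_st (s0 : st) (q : option (tm_state M)) (T : m.+1.-tuple (tape Wk)) : st :=
  fun i => if i < b then s0 i else
    if i == qreg then (if q is Some q' then [:: inr (e (inr q'))] else [::]) else
    if i < qreg then
      let tp := tnth T (inord (i - b)./2) in
      if odd (i - b) then map em tp.1 else map em tp.2
    else [::].

Definition sim_body : cmd :=
  Case qreg (fun g =>
    reads [seq rreg i | i <- iota 0 m.+1] (fun gs =>
      match tm_trans (dq g) [tuple nth None (map de gs) i | i < m.+1] with
      | None => Pop A qreg
      | Some (q', acts) => Seq (Seq (Pop A qreg) (Push qreg (inr (e (inr q')))))
          (seqs [seq act_cmd (lreg i) (rreg i) (tnth acts i) | i : 'I_m.+1 <- enum 'I_m.+1])
      end)).

Definition sim_loop : cmd := While qreg isSome sim_body.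

Lemma sim_rreg s0 q T (i : 'I_m.+1) : sim_st s0 q T (rreg i) = map em (tnth T i).2.
Proof.
rewrite /sim_st /rreg /qreg; have := ltn_ord i => lti.
have -> : b + (i : nat).*2 < b = false by lia.
have -> : (b + (i : nat).*2 == b + m.+1.*2) = false by lia.
have -> : b + (i : nat).*2 < b + m.+1.*2 by lia.
have -> : b + (i : nat).*2 - b = (i : nat).*2 by lia.
by rewrite odd_double doubleK inord_val.
Qed.

Lemma sim_lreg s0 q T (i : 'I_m.+1) : sim_st s0 q T (lreg i) = map em (tnth T i).1.
Proof.
rewrite /sim_st /lreg /qreg; have := ltn_ord i => lti.
have -> : (b + (i : nat).*2).+1 < b = false by lia.
have -> : ((b + (i : nat).*2).+1 == b + m.+1.*2) = false by lia.
have -> : (b + (i : nat).*2).+1 < b + m.+1.*2 by lia.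
have -> : (b + (i : nat).*2).+1 - b = ((i : nat).*2).+1 by lia.
by rewrite /= odd_double /= uphalf_double inord_val.
Qed.

Lemma sim_qreg s0 q T : sim_st s0 (Some q) T qreg = [:: inr (e (inr q))].
Proof. by rewrite /sim_st eqxx ifN // /qreg; lia. Qed.

Lemma sim_upd_q s0 q q' T l :
  l = (if q' is Some q' then [:: inr (e (inr q'))] else [::]) ->
  upd (sim_st s0 q T) qreg l = sim_st s0 q' T.
Proof.
move=> ->; apply/funext => i; rewrite updE /sim_st.
by case: (eqVneq i qreg) => [->|//]; rewrite ifN // /qreg; lia.
Qed.

Definition mix (T : m.+1.-tuple (tape Wk)) (acts : m.+1.-tuple (symbol Wk * move))
  (d : seq 'I_m.+1) : m.+1.-tuple (tape Wk) :=
  [tuple if i \in d then tape_act (tnth T i) (tnth acts i) else tnth T i | i < m.+1].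

Lemma sim_upd_tape s0 q T T' (i : 'I_m.+1) :
  (forall j, j != i -> tnth T' j = tnth T j) ->
  upd (upd (sim_st s0 q T) (lreg i) (map em (tnth T' i).1)) (rreg i) (map em (tnth T' i).2)
  = sim_st s0 q T'.
Proof.
move=> h; apply/funext => r; rewrite !updE.
case: (eqVneq r (rreg i)) => [->|nr]; first by rewrite sim_rreg.
case: (eqVneq r (lreg i)) => [->|nl]; first by rewrite sim_lreg.
rewrite /sim_st; case: ifP => // rb; case: ifP => // rq; case: ifP => // rlt.
rewrite h //; apply/eqP => /(congr1 val) /=; rewrite inordK; last by move: rlt; rewrite /qreg; lia.
move: nr nl; rewrite /rreg /lreg => /eqP nr /eqP nl.
by have := odd_double_half (r - b); case: odd => /=; lia.
Qed.

Lemma sim_step s0 q T :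
  runs sim_body (sim_st s0 (Some q) T) (15 * m.+1 + 15)
    (if tm_step (q, T) is Some c then sim_st s0 (Some c.1) c.2 else sim_st s0 None T).
Proof.
rewrite /sim_body.
have -> : 15 * m.+1 + 15 = (14 * m.+1 + 14 + m.+1).+1 by lia.
apply: runs_case; rewrite sim_qreg [ohead _]/=.
apply: (@runs_le _ _ (14 * m.+1 + 14 + size [seq rreg i | i <- iota 0 m.+1])).
  by rewrite size_map size_iota.
apply: runs_reads.
rewrite (dqK q) /tm_step.
have -> : [tuple nth None [seq de i0 | i0 <- [seq ohead (sim_st s0 (Some q) T r) | r <- [seq rreg i | i <- iota 0 m.+1]]] i | i < m.+1] = map_tuple (@tape_read _) T.
  apply: eq_from_tnth => i; rewrite tnth_mktuple tnth_map -!map_comp.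
  by rewrite (nth_map 0) ?size_iota // nth_iota //= add0n sim_rreg deK.
case: tm_trans => [[q' acts]|]; last first.
  have <- : upd (sim_st s0 (Some q) T) qreg (behead (sim_st s0 (Some q) T qreg)) = sim_st s0 None T.
    by apply: sim_upd_q; rewrite sim_qreg.
  by apply: runs_le (runs_pop _ _); lia.
have h1 : runs (Seq (Pop A qreg) (Push qreg (inr (e (inr q'))))) (sim_st s0 (Some q) T) 4 (sim_st s0 (Some q') T).
  have h := runs_seq (runs_pop qreg (sim_st s0 (Some q) T)) (runs_push qreg (inr (e (inr q'))) _).
  by move: h; rewrite !upd_upd upd_same sim_qreg (@sim_upd_q s0 (Some q) (Some q')).
have h2 : runs (seqs [seq act_cmd (lreg i) (rreg i) (tnth acts i) | i : 'I_m.+1 <- enum 'I_m.+1])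
   (sim_st s0 (Some q') T) (m.+1 * 13).+1 (sim_st s0 (Some q') [tuple tape_act (tnth T i) (tnth acts i) | i < m.+1]).
  have -> : T = mix T acts [::] by apply: eq_from_tnth => i; rewrite tnth_mktuple.
  have -> : [tuple tape_act (tnth (mix T acts [::]) i) (tnth acts i) | i < m.+1] = mix T acts ([::] ++ enum 'I_m.+1).
    by apply: eq_from_tnth => i; rewrite !tnth_mktuple mem_enum.
  apply: runs_le (@runs_seqs 'I_m.+1 (fun i : 'I_m.+1 => act_cmd (lreg i) (rreg i) (tnth acts i)) (fun d => sim_st s0 (Some q') (mix T acts d)) 12 [::] (enum 'I_m.+1) _).
    by rewrite size_enum_ord.
  move=> d i es' ed.
  have id : i \notin d.
    have := enum_uniq 'I_m.+1; rewrite -[enum _]cat0s ed cat_uniq => /and3P[_ /hasPn h _].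
    by apply: h; rewrite inE eqxx.
  have := @runs_act (lreg i) (rreg i) (tnth acts i) (sim_st s0 (Some q') (mix T acts d)) (tnth (mix T acts d) i).
  rewrite sim_lreg sim_rreg => h; apply: runs_eq (h _ erefl erefl); last by rewrite /lreg /rreg; lia.
  have e1 : tape_act (tnth (mix T acts d) i) (tnth acts i) = tnth (mix T acts (rcons d i)) i.
    by rewrite !tnth_mktuple (negbTE id) mem_rcons inE eqxx.
  rewrite e1 => r; rewrite sim_upd_tape // => j ji.
  by rewrite !tnth_mktuple mem_rcons inE (negbTE ji).
by apply: runs_le (runs_seq h1 h2); lia.
Qed.

Definition tapes_size (T : m.+1.-tuple (tape Wk)) N :=
  forall i, size (tnth T i).1 <= N /\ size (tnth T i).2 <= N.

Lemma tapes_size_le T N N' : N <= N' -> tapes_size T N -> tapes_size T N'.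
Proof.
by move=> le h i; case: (h i) => h1 h2; split; [apply: leq_trans h1 le|apply: leq_trans h2 le].
Qed.

(** A step adds at most two cells to a half tape: a left move lists the current cell and the one to
    its left. The bound on the sizes pays for clearing the tapes afterwards. *)
Lemma sim_loopP s0 t q T c' N : tm_exec t (q, T) = Some c' -> tapes_size T N ->
  runs sim_loop (sim_st s0 (Some q) T) (t.+1 * (15 * m.+1 + 17)) (sim_st s0 None c'.2)
  /\ tapes_size c'.2 (N + 2 * t).
Proof.
elim: t q T N => [|t IH] q T N /=; have := @sim_step s0 q T.
  case: tm_step => // h [<-] TN /=; split; last by rewrite addn0.
  apply: runs_le (runs_whileT _ h (runs_whileF _ _)); rewrite ?sim_qreg //; first lia.
  by rewrite /sim_st eqxx; case: ifP => //; rewrite /qreg; lia.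
case ts: tm_step => [[q1 T1]|] h /=.
  move=> ex TN; have /(IH _ _ (N + 2)) : tm_exec t (q1, T1) = Some c' by [].
  case.
    move: ts; rewrite /tm_step /=; case: tm_trans => // -[q2 acts] [_ <-] i.
    rewrite tnth_mktuple; case: (TN i) => h1 h2; rewrite /tape_act.
    case: (tnth T i) h1 h2 => L R /= h1 h2.
    have hL : size (behead L) <= N by rewrite size_behead; apply: leq_trans (leq_pred _) h1.
    have hR : size (behead R) <= N by rewrite size_behead; apply: leq_trans (leq_pred _) h2.
    have w2 k : k <= N -> k <= N.+2 by move=> h0; apply: leqW; apply: leqW.
    have w1 k : k <= N -> k <= N.+1 by apply: leqW.
    case: ((tnth acts i).2) => /=; split; rewrite ?addn2 ?ltnS //; do ?[exact: w1|exact: w2].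
  move=> h2 h3; split; last by apply: tapes_size_le h3; lia.
  by apply: runs_le (runs_whileT _ h h2); [lia|rewrite sim_qreg].
move=> [<-] TN; split; last by apply: tapes_size_le TN; lia.
apply: runs_le (runs_whileT _ h (runs_whileF _ _)); rewrite ?sim_qreg //; first lia.
by rewrite /sim_st eqxx; case: ifP => //; rewrite /qreg; lia.
Qed.

Definition is_bit (g : option G) := if g is Some (inl _) then true else false.

(** Register [b] is the right half of tape 0, so the input is already in place. At the end the
    leading bits are parked in [b.+1] while the rest of the tape is erased. *)
Definition call : cmd :=
  Seq (Push qreg (inr (e (inr (tm_start M)))))
  (Seq sim_loop
  (Seq (seqs [seq clear i | i <- iota b.+1 m.*2.+1])
  (Seq (transfer is_bit b b.+1) (Seq (clear b) (move_all b.+1 b))))).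

Definition call_cost := 200 * m.+1.

Lemma lead_em (R : seq (symbol Wk)) : exists2 l2 : seq G,
   map em R = [seq inl x | x <- leading_bits R] ++ l2 &
   stops is_bit l2.
Proof.
elim: R => [|[[x|a]|] R [l2 e2 h]] //=; first by exists [::].
- by exists l2 => //; rewrite e2.
- by exists (inr (e (inl (Some (inr a)))) :: map em R).
- by exists (inr (e (inl None)) :: map em R).
Qed.

Lemma callP t x y s : computes_within M t x y ->
  s b = [seq inl z | z <- x] -> (forall i, b < i -> s i = [::]) ->
  runs call s (call_cost * (t + size x).+1) (upd s b [seq inl z | z <- y])
  /\ size y <= size x + 2 * t.
Proof.
move=> cw sb sb0.
move: cw; rewrite /computes_within; case ex: tm_exec => [c'|] //= [yE].
have T0N : tapes_size (tm_init M x).2 (size x).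
  by move=> i; rewrite tnth_mktuple; case: ifP => //= _; rewrite size_map.
have [h2 h2N] := sim_loopP s ex T0N.
have h1 : runs (Push qreg (inr (e (inr (tm_start M))))) s 2 (sim_st s (Some (tm_start M)) (tm_init M x).2).
  apply: runs_eq (runs_push _ _ _) => i; rewrite updE /sim_st.
  have e1 : qreg - b = m.+1.*2 by rewrite /qreg; lia.
  case: (ltnP i b) => ib.
    by rewrite ifN // /qreg; lia.
  case: (eqVneq i qreg) => [_|nq]; first by rewrite sb0 // /qreg; lia.
  case: (ltnP i qreg) => iq; last by apply: sb0; move: iq; rewrite /qreg; lia.
  rewrite tnth_mktuple; case: (eqVneq i b) => [->|nb].
    rewrite subnn /= sb.
    have -> : (inord 0 == ord0 :> 'I_m.+1) by apply/eqP/val_inj; rewrite /= inordK.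
    by rewrite -map_comp; apply: eq_map.
  rewrite sb0; last by lia.
  case: ifP => [od|ev]; case: ifP => //.
  move=> /eqP /(congr1 val) /=; rewrite inordK; last by move: iq; rewrite /qreg; lia.
  by have := odd_double_half (i - b); rewrite ev; lia.
set N := size x + 2 * t in h2N.
set s2 := sim_st s None c'.2 in h2.
have s2N i : b <= i -> size (s2 i) <= N.
  move=> bi; rewrite /s2 /sim_st ltnNge bi /=; case: ifP => // _; case: ifP => // _.
  by case: (h2N (inord (i - b)./2)) => ? ?; case: odd; rewrite size_map.
have h3 := @runs_clears b.+1 m.*2.+1 s2 N (fun i hi => s2N i (ltnW (proj1 (andP hi)))).
pose s3 : st := fun i => if b < i < b.+1 + m.*2.+1 then [::] else s2 i.
rewrite -/s3 in h3.
have s3b : s3 b = map em (tnth c'.2 ord0).2.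
  rewrite /s3 ltnn /= /s2.
  have -> : b = rreg (ord0 : 'I_m.+1) by rewrite /rreg /= addn0.
  by rewrite sim_rreg.
have s3N := s2N b (leqnn b); rewrite [s2 b](_ : _ = s3 b) in s3N; last by rewrite /s3 ltnn.
have [l2 e2 l2P] := lead_em (tnth c'.2 ord0).2.
have yE' : leading_bits (tnth c'.2 ord0).2 = y by rewrite -yE.
rewrite yE' in e2.
have h4 := @runs_transfer is_bit b b.+1 s3 [seq inl z | z <- y] l2.
have nb : b != b.+1 by lia.
have nb' : b.+1 != b by lia.
have e3 : s3 b = [seq inl z | z <- y] ++ l2 by rewrite s3b.
have {}h4 := h4 nb e3.
rewrite all_map in h4; have {}h4 := h4 (introT allP (fun z _ => erefl)).
have {}h4 := h4 l2P.
have s3b1 : s3 b.+1 = [::] by rewrite /s3 leqnn /=; case: ltnP => //; lia.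
rewrite s3b1 cats0 in h4.
set s4 := upd _ _ _ in h4.
have h5 := runs_clear b s4.
set s5 := upd _ _ _ in h5.
have h6 := @runs_move b.+1 b s5 nb'.
have s4b : s4 b = l2 by rewrite /s4 upd_other // upd_same.
have s5b1 : s5 b.+1 = rev [seq inl z | z <- y] by rewrite /s5 upd_other // /s4 upd_same.
have s5b : s5 b = [::] by rewrite /s5 upd_same.
have sz : size y + size l2 <= N.
  by move: s3N; rewrite s3b e2 size_cat size_map.
split; last lia.
have h := runs_seq h1 (runs_seq h2 (runs_seq h3 (runs_seq h4 (runs_seq h5 h6)))).
suff e4 : forall i, upd (upd s5 b.+1 [::]) b (rev (s5 b.+1) ++ s5 b) i = upd s b [seq inl z | z <- y] i.
  apply: runs_eq e4 (runs_le _ h).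
  rewrite s4b s5b1 size_rev !size_map /call_cost.
  by move: sz; rewrite /N; nia.
  move=> i; rewrite s5b1 s5b revK cats0 !updE.
  case: (eqVneq i b) => // nib; case: (eqVneq i b.+1) => [->|nib1]; first by rewrite sb0.
  rewrite /s5 /s4 !updE (negbTE nib) (negbTE nib1) /s3.
  case: ifP => [|hi]; first by move=> ?; rewrite sb0 //; lia.
  rewrite /s2 /sim_st; case: ifP => // ib.
  have -> : i < qreg = false by move: hi; rewrite /qreg; lia.
  by rewrite if_same sb0 //; lia.
Qed.

End AtBase.
End Simulation.
End Macros.

(** * Functions computable in polynomial time *)

Section PolyBounded.
Variable T : Type.
Implicit Types S f g : T -> nat.

(** The base is at least 2, so constants and sums are absorbed by a larger exponent. *)
Definition pbd S f : Prop := exists c, forall t, f t <= (S t + 2) ^ c.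

Lemma pbd_le S f g : (forall t, f t <= g t) -> pbd S g -> pbd S f.
Proof. by move=> le [c h]; exists c => t; apply: leq_trans (le t) (h t). Qed.

Lemma pbd_const S c : pbd S (fun _ => c).
Proof.
exists c => t; apply: leq_trans (ltnW (ltn_expl c _)) _; first exact: (ltnSn 1).
by case: c => // c; rewrite leq_exp2r // leq_addl.
Qed.

Lemma pbd_size S : pbd S S.
Proof. by exists 1 => t; rewrite expn1 leq_addr. Qed.

Lemma pbd_mul S f g : pbd S f -> pbd S g -> pbd S (fun t => f t * g t).
Proof. by move=> [c hc] [d hd]; exists (c + d) => t; rewrite expnD leq_mul. Qed.

Lemma pbd_add S f g : pbd S f -> pbd S g -> pbd S (fun t => f t + g t).
Proof.
move=> [c hc] [d hd]; exists (c + d).+1 => t; rewrite expnS.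
have h1 : (S t + 2) ^ c <= (S t + 2) ^ (c + d) by rewrite leq_exp2l ?leq_addr; lia.
have h2 : (S t + 2) ^ d <= (S t + 2) ^ (c + d) by rewrite leq_exp2l ?leq_addl; lia.
have := hc t; have := hd t; nia.
Qed.

Lemma pbd_exp S f d : pbd S f -> pbd S (fun t => f t ^ d).
Proof.
move=> hf; elim: d => [|d IH].
  by apply: pbd_le (pbd_const S 1) => t; rewrite expn0.
by apply: pbd_le (pbd_mul hf IH) => t; rewrite expnS.
Qed.

Lemma pbd_succ S f : pbd S f -> pbd S (fun t => (f t).+1).
Proof.
by move=> hf; apply: pbd_le (pbd_add hf (pbd_const S 1)) => t; rewrite addn1.
Qed.

End PolyBounded.

Lemma pbd_comp (T U : Type) (S : T -> nat) (S' : U -> nat) (h : T -> U) (f : U -> nat) :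
  pbd S (fun t => S' (h t)) -> pbd S' f -> pbd S (fun t => f (h t)).
Proof.
move=> hS [c hc].
by apply: pbd_le (pbd_exp c (pbd_add hS (pbd_const S 2))) => t; apply: hc.
Qed.

Section PT.
Variable A : finType.
Notation G := (bool + A)%type.
Notation cmd := (cmd A).
Notation st := (st A).

Definition un (n : nat) : seq G := nseq n (inl true).

Lemma rev_un n : rev (un n) = un n.
Proof. exact: rev_nseq. Qed.

Lemma un_cat m n : un m ++ un n = un (m + n).
Proof. by rewrite /un nseqD. Qed.

Section Class.
Variable T : Type.
Variables (X : T -> seq bool) (S : T -> nat) (B : seq (T -> nat)).

(* The programs [P rs b] read the input [X t] in register 0 and the values
   [B t] in the registers [rs], both of which they preserve, use the registers
   from [b] on as work space and leave the result in register [b]. *)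
Definition pt (f : T -> nat) : Prop :=
  exists (P : seq nat -> nat -> cmd) (tau : T -> nat),
    [/\ pbd S f, pbd S tau &
    forall t rs b s, 0 < b -> all (fun r => r < b) rs ->
      s 0 = [seq inl x | x <- X t] ->
      [seq s r | r <- rs] = [seq un (g t) | g <- B] ->
      (forall i, b <= i -> s i = [::]) ->
      runs (P rs b) s (tau t) (upd s b (un (f t)))].

Lemma pt_ext f g : f =1 g -> pt f -> pt g.
Proof. by move=> /funext ->. Qed.

Lemma pt_pbd f : pt f -> pbd S f.
Proof. by case=> P [tau []]. Qed.

(* The side conditions of a program started at [b'] after some registers in
   [b, b') have been written. *)
Lemma frame_ok (rs : seq nat) b b' (s s' : st) t :
  0 < b -> b <= b' -> all (fun r => r < b) rs ->
  s 0 = [seq inl x | x <- X t] ->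
  [seq s r | r <- rs] = [seq un (g t) | g <- B] ->
  (forall i, i < b -> s' i = s i) ->
  [/\ 0 < b', all (fun r => r < b') rs, s' 0 = [seq inl x | x <- X t] &
      [seq s' r | r <- rs] = [seq un (g t) | g <- B]].
Proof.
move=> b0 bb ars s0 srs e; split.
- exact: leq_trans bb.
- by apply: sub_all ars => r rb; apply: leq_trans rb bb.
- by rewrite e.
- by rewrite -srs; apply/eq_in_map => r rr; apply: e; apply: (allP ars).
Qed.

Fixpoint pushn (b n : nat) : cmd :=
  if n is n'.+1 then Seq (Push b (inl true)) (pushn b n') else Skip A.

Lemma runs_pushn b n (s : st) : runs (pushn b n) s (3 * n).+1 (upd s b (un n ++ s b)).
Proof.
elim: n s => [|n IH] s /=; first by rewrite upd_id muln0; apply: runs_skip.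
have h := runs_seq (runs_push b (inl true) s) (IH _).
rewrite upd_upd upd_same in h.
have -> : upd s b (inl true :: un n ++ s b) = upd s b (un n ++ inl true :: s b).
  by congr upd; rewrite -cat1s -[_ :: s b]cat1s !catA; congr cat; rewrite (un_cat 1) (un_cat n 1) addnC.
by apply: runs_le h; lia.
Qed.

Lemma pt_const n : pt (fun _ => n).
Proof.
exists (fun _ b => pushn b n), (fun _ => (3 * n).+1); split; try exact: pbd_const.
move=> t rs b s b0 _ _ _ sb.
by have := runs_pushn b n s; rewrite sb // cats0.
Qed.

(* [Inv i] is the state before the [i]-th round. *)
Lemma runs_for r body (Inv : nat -> st) D n :
  (forall i, i <= n -> Inv i r = un (n - i)) ->
  (forall i, i < n -> runs body (upd (Inv i) r (un (n - i.+1))) D (Inv i.+1)) ->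
  runs (While r isSome (Seq (Pop A r) body)) (Inv 0) (n * (D + 3)).+1 (Inv n).
Proof.
move=> hr hb; suff : forall k i, i + k = n ->
    runs (While r isSome (Seq (Pop A r) body)) (Inv i) (k * (D + 3)).+1 (Inv n).
  by move=> /(_ n 0); apply.
elim=> [|k IH] i ik.
  move: ik; rewrite addn0 => ->; rewrite mul0n; apply: runs_whileF.
  by rewrite hr // subnn.
have lt : i < n by lia.
have e : Inv i r = un (n - i.+1).+1 by rewrite hr ?(ltnW lt) //; congr un; lia.
have h := runs_pop r (Inv i); rewrite e /= in h.
have h2 := runs_seq h (hb i lt).
have ps : isSome (ohead (Inv i r)) by rewrite e.
apply: runs_le (runs_whileT (p := isSome) ps h2 (IH i.+1 _)); last by lia.
lia.
Qed.

Definition copy_cmd (r b : nat) : cmd :=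
  Seq (move_all A r b.+1)
    (While b.+1 isSome (Seq (Pop A b.+1) (Seq (Push r (inl true)) (Push b (inl true))))).

Lemma runs_copy r b (s : st) n : r < b -> s r = un n -> s b = [::] -> s b.+1 = [::] ->
  runs (copy_cmd r b) s (14 * n).+3 (upd s b (un n)).
Proof.
move=> rb sr sb sb1.
have ne : r != b.+1 by lia.
have h1 := runs_move s ne; rewrite sr sb1 cats0 rev_un size_nseq in h1.
pose Inv i := upd (upd (upd s r (un i)) b (un i)) b.+1 (un (n - i)).
have e0 : upd (upd s r [::]) b.+1 (un n) = Inv 0.
  apply/funext => i; rewrite /Inv !updE subn0; case: eqP => // _; case: (eqVneq i b) => [->|//].
  by rewrite ifN ?sb //; lia.
rewrite e0 in h1.
have en : Inv n = upd s b (un n).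
  apply/funext => i; rewrite /Inv !updE subnn; case: eqP => [->|_].
    by rewrite ifN ?sb1 //; lia.
  by case: eqP => // _; case: eqP => // ->.
have h2 : runs (While b.+1 isSome (Seq (Pop A b.+1) (Seq (Push r (inl true)) (Push b (inl true)))))
   (Inv 0) (n * (5 + 3)).+1 (Inv n).
  apply: (@runs_for b.+1) => i ltin; first by rewrite /Inv upd_same.
  apply: runs_eq (runs_seq (runs_push _ _ _) (runs_push _ _ _)) => j.
  have n1 : (b == r) = false by lia.
  have n2 : (b == b.+1) = false by lia.
  have n3 : (r == b.+1) = false by lia.
  have n4 : (r == b) = false by lia.
  rewrite /Inv !(updE, eqxx, n1, n2, n3, n4); case: (eqVneq j b) => [->|nb]; first by rewrite n2.
  case: (eqVneq j r) => [->|nr]; first by rewrite n3.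
  by case: eqP.
rewrite en in h2.
by apply: runs_le (runs_seq h1 h2); lia.
Qed.

Lemma pt_var i : i < size B -> pbd S (nth (fun _ => 0) B i) -> pt (nth (fun _ => 0) B i).
Proof.
move=> iB hb; exists (fun rs b => copy_cmd (nth 0 rs i) b), (fun t => (14 * nth (fun _ => 0) B i t).+3).
split => //.
  by do 3!apply: pbd_succ; apply: pbd_mul => //; apply: pbd_const.
move=> t rs b s b0 ars s0 srs sb.
have szr : size rs = size B by rewrite -(size_map s) srs size_map.
have ir : i < size rs by rewrite szr.
apply: runs_copy; [|clear sb|exact: sb|exact: sb]; first by apply: (allP ars); apply: mem_nth.
by rewrite -(nth_map 0 [::] s) // srs (nth_map (fun _ => 0)).
Qed.

Lemma pt_add f g : pt f -> pt g -> pt (fun t => f t + g t).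
Proof.
move=> [P [tau [bf btau hP]]] [Q [rho [bg brho hQ]]].
exists (fun rs b => Seq (P rs b) (Seq (Q rs b.+1) (move_all A b.+1 b))).
exists (fun t => (tau t + (rho t + (6 * g t).+1).+1).+1); split.
- exact: pbd_add.
- by apply: pbd_succ; apply: pbd_add => //; apply: pbd_succ; apply: pbd_add => //;
    apply: pbd_succ; apply: pbd_mul => //; apply: pbd_const.
move=> t rs b s b0 ars s0 srs sb.
have h1 := hP t rs b s b0 ars s0 srs sb.
set s1 := upd s b _ in h1.
have e1 i : i < b -> s1 i = s i by move=> ib; rewrite /s1 upd_other //; lia.
have [b1 ars1 s10 srs1] := frame_ok b0 (leqnSn b) ars s0 srs e1.
have sb1 i : b < i -> s1 i = [::] by move=> ib; rewrite /s1 upd_other ?sb //; lia.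
have h2 := hQ t rs b.+1 s1 b1 ars1 s10 srs1 sb1.
set s2 := upd s1 _ _ in h2.
have ne : b.+1 != b by lia.
have h3 := runs_move s2 ne.
have e3 : s2 b.+1 = un (g t) by rewrite /s2 upd_same.
have e4 : s2 b = un (f t) by rewrite /s2 upd_other ?/s1 ?upd_same //; lia.
rewrite e3 e4 rev_un un_cat size_nseq in h3.
apply: runs_eq (runs_seq h1 (runs_seq h2 h3)) => i.
rewrite !updE addnC; case: (eqVneq i b) => // nb; case: (eqVneq i b.+1) => [->|nb1]; first by rewrite sb.
by rewrite /s2 /s1 !updE (negbTE nb) (negbTE nb1).
Qed.

Lemma pt_sub f g : pt f -> pt g -> pt (fun t => f t - g t).
Proof.
move=> [P [tau [bf btau hP]]] [Q [rho [bg brho hQ]]].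
exists (fun rs b => Seq (P rs b) (Seq (Q rs b.+1)
   (While b.+1 isSome (Seq (Pop A b.+1) (Pop A b))))).
exists (fun t => (tau t + (rho t + (g t * (1 + 3)).+1).+1).+1); split.
- by apply: pbd_le bf => t; apply: leq_subr.
- by apply: pbd_succ; apply: pbd_add => //; apply: pbd_succ; apply: pbd_add => //;
    apply: pbd_succ; apply: pbd_mul => //; apply: pbd_const.
move=> t rs b s b0 ars s0 srs sb.
have h1 := hP t rs b s b0 ars s0 srs sb.
set s1 := upd s b _ in h1.
have e1 i : i < b -> s1 i = s i by move=> ib; rewrite /s1 upd_other //; lia.
have [b1 ars1 s10 srs1] := frame_ok b0 (leqnSn b) ars s0 srs e1.
have sb1 i : b < i -> s1 i = [::] by move=> ib; rewrite /s1 upd_other ?sb //; lia.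
have h2 := hQ t rs b.+1 s1 b1 ars1 s10 srs1 sb1.
pose Inv i := upd (upd s b (un (f t - i))) b.+1 (un (g t - i)).
have e2 : upd s1 b.+1 (un (g t)) = Inv 0 by rewrite /Inv /s1 !subn0.
rewrite e2 in h2.
have h3 : runs (While b.+1 isSome (Seq (Pop A b.+1) (Pop A b))) (Inv 0) (g t * (1 + 3)).+1 (Inv (g t)).
  apply: (@runs_for b.+1) => i lt; first by rewrite /Inv upd_same.
  apply: runs_eq (runs_pop _ _) => j; rewrite /Inv !updE.
  rewrite (_ : b == b.+1 = false) ?eqxx; last by lia.
  case: (eqVneq j b) => [->|nb]; last by case: eqP.
  by rewrite (_ : b == b.+1 = false); [rewrite /un subnS; case: (f t - i)|lia].
apply: runs_eq (runs_seq h1 (runs_seq h2 h3)) => i.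
rewrite /Inv subnn !updE; case: (eqVneq i b.+1) => [->|//].
by rewrite ifN ?sb //; lia.
Qed.

Definition skip_cmd (b : nat) : cmd :=
  While b isSome (Seq (Pop A b)
    (Case 0 (fun g => Seq (put b.+1 g) (Pop A 0)))).

(** The first [f t] symbols of the input are parked in reverse order in register [b.+1] and put back
    after the next symbol has been inspected. *)
Lemma pt_bit f : pbd S (fun t => size (X t)) -> pt f ->
  pt (fun t => nat_of_bool (nth false (X t) (f t))).
Proof.
move=> hX [P [tau [bf btau hP]]].
exists (fun rs b => Seq (P rs b) (Seq (skip_cmd b)
  (Seq (Case 0 (fun g => if g is Some (inl true) then Push b (inl true) else Skip A))
    (move_all A b.+1 0)))).
exists (fun t => (tau t + ((f t * (5 + 3)).+1 + (3 + (6 * size (X t)).+1).+1).+1).+1); split.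
- by apply: pbd_le (pbd_const S 1) => t; case: nth.
- apply: pbd_succ; apply: pbd_add => //; apply: pbd_succ; apply: pbd_add.
    by apply: pbd_succ; apply: pbd_mul => //; apply: pbd_const.
  apply: pbd_succ; apply: pbd_add; first exact: pbd_const.
  by apply: pbd_succ; apply: pbd_mul => //; apply: pbd_const.
move=> t rs b s b0 ars s0 srs sb.
have h1 := hP t rs b s b0 ars s0 srs sb.
have n1 : (b == b.+1) = false by lia.
have n2 : (b.+1 == b) = false by lia.
have n3 : (b == 0) = false by lia.
have n4 : (0 == b) = false by lia.
have n5 : (0 == b.+1) = false by lia.
have n6 : (b.+1 == 0) = false by lia.
pose nE := (updE, eqxx, n1, n2, n3, n4, n5, n6).
have sb0 := sb b (leqnn b); have sb1 := sb b.+1 (leqnSn b).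
clear hP srs ars sb.
set x := [seq inl z | z <- X t] in s0 *.
pose Inv i := upd (upd (upd s b (un (f t - i))) 0 (drop i x : seq G)) b.+1 (rev (take i x)).
have e1 : upd s b (un (f t)) = Inv 0.
  apply/funext => i; rewrite /Inv subn0 drop0 take0 !updE.
  case: (eqVneq i b.+1) => [->|_]; first by rewrite n2 sb1.
  by case: (eqVneq i 0) => [->|//]; rewrite -s0 n4.
rewrite e1 in h1.
have h2 : runs (skip_cmd b) (Inv 0) (f t * (5 + 3)).+1 (Inv (f t)).
  apply: (@runs_for b) => i lt; first by rewrite /Inv !nE.
  apply: runs_case.
  set s2 := upd _ _ _.
  have e2 : s2 0 = drop i x by rewrite /s2 /Inv !nE.
  have e3 : s2 b.+1 = rev (take i x) by rewrite /s2 /Inv !nE.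
  have sE j : j != 0 -> j != b.+1 -> s2 j = Inv i.+1 j.
    by move=> m1 m2; rewrite /s2 /Inv !updE (negbTE m1) (negbTE m2); case: eqP.
  rewrite e2; clearbody s2.
  case ed: (drop i x) => [|g l] /=.
    apply: runs_eq (runs_le _ (runs_seq (runs_skip _) (runs_pop _ _))) => // j.
    have szx : size x <= i by rewrite leqNgt; apply/negP => lt'; move: ed; rewrite (drop_nth (inl true)).
    rewrite updE; case: (eqVneq j 0) => [->|m0].
      by rewrite e2 ed /Inv !nE drop_oversize // (leq_trans szx).
    case: (eqVneq j b.+1) => [->|m1]; last by rewrite sE.
    by rewrite e3 /Inv upd_same !take_oversize // (leq_trans szx).
  apply: runs_eq (runs_seq (runs_push _ _ _) (runs_pop _ _)) => j.
  have lt' : i < size x by rewrite ltnNge; apply/negP => ge; move: ed; rewrite drop_oversize.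
  have el : drop i.+1 x = l by rewrite -add1n -drop_drop ed drop1.
  have et : take i.+1 x = rcons (take i x) g.
    by rewrite (take_nth g lt') -[i in nth _ _ i]addn0 -nth_drop ed.
  rewrite !updE; case: (eqVneq j 0) => [->|m0].
    by rewrite n5 e2 ed /Inv !nE el.
  case: (eqVneq j b.+1) => [->|m1]; last by rewrite sE.
  by rewrite e3 /Inv upd_same et rev_rcons.
set v := nat_of_bool _.
have h3 : runs (Case 0 (fun g => if g is Some (inl true) then Push b (inl true) else Skip A)) (Inv (f t)) 3
   (upd (Inv (f t)) b (un v)).
  apply: runs_case.
  have e2 : Inv (f t) 0 = drop (f t) x by rewrite /Inv !nE.
  have e3 : Inv (f t) b = [::] by rewrite /Inv !nE subnn.
  rewrite e2 /v /x -map_drop.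
  have -> : nth false (X t) (f t) = head false (drop (f t) (X t)) by rewrite -nth0 nth_drop addn0.
  have h0 : runs (Skip A) (Inv (f t)) 2 (upd (Inv (f t)) b (un false)).
    by rewrite (_ : un false = Inv (f t) b) // upd_id; apply: runs_le (runs_skip _).
  case: (drop (f t) (X t)) => [|[] l] //=.
  by have := runs_push b (inl true) (Inv (f t)); rewrite e3; exact.
have ne : b.+1 != 0 by [].
have h4 := runs_move (upd (Inv (f t)) b (un v)) ne.
set s4 := upd (Inv (f t)) b (un v) in h3 h4 *.
have e4 : s4 b.+1 = rev (take (f t) x) by rewrite /s4 /Inv !nE.
have e5 : s4 0 = drop (f t) x by rewrite /s4 /Inv !nE.
rewrite e4 e5 revK cat_take_drop size_rev in h4.
have le : size (take (f t) x) <= size (X t) by rewrite size_take_min /x size_map geq_minr.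
apply: runs_eq (runs_le _ (runs_seq h1 (runs_seq h2 (runs_seq h3 h4)))) => [i|]; last by lia.
rewrite !updE; case: (eqVneq i 0) => [->|m0]; first by rewrite n4 -s0.
case: (eqVneq i b.+1) => [->|m1]; first by rewrite n2 sb1.
by rewrite /s4 /Inv !updE (negbTE m0) (negbTE m1); case: (i == b).
Qed.

End Class.

Section Extension.
Variable T : Type.
Variables (X : T -> seq bool) (S : T -> nat) (B : seq (T -> nat)).

(** A context with one more bound variable: its register comes first in the list, and its value
    counts towards the size because numbers are unary. *)
Definition eX (p : T * nat) := X p.1.
Definition eS (p : T * nat) := S p.1 + p.2.
Definition eB : seq (T * nat -> nat) := snd :: [seq (fun p => g p.1) | g <- B].

Lemma pbd_weak f : pbd S f -> pbd eS (fun p => f p.1).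
Proof.
apply: (@pbd_comp _ _ eS S fst); exists 1 => p; rewrite expn1 /eS; lia.
Qed.

Lemma pt_weak f : pt X S B f -> pt eX eS eB (fun p => f p.1).
Proof.
move=> [P [tau [bf btau hP]]].
exists (fun rs b => P (behead rs) b), (fun p => tau p.1); split; try exact: pbd_weak.
move=> [t i] rs b s b0 ars s0 srs sb /=; apply: hP => //.
  by case: rs ars {srs} => //= r rs /andP[].
by case: rs ars srs => //= r rs _ [_ ->]; rewrite -map_comp.
Qed.

Lemma pt_var0 : pt eX eS eB snd.
Proof.
apply: (@pt_var _ eX eS eB 0) => //.
by exists 1 => p; rewrite expn1 /eS /=; lia.
Qed.

End Extension.

Section Loops.
Variable T : Type.
Variables (X : T -> seq bool) (S : T -> nat) (B : seq (T -> nat)).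

(** Iterating a polynomial step can produce exponential values, so a polynomial bound [a] on all
    intermediate values is required. In the context of [step], [p.1.2] is the index and [p.2] the
    accumulator. *)
Lemma pt_iter n init step (a : T -> nat) :
  pt X S B n -> pt X S B init ->
  pt (eX (eX X)) (eS (eS S)) (eB (eB B)) (fun p => step p.1.1 p.1.2 p.2) ->
  pbd S a -> (forall t i, i <= n t -> iteri i (step t) (init t) <= a t) ->
  pt X S B (fun t => iteri (n t) (step t) (init t)).
Proof.
move=> [P [tau [bn btau hP]]] [Q [rho [bi brho hQ]]] [R [sig [bs [c hsig] hR]]] ba ha.
(* Register [b] holds the accumulator, [b.+1] the number of rounds left and [b.+2] the current
   index; the step works from [b.+3] on. *)
pose body b rs := Seq (R [:: b, b.+2 & rs] b.+3)
  (Seq (clear A b) (Seq (move_all A b.+3 b) (Push b.+2 (inl true)))).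
pose D t := (S t + n t + a t + 2) ^ c + 8 * a t + 20.
have bD : pbd S D.
  apply: pbd_add; last exact: pbd_const.
  apply: pbd_add; last by apply: pbd_mul => //; apply: pbd_const.
  apply: pbd_exp; apply: pbd_add; last exact: pbd_const.
  by do 2!apply: pbd_add => //; apply: pbd_size.
exists (fun rs b => Seq (Q rs b) (Seq (P rs b.+1)
  (Seq (While b.+1 isSome (Seq (Pop A b.+1) (body b rs))) (clear A b.+2)))).
exists (fun t => (rho t + (tau t + ((n t * (D t + 3)).+1 + (2 * n t).+1).+1).+1).+1); split.
- by apply: pbd_le ba => t; apply: ha.
- apply: pbd_succ; apply: pbd_add => //; apply: pbd_succ; apply: pbd_add => //.
  apply: pbd_succ; apply: pbd_add.
    by apply: pbd_succ; apply: pbd_mul => //; apply: pbd_add => //; apply: pbd_const.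
  by apply: pbd_succ; apply: pbd_mul => //; apply: pbd_const.
move=> t rs b s b0 ars s0 srs sb.
have h1 := hQ t rs b s b0 ars s0 srs sb.
set s1 := upd s b _ in h1.
have e1 i : i < b -> s1 i = s i by move=> ib; rewrite /s1 upd_other //; lia.
have [b1 ars1 s10 srs1] := frame_ok b0 (leqnSn b) ars s0 srs e1.
have sb1 i : b < i -> s1 i = [::] by move=> ib; rewrite /s1 upd_other ?sb //; lia.
have h2 := hP t rs b.+1 s1 b1 ars1 s10 srs1 sb1.
pose acc i := iteri i (step t) (init t).
pose Inv i := upd (upd (upd s b (un (acc i))) b.+2 (un i)) b.+1 (un (n t - i)).
have n01 : (b == b.+1) = false by lia.
have n02 : (b == b.+2) = false by lia.
have n03 : (b == b.+3) = false by lia.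
have n10 : (b.+1 == b) = false by lia.
have n12 : (b.+1 == b.+2) = false by lia.
have n13 : (b.+1 == b.+3) = false by lia.
have n20 : (b.+2 == b) = false by lia.
have n21 : (b.+2 == b.+1) = false by lia.
have n23 : (b.+2 == b.+3) = false by lia.
have n30 : (b.+3 == b) = false by lia.
have n31 : (b.+3 == b.+1) = false by lia.
have n32 : (b.+3 == b.+2) = false by lia.
pose nE := (updE, eqxx, n01, n02, n03, n10, n12, n13, n20, n21, n23, n30, n31, n32).
have e2 : upd s1 b.+1 (un (n t)) = Inv 0.
  apply/funext => i; rewrite /s1 /Inv !updE subn0; case: eqP => // _.
  case: (eqVneq i b.+2) => [->|//]; rewrite n20 sb //; lia.
rewrite e2 in h2.
have h3 : runs (While b.+1 isSome (Seq (Pop A b.+1) (body b rs))) (Inv 0) (n t * (D t + 3)).+1 (Inv (n t)).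
  apply: (@runs_for b.+1) => i lt; first by rewrite /Inv !nE.
  set s3 := upd _ _ _.
  have e3 : s3 = upd (upd (upd s b (un (acc i))) b.+2 (un i)) b.+1 (un (n t - i.+1)).
    by rewrite /s3 /Inv upd_upd.
  have es j : j < b -> s3 j = s j.
    move=> jb; rewrite e3 !upd_other //; lia.
  have bb3 : b <= b.+3 by rewrite -addn3 leq_addr.
  have [b3 ars3 s30 srs3] := frame_ok b0 bb3 ars s0 srs es.
  have h4 := hR ((t, i), acc i) [:: b, b.+2 & rs] b.+3 s3 b3.
  have {h4} := h4 _ s30 _ _; rewrite [(_, _, _).1.1]/= [(_, _, _).1.2]/= [(_, _, _).2]/= => h4.
  have {}h4 : runs (R [:: b, b.+2 & rs] b.+3) s3 (sig (t, i, acc i)) (upd s3 b.+3 (un (acc i.+1))).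
    apply: h4; first by rewrite /= ars3 !andbT; lia.
      rewrite /= -!map_comp; congr [:: _, _ & _]; [by rewrite e3 !nE|by rewrite e3 !nE|].
      by rewrite srs3.
    move=> j jb; rewrite e3 !upd_other ?sb //; lia.
  have h5 := runs_clear b (upd s3 b.+3 (un (acc i.+1))).
  set s5 := upd _ b [::] in h5.
  have ne : b.+3 != b by rewrite n30.
  have h6 := runs_move s5 ne.
  set s6 := upd _ b _ in h6.
  have h7 := runs_push b.+2 (inl true) s6.
  have s3b : s3 b = un (acc i) by rewrite e3 !nE.
  have s53 : s5 b.+3 = un (acc i.+1) by rewrite /s5 !nE.
  have s5b : s5 b = [::] by rewrite /s5 !nE.
  rewrite upd_other ?n03 // s3b size_nseq in h5.
  rewrite s53 size_nseq in h6.
  apply: runs_eq (runs_le _ (runs_seq h4 (runs_seq h5 (runs_seq h6 h7)))) => [j|].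
    rewrite /s6 s53 s5b cats0 rev_un /s5 e3 /Inv !nE.
    case: (eqVneq j b.+2) => [->|m2]; first by rewrite n21.
    case: (eqVneq j b) => [->|m0]; first by rewrite n01.
    case: (eqVneq j b.+3) => [->|m3].
      by rewrite n31 sb // (leq_trans bb3).
    by [].
  have a1 := ha t i (ltnW lt); have a2 := ha t i.+1 lt.
  have : sig (t, i, acc i) <= (S t + n t + a t + 2) ^ c.
    apply: leq_trans (hsig _) _; case: (c) => // c'; rewrite leq_exp2r // /eS /=.
    by rewrite leq_add2r !leq_add // ltnW.
  rewrite /D -/(acc i) -/(acc i.+1) in a1 a2 *; lia.
have h4 := runs_clear b.+2 (Inv (n t)).
have e4 : Inv (n t) b.+2 = un (n t) by rewrite /Inv !nE.
rewrite e4 size_nseq in h4.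
apply: runs_eq (runs_seq h1 (runs_seq h2 (runs_seq h3 h4))) => i.
rewrite /Inv subnn !updE; case: (eqVneq i b.+2) => [->|m2]; first by rewrite n20 sb //; lia.
case: (eqVneq i b.+1) => [->|m1]; first by rewrite n10 sb.
by [].
Qed.

Lemma pt_size : pbd S (fun t => size (X t)) -> pt X S B (fun t => size (X t)).
Proof.
move=> hX.
exists (fun rs b => Seq (move_all A 0 b.+1) (While b.+1 isSome
   (Seq (Case b.+1 (fun g => Seq (put 0 g) (Pop A b.+1))) (Push b (inl true))))).
exists (fun t => ((6 * size (X t)).+1 + (10 * size (X t)).+1).+1); split => //.
  by apply: pbd_succ; apply: pbd_add; apply: pbd_succ; apply: pbd_mul => //; apply: pbd_const.
move=> t rs b s b0 _ s0 _ sb.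
have n0 : (0 == b.+1) = false by [].
have n1 : (b == b.+1) = false by lia.
have n2 : (b.+1 == b) = false by lia.
have n3 : (b == 0) = false by lia.
have n4 : (0 == b) = false by lia.
pose nE := (updE, eqxx, n0, n1, n2, n3, n4).
have ne : 0 != b.+1 by [].
have sb1 : s b.+1 = [::] by apply: sb; lia.
have h1 := runs_move s ne; rewrite s0 sb1 cats0 size_map in h1.
pose Inv l k := upd (upd (upd s 0 (drop (size l) [seq inl x | x <- X t])) b.+1 l) b (un k).
have e1 : upd (upd s 0 [::]) b.+1 (rev [seq inl x | x <- X t]) = Inv (rev [seq inl x | x <- X t]) 0.
  apply/funext => i; rewrite /Inv size_rev drop_size !updE.
  by case: (eqVneq i b) => [->|//]; rewrite n1 n3 sb.
have main l l2 k : rev [seq inl x | x <- X t] = l2 ++ l -> size l2 = k ->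
  runs (While b.+1 isSome (Seq (Case b.+1 (fun g => Seq (put 0 g) (Pop A b.+1))) (Push b (inl true))))
   (Inv l k) (10 * size l).+1 (upd s b (un (size (X t)))).
  elim: l l2 k => [|g l IH] l2 k e szl.
    have -> : upd s b (un (size (X t))) = Inv [::] k.
      have -> : k = size (X t) by have := congr1 size e; rewrite size_rev size_map cats0 szl.
      by apply/funext => i; rewrite /Inv drop0 !updE -s0; case: eqP => // _; case: eqP => [->//|_]; case: eqP => [->|].
    by apply: runs_whileF; rewrite /Inv !nE.
  have h : runs (Case b.+1 (fun g => Seq (put 0 g) (Pop A b.+1))) (Inv (g :: l) k) 5 (Inv l k).
    apply: runs_case; rewrite /Inv !nE /=.
    apply: runs_eq (runs_seq (runs_push _ _ _) (runs_pop _ _)) => i.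
    have ed : drop (size l) [seq inl x | x <- X t] = g :: drop (size l).+1 [seq inl x | x <- X t].
      have -> : [seq inl x | x <- X t] = rev l ++ g :: rev l2.
        by rewrite -[map _ _]revK e rev_cat rev_cons cat_rcons.
      by rewrite drop_size_cat ?size_rev // -cat_rcons drop_size_cat // size_rcons size_rev.
    rewrite !nE ed; case: (eqVneq i b) => [->|mb]; first by rewrite n1 n3.
    by case: (i == b.+1); case: (i == 0).
  have h' := runs_push b (inl true) (Inv l k).
  have e' : upd (Inv l k) b (inl true :: Inv l k b) = Inv l k.+1.
    by rewrite /Inv upd_same upd_upd.
  rewrite e' in h'.
  have ps : isSome (ohead (Inv (g :: l) k b.+1)) by rewrite /Inv !nE.
  have := IH (rcons l2 g) k.+1; rewrite cat_rcons size_rcons szl => /(_ e erefl) h2.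
  apply: runs_le (runs_whileT (p := isSome) ps (runs_seq h h') h2); rewrite /=; lia.
rewrite e1 in h1.
have h2 := main _ [::] 0 erefl erefl; rewrite size_rev size_map in h2.
exact: runs_seq h1 h2.
Qed.

End Loops.

Section Call.
Variables (f : nat -> nat) (M : TM) (e : symbol (tm_work M) + tm_state M -> A).
Hypothesis e_inj : injective e.
Variable time : nat -> nat.
Hypothesis fM : forall n, computes_within M (time n) (enc_nat n) (enc_nat (f n)).

(** The final [false] of [enc_nat] lies at the bottom of the stack, so the number is tipped over
    into the next register to add it, and once more to remove it. *)
Definition call_nat (b : nat) : cmd :=
  Seq (move_all A b b.+1) (Seq (Push b (inl false)) (Seq (move_all A b.+1 b)
  (Seq (call e b)
  (Seq (move_all A b b.+1) (Seq (Pop A b.+1) (move_all A b.+1 b)))))).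

Lemma map_enc_nat n : [seq inl z | z <- enc_nat n] = rcons (un n) (inl false).
Proof. by rewrite /enc_nat map_rcons map_nseq. Qed.

Lemma runs_call_nat b (s : st) n : s b = un n -> (forall i, b < i -> s i = [::]) ->
  runs (call_nat b) s (call_cost M * (time n + n + 2) + 24 * n + 24 * time n + 100) (upd s b (un (f n)))
  /\ f n <= n + 2 * time n.
Proof.
move=> sb sb1.
have ne : b != b.+1 by lia.
have ne' : b.+1 != b by lia.
have n1 : (b == b.+1) = false by lia.
have n2 : (b.+1 == b) = false by lia.
pose nE := (updE, eqxx, n1, n2).
have h1 := runs_move s ne.
rewrite sb sb1 // cats0 rev_un size_nseq in h1.
set s1 := upd _ _ _ in h1.
have h2 := runs_push b (inl false) s1.
set s2 := upd _ _ _ in h2.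
have h3 := runs_move s2 ne'.
have s2b1 : s2 b.+1 = un n by rewrite /s2 /s1 !nE.
have s2b : s2 b = [:: inl false] by rewrite /s2 /s1 !nE.
rewrite s2b1 s2b rev_un cats1 size_nseq -map_enc_nat in h3.
set s3 := upd _ _ _ in h3.
have s3b : s3 b = [seq inl z | z <- enc_nat n] by rewrite /s3 upd_same.
have s3z i : b < i -> s3 i = [::].
  move=> bi; rewrite /s3 /s2 /s1 !updE (_ : i == b = false); last by lia.
  by case: eqP => // _; rewrite sb1.
have [h4 szy] := callP e_inj (fM n) s3b s3z.
have sze k : size (enc_nat k) = k.+1 by rewrite /enc_nat size_rcons size_nseq.
rewrite !sze in h4 szy.
set s4 := upd _ _ _ in h4.
have h5 := runs_move s4 ne.
have s4b : s4 b = rcons (un (f n)) (inl false) by rewrite /s4 upd_same map_enc_nat.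
have s4b1 : s4 b.+1 = [::] by rewrite /s4 upd_other ?s3z.
rewrite s4b s4b1 cats0 rev_rcons rev_un size_rcons size_nseq in h5.
set s5 := upd _ _ _ in h5.
have h6 := runs_pop b.+1 s5.
have s5b1 : s5 b.+1 = inl false :: un (f n) by rewrite /s5 upd_same.
rewrite s5b1 /= in h6.
set s6 := upd _ _ _ in h6.
have h7 := runs_move s6 ne'.
have s6b1 : s6 b.+1 = un (f n) by rewrite /s6 upd_same.
have s6b : s6 b = [::] by rewrite /s6 /s5 !nE.
rewrite s6b1 s6b cats0 rev_un size_nseq in h7.
have fle : f n <= n + 2 * time n by lia.
split => //.
apply: runs_eq (runs_le _ (runs_seq h1 (runs_seq h2 (runs_seq h3 (runs_seq h4 (runs_seq h5 (runs_seq h6 h7))))))) => [i|].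
  rewrite !updE; case: (eqVneq i b) => // nb; case: (eqVneq i b.+1) => [->|nb1]; first by rewrite sb1.
  by rewrite /s6 /s5 /s4 /s3 /s2 /s1 !updE (negbTE nb) (negbTE nb1).
have -> : (time n + n.+1).+1 = time n + n + 2 by lia.
move: fle; lia.
Qed.

(** The function [f] need not be polynomial: the size measure [S] only has to dominate, up to a
    power, the running time on the arguments that occur. *)
Lemma pt_call (T : Type) (X : T -> seq bool) (S : T -> nat) (B : seq (T -> nat)) (a : T -> nat) :
  pt X S B a -> pbd S (fun t => time (a t)) -> pt X S B (fun t => f (a t)).
Proof.
move=> [P [tau [ba btau hP]]] bt.
have le n : f n <= n + 2 * time n.
  have h0 i : 1 < i -> (if i == 1 then un n else [::]) = [::] by case: i => [|[]].
  exact: proj2 (@runs_call_nat 1 (fun i => if i == 1 then un n else [::]) n erefl h0).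
exists (fun rs b => Seq (P rs b) (call_nat b)).
exists (fun t => (tau t + (call_cost M * (time (a t) + a t + 2) + 24 * a t + 24 * time (a t) + 100)).+1); split.
- apply: pbd_le (pbd_add ba (pbd_mul (pbd_const S 2) bt)) => t; exact: le.
- apply: pbd_succ; apply: pbd_add => //; apply: pbd_add; last exact: pbd_const.
  apply: pbd_add; last by apply: pbd_mul => //; apply: pbd_const.
  apply: pbd_add; last by apply: pbd_mul => //; apply: pbd_const.
  apply: pbd_mul; first exact: pbd_const.
  by apply: pbd_add; [apply: pbd_add|apply: pbd_const].
move=> t rs b s b0 ars s0 srs sb.
have h1 := hP t rs b s b0 ars s0 srs sb.
have [||h2 _] := @runs_call_nat b (upd s b (un (a t))) (a t).
- by rewrite upd_same.
- by move=> i bi; rewrite upd_other ?sb //; lia.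
by rewrite upd_upd in h2; apply: runs_seq h1 h2.
Qed.

End Call.
End PT.

(** * Binary digits and bitwise sums of natural numbers *)

Definition bitn (a i : nat) : bool := odd (a %/ 2 ^ i).
Definition xorn : nat -> nat -> nat := Nat.lxor.

Lemma div2_half n : Nat.div2 n = n./2.
Proof. by elim/ltn_ind: n => -[|[|n]] //= IH; rewrite IH // ltnW. Qed.

Lemma Nat_odd_odd n : Nat.odd n = odd n.
Proof.
elim/ltn_ind: n => -[|[|n]] IH //.
by rewrite /= negbK -IH // ltnW.
Qed.

Lemma bitnS a i : bitn a i.+1 = bitn a./2 i.
Proof. by rewrite /bitn expnS divnMA divn2. Qed.

Lemma bitn0 a : bitn a 0 = odd a.
Proof. by rewrite /bitn expn0 divn1. Qed.

Lemma bitn_testbit a i : Nat.testbit a i = bitn a i.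
Proof.
elim: i a => [|i IH] a; first by rewrite bitn0 /= Nat_odd_odd.
by rewrite bitnS -IH /= div2_half.
Qed.

Lemma bitn_xor a b i : bitn (xorn a b) i = bitn a i (+) bitn b i.
Proof. by rewrite -!bitn_testbit /xorn PeanoNat.Nat.lxor_spec; case: Nat.testbit; case: Nat.testbit. Qed.

Lemma bits_sum c n : c < 2 ^ n -> c = \sum_(i < n) bitn c i * 2 ^ i.
Proof.
elim: n c => [|n IH] c; first by rewrite big_ord0 expn0; case: c.
rewrite expnS => lt; rewrite big_ord_recl bitn0 expn0 muln1.
rewrite (eq_bigr (fun i : 'I_n => 2 * (bitn c./2 i * 2 ^ i))); last first.
  by move=> i _; rewrite lift0 bitnS expnS mulnCA.
rewrite -big_distrr -IH /=; last by rewrite ltn_half_double -mul2n.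
by rewrite mul2n odd_double_half.
Qed.

Lemma bitn_big c n i : c < 2 ^ n -> n <= i -> bitn c i = false.
Proof.
move=> lt le; rewrite /bitn divn_small //; apply: leq_trans lt _.
by rewrite leq_exp2l.
Qed.

Lemma bits_lt c n : (forall i, n <= i -> bitn c i = false) -> c < 2 ^ n.
Proof.
move=> h; suff : c %/ 2 ^ n = 0.
  by move/eqP; rewrite -leqn0 leqNgt divn_gt0 ?expn_gt0 // -ltnNge.
have lt1 : 1 < 2 by [].
rewrite (bits_sum (ltn_expl (c %/ 2 ^ n) lt1)) big1 // => i _.
have := h (n + i) (leq_addr _ _); rewrite /bitn expnD divnMA => ->.
by rewrite mul0n.
Qed.

Lemma xorn_lt a b n : a < 2 ^ n -> b < 2 ^ n -> xorn a b < 2 ^ n.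
Proof.
by move=> ha hb; apply: bits_lt => i le; rewrite bitn_xor !(bitn_big _ le).
Qed.

Lemma xornA : associative xorn. Proof. by move=> a b c; rewrite /xorn PeanoNat.Nat.lxor_assoc. Qed.
Lemma xornC : commutative xorn. Proof. by move=> a b; rewrite /xorn PeanoNat.Nat.lxor_comm. Qed.
Lemma xornn a : xorn a a = 0. Proof. exact: PeanoNat.Nat.lxor_nilpotent. Qed.
Lemma xorn0 a : xorn a 0 = a. Proof. exact: PeanoNat.Nat.lxor_0_r. Qed.
Lemma xorKn a b : xorn (xorn a b) b = a.
Proof. by rewrite -xornA xornn xorn0. Qed.

(** In unary, [2 ^ i] may be too large to be written down; capping it at [a.+1] does not change the
    quotient. *)
Lemma minn_pow2_bit a i : odd (a %/ minn (2 ^ i) a.+1) = bitn a i.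
Proof.
rewrite /bitn /minn; case: ltnP => // h.
by rewrite !divn_small // ltnW.
Qed.

(** If a power of two reaches the cap, it exceeds both numbers and its coefficient vanishes. The
    bitwise sum thus becomes a bounded sum of computable terms. *)
Lemma xorn_sum a b :
  \sum_(i < a + b) (bitn a i (+) bitn b i) * minn (2 ^ i) (a + b).+1 = xorn a b.
Proof.
have lt c : c <= a + b -> c < 2 ^ (a + b) by move=> le; apply: leq_ltn_trans le (ltn_expl _ (ltnSn 1)).
rewrite [RHS](@bits_sum _ (a + b)); last by apply: xorn_lt; apply: lt; [exact: leq_addr|exact: leq_addl].
apply: eq_bigr => i _; rewrite bitn_xor.
have [h|h] := leqP (2 ^ i) (a + b); first by rewrite (minn_idPl (leqW h)).
have e c : c <= a + b -> bitn c i = false.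
  by move=> le; rewrite /bitn divn_small // (leq_ltn_trans le).
by rewrite !e ?leq_addr ?leq_addl.
Qed.

Lemma sum_ltn m k : \sum_(i < m) (i < k) = minn m k.
Proof. by elim: m => [|m IH]; rewrite ?big_ord0 ?min0n // big_ord_recr /= IH; lia. Qed.

(** * Arithmetic and bounded quantifiers in polynomial time *)

Section Derived.
Variable A : finType.

Section Arith.
Variable T : Type.
Variables (X : T -> seq bool) (S : T -> nat) (B : seq (T -> nat)).
Notation pt1 := (pt A (eX X) (eS S) (eB B)).
Notation pt := (pt A X S B).
Implicit Types (f g n : T -> nat) (P Q : T -> bool).

Lemma pt_succ f : pt f -> pt (fun t => (f t).+1).
Proof.
by move=> hf; apply: pt_ext (pt_add hf (pt_const A X S B 1)) => t; rewrite addn1.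
Qed.

Lemma pt_mul f g : pt f -> pt g -> pt (fun t => f t * g t).
Proof.
move=> hf hg.
have e (c n : nat) : iteri n (fun _ acc => acc + c) 0 = n * c.
  by elim: n => //= n ->; rewrite mulSn addnC.
apply: (@pt_ext _ _ _ _ _ (fun t => iteri (f t) (fun _ acc => acc + g t) 0)) => [t|]; first exact: e.
apply: (@pt_iter A T X S B f (fun _ => 0) (fun t i acc => acc + g t) (fun t => f t * g t)) => //.
- exact: pt_const.
- by apply: pt_add; [apply: pt_var0|exact: (pt_weak (pt_weak hg))].
- by apply: pbd_mul; apply: pt_pbd; eassumption.
- by move=> t i le; rewrite e leq_mul2r le orbT.
Qed.

Lemma pt_sum n (g : T -> nat -> nat) : pt n -> pt1 (fun p => g p.1 p.2) ->
  pt (fun t => \sum_(i < n t) g t i).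
Proof.
move=> hn hg.
have e (h : nat -> nat) m : iteri m (fun i acc => acc + h i) 0 = \sum_(i < m) h i.
  by elim: m => [|m IH] /=; rewrite ?big_ord0 // big_ord_recr /= IH.
apply: (@pt_ext _ _ _ _ _ (fun t => iteri (n t) (fun i acc => acc + g t i) 0)) => [t|]; first exact: e.
have [c hc] := pt_pbd hg.
apply: (@pt_iter A T X S B n (fun _ => 0) (fun t i acc => acc + g t i) (fun t => n t * (S t + n t + 2) ^ c)) => //.
- exact: pt_const.
- by apply: pt_add; [apply: pt_var0|apply: (pt_weak hg)].
- apply: pbd_mul; first exact: pt_pbd hn.
  apply: pbd_exp; apply: pbd_add; last exact: pbd_const.
  by apply: pbd_add; [apply: pbd_size|apply: pt_pbd hn].
- move=> t i le; rewrite e; apply: leq_trans (_ : i * (S t + n t + 2) ^ c <= _); last first.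
    by rewrite leq_mul2r le orbT.
  rewrite -[X in X * _]card_ord -sum_nat_const; apply: leq_sum => j _.
  apply: leq_trans (hc (t, nat_of_ord j)) _; case: (c) => // c'.
  rewrite leq_exp2r // /eS /= leq_add2r leq_add2l.
  by apply: leq_trans le; apply: ltnW.
Qed.

Lemma pt_leq f g : pt f -> pt g -> pt (fun t => nat_of_bool (f t <= g t)).
Proof.
move=> hf hg; apply: pt_ext (pt_sub (pt_const A X S B 1) (pt_sub hf hg)) => t.
by rewrite -subn_eq0; case: (f t - g t).
Qed.

Lemma pt_and P Q : pt (fun t => nat_of_bool (P t)) -> pt (fun t => nat_of_bool (Q t)) ->
  pt (fun t => nat_of_bool (P t && Q t)).
Proof. by move=> hP hQ; apply: pt_ext (pt_mul hP hQ) => t; case: (P t); case: (Q t). Qed.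

Lemma pt_neg P : pt (fun t => nat_of_bool (P t)) -> pt (fun t => nat_of_bool (~~ P t)).
Proof. by move=> hP; apply: pt_ext (pt_sub (pt_const A X S B 1) hP) => t; case: (P t). Qed.

Lemma pt_or P Q : pt (fun t => nat_of_bool (P t)) -> pt (fun t => nat_of_bool (Q t)) ->
  pt (fun t => nat_of_bool (P t || Q t)).
Proof.
by move=> hP hQ; apply: pt_ext (pt_neg (pt_and (pt_neg hP) (pt_neg hQ))) => t; rewrite negb_and !negbK.
Qed.

Lemma pt_imply P Q : pt (fun t => nat_of_bool (P t)) -> pt (fun t => nat_of_bool (Q t)) ->
  pt (fun t => nat_of_bool (P t ==> Q t)).
Proof. by move=> hP hQ; apply: pt_ext (pt_or (pt_neg hP) hQ) => t; case: (P t). Qed.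

Lemma pt_eqn f g : pt f -> pt g -> pt (fun t => nat_of_bool (f t == g t)).
Proof.
by move=> hf hg; apply: pt_ext (pt_and (pt_leq hf hg) (pt_leq hg hf)) => t; rewrite eqn_leq.
Qed.

Lemma pt_eqb P Q : pt (fun t => nat_of_bool (P t)) -> pt (fun t => nat_of_bool (Q t)) ->
  pt (fun t => nat_of_bool (P t == Q t)).
Proof. by move=> hP hQ; apply: pt_ext (pt_eqn hP hQ) => t; case: (P t); case: (Q t). Qed.

Lemma pt_addb P Q : pt (fun t => nat_of_bool (P t)) -> pt (fun t => nat_of_bool (Q t)) ->
  pt (fun t => nat_of_bool (P t (+) Q t)).
Proof.
by move=> hP hQ; apply: pt_ext (pt_neg (pt_eqn hP hQ)) => t; case: (P t); case: (Q t).
Qed.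

Lemma pt_if P f g : pt (fun t => nat_of_bool (P t)) -> pt f -> pt g ->
  pt (fun t => if P t then f t else g t).
Proof.
move=> hP hf hg; apply: pt_ext (pt_add (pt_mul hP hf) (pt_mul (pt_neg hP) hg)) => t.
by case: (P t); rewrite /= ?mul1n ?mul0n ?addn0.
Qed.

Lemma pt_ifb P (Q R : T -> bool) : pt (fun t => nat_of_bool (P t)) ->
  pt (fun t => nat_of_bool (Q t)) -> pt (fun t => nat_of_bool (R t)) ->
  pt (fun t => nat_of_bool (if P t then Q t else R t)).
Proof. by move=> hP hQ hR; apply: pt_ext (pt_if hP hQ hR) => t; case: (P t). Qed.

Lemma pt_has n (P : T -> nat -> bool) : pt n -> pt1 (fun p => nat_of_bool (P p.1 p.2)) ->
  pt (fun t => nat_of_bool (has (fun i => P t i) (iota 0 (n t)))).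
Proof.
move=> hn hP.
have hs := pt_sum (g := fun t i => nat_of_bool (P t i)) hn hP.
apply: pt_ext (pt_leq (pt_const A X S B 1) hs) => t; congr nat_of_bool.
rewrite lt0n sum_nat_eq0 negb_forall; apply/existsP/hasP => [[i]|[i]].
  by move=> h; exists (nat_of_ord i); [rewrite mem_iota /= ltn_ord|move: h; case: (P t i)].
by rewrite mem_iota /= => lt Pi; exists (Ordinal lt); rewrite /= Pi.
Qed.

Lemma pt_all n (P : T -> nat -> bool) : pt n -> pt1 (fun p => nat_of_bool (P p.1 p.2)) ->
  pt (fun t => nat_of_bool (all (fun i => P t i) (iota 0 (n t)))).
Proof.
move=> hn hP.
have hP' : pt1 (fun p => nat_of_bool (~~ P p.1 p.2)).
  by apply: pt_ext (pt_sub (pt_const A _ _ _ 1) hP) => p; case: (P _ _).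
have := pt_neg (pt_has (P := fun t i => ~~ P t i) hn hP').
by apply: pt_ext => t; rewrite -all_predC; congr nat_of_bool; apply: eq_all => i /=; rewrite negbK.
Qed.

End Arith.

Section Arith2.
Variable T : Type.
Variables (X : T -> seq bool) (S : T -> nat) (B : seq (T -> nat)).
Notation pt1 := (pt A (eX X) (eS S) (eB B)).
Notation pt := (pt A X S B).
Implicit Types (f g n : T -> nat) (P Q : T -> bool).

(** The quotient counts the positive multiples of [g t] up to [f t]. *)
Lemma pt_divn f g : pt f -> pt g -> pt (fun t => f t %/ g t).
Proof.
move=> hf hg.
apply: (@pt_ext _ _ _ _ _ (fun t => \sum_(i < f t) nat_of_bool ((0 < g t) && (i.+1 * g t <= f t)))) => [t|].
  case: (posnP (g t)) => [->|g0]; first by rewrite divn0 big1.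
  under eq_bigr => i _ do rewrite /= -leq_divRL //.
  by rewrite sum_ltn; apply/minn_idPr; apply: leq_div.
apply: (@pt_sum _ X S B f (fun t i => nat_of_bool ((0 < g t) && (i.+1 * g t <= f t)))) => //.
apply: pt_and; first by apply: pt_leq; [apply: pt_const|apply: pt_weak].
apply: pt_leq; last exact: pt_weak.
by apply: pt_mul; [apply: pt_succ; apply: pt_var0|apply: pt_weak].
Qed.

Lemma pt_modn f g : pt f -> pt g -> pt (fun t => f t %% g t).
Proof.
move=> hf hg; apply: pt_ext (pt_sub hf (pt_mul (pt_divn hf hg) hg)) => t.
by rewrite {1}(divn_eq (f t) (g t)) addKn.
Qed.

Lemma pt_odd f : pt f -> pt (fun t => nat_of_bool (odd (f t))).
Proof. by move=> hf; apply: pt_ext (pt_modn hf (pt_const A X S B 2)) => t; rewrite modn2. Qed.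

Lemma pt_half f : pt f -> pt (fun t => (f t)./2).
Proof. by move=> hf; apply: pt_ext (pt_divn hf (pt_const A X S B 2)) => t; rewrite divn2. Qed.

Lemma pt_minn f g : pt f -> pt g -> pt (fun t => minn (f t) (g t)).
Proof. by move=> hf hg; apply: pt_ext (pt_sub hf (pt_sub hf hg)) => t; lia. Qed.

Lemma pt_exp f d : pt f -> pt (fun t => f t ^ d).
Proof.
move=> hf; elim: d => [|d IH].
  by apply: pt_ext (pt_const A X S B 1) => t; rewrite expn0.
by apply: pt_ext (pt_mul hf IH) => t; rewrite expnS.
Qed.

Lemma pt_pow2 f : pt f -> pbd S (fun t => 2 ^ f t) -> pt (fun t => 2 ^ f t).
Proof.
move=> hf hb.
have e m : iteri m (fun _ acc => acc + acc) 1 = 2 ^ m.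
  by elim: m => //= m ->; rewrite addnn -mul2n expnS.
apply: (@pt_ext _ _ _ _ _ (fun t => iteri (f t) (fun _ acc => acc + acc) 1)) => [t|]; first exact: e.
apply: (@pt_iter A T X S B f (fun _ => 1) (fun t i acc => acc + acc) (fun t => 2 ^ f t)) => //.
- exact: pt_const.
- by apply: pt_add; apply: pt_var0.
- by move=> t i le; rewrite e leq_exp2l.
Qed.

(* [g] as base: iterated multiplication. *)
Lemma pt_expn g f : pt g -> pt f -> pbd S (fun t => g t ^ f t) -> pt (fun t => g t ^ f t).
Proof.
move=> hg hf hb.
have e a m : iteri m (fun _ acc => acc * a) 1 = a ^ m.
  by elim: m => //= m ->; rewrite expnS mulnC.
apply: (@pt_ext _ _ _ _ _ (fun t => iteri (f t) (fun _ acc => acc * g t) 1)) => [t|]; first exact: e.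
apply: (@pt_iter A T X S B f (fun _ => 1) (fun t i acc => acc * g t) (fun t => (g t ^ f t).+1)) => //.
- exact: pt_const.
- by apply: pt_mul; [apply: pt_var0|exact: (pt_weak (pt_weak hg))].
- exact: pbd_succ.
- move=> t i le; rewrite e; case: (posnP (g t)) => [->|g0].
    by case: i {le} => [|i]; rewrite ?expn0 // exp0n.
  by apply: leqW; rewrite leq_pexp2l.
Qed.

End Arith2.

Section Arith3.
Variable T : Type.
Variables (X : T -> seq bool) (S : T -> nat) (B : seq (T -> nat)).
Notation pt := (pt A X S B).
Implicit Types (f g n : T -> nat) (P Q : T -> bool).

Lemma pt_pow2cap f g : pt f -> pt g -> pt (fun t => minn (2 ^ f t) (g t)).
Proof.
move=> hf hg.
have e m c : iteri m (fun _ acc => minn (acc + acc) c) (minn 1 c) = minn (2 ^ m) c.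
  by elim: m => //= m ->; rewrite expnS; lia.
apply: (@pt_ext _ _ _ _ _ (fun t => iteri (f t) (fun _ acc => minn (acc + acc) (g t)) (minn 1 (g t)))) => [t|]; first exact: e.
apply: (@pt_iter A T X S B f (fun t => minn 1 (g t)) (fun t i acc => minn (acc + acc) (g t)) g) => //.
- by apply: pt_minn => //; apply: pt_const.
- by apply: pt_minn; [apply: pt_add; apply: pt_var0|exact: (pt_weak (pt_weak hg))].
- exact: pt_pbd hg.
- by move=> t i le; rewrite e geq_minr.
Qed.

End Arith3.

Section Arith3b.
Variable T : Type.
Variables (X : T -> seq bool) (S : T -> nat) (B : seq (T -> nat)).
Notation pt := (pt A X S B).
Implicit Types (f g n : T -> nat) (P Q : T -> bool).

Lemma pt_bitn f g : pt f -> pt g -> pt (fun t => nat_of_bool (bitn (f t) (g t))).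
Proof.
move=> hf hg.
apply: pt_ext (pt_odd (pt_divn hf (pt_pow2cap hg (pt_succ hf)))) => t.
by rewrite minn_pow2_bit.
Qed.
End Arith3b.

Section Arith4.
Variable T : Type.
Variables (X : T -> seq bool) (S : T -> nat) (B : seq (T -> nat)).
Notation pt := (pt A X S B).
Implicit Types (f g n : T -> nat) (P Q : T -> bool).

Lemma pt_xorn f g : pt f -> pt g -> pt (fun t => xorn (f t) (g t)).
Proof.
move=> hf hg.
apply: (@pt_ext _ _ _ _ _ (fun t => \sum_(i < f t + g t) (bitn (f t) i (+) bitn (g t) i) * minn (2 ^ i) (f t + g t).+1)) => [t|].
  exact: xorn_sum.
apply: (@pt_sum _ X S B (fun t => f t + g t) (fun t i => (bitn (f t) i (+) bitn (g t) i) * minn (2 ^ i) (f t + g t).+1)); first exact: pt_add.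
apply: pt_mul.
  by apply: pt_addb; apply: pt_bitn; (try exact: pt_var0); apply: pt_weak.
apply: pt_pow2cap; first exact: pt_var0.
by apply: pt_succ; apply: pt_add; apply: pt_weak.
Qed.
End Arith4.
End Derived.

Ltac pt_weaken := lazymatch goal with
  | |- pt _ _ _ _ (fun p => ?F (fst p)) => apply (pt_weak (f := F))
  | |- pt _ _ _ _ (fun p => ?F (fst (fst p))) => apply (pt_weak (f := fun q => F (fst q)))
  | |- pt _ _ _ _ (fun p => ?F (fst (fst (fst p)))) => apply (pt_weak (f := fun q => F (fst (fst q))))
  | |- pt _ _ _ _ (fun p => ?F (fst (fst (fst (fst p))))) => apply (pt_weak (f := fun q => F (fst (fst (fst q)))))
  | |- pt _ _ _ _ (fun p => ?F (fst (fst (fst (fst (fst p)))))) => apply (pt_weak (f := fun q => F (fst (fst (fst (fst q))))))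
  | |- pt _ _ _ _ (fun p => ?F (fst (fst (fst (fst (fst (fst p))))))) => apply (pt_weak (f := fun q => F (fst (fst (fst (fst (fst q)))))))
  | |- pt _ _ _ _ (fun p => nat_of_bool (?F (fst p))) => apply (pt_weak (f := fun q => nat_of_bool (F q)))
  end.

Ltac pt_bool := lazymatch goal with
  | |- pt _ _ _ _ (fun p => nat_of_bool (@?P p && @?Q p)) => apply: (@pt_and _ _ _ _ _ P Q)
  | |- pt _ _ _ _ (fun p => nat_of_bool (@?P p || @?Q p)) => apply: (@pt_or _ _ _ _ _ P Q)
  | |- pt _ _ _ _ (fun p => nat_of_bool (@?P p ==> @?Q p)) => apply: (@pt_imply _ _ _ _ _ P Q)
  | |- pt _ _ _ _ (fun p => nat_of_bool (~~ @?P p)) => apply: (@pt_neg _ _ _ _ _ P)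
  | |- pt _ _ _ _ (fun p => nat_of_bool (@?P p (+) @?Q p)) => apply: (@pt_addb _ _ _ _ _ P Q)
  | |- pt _ _ _ _ (fun p => nat_of_bool (@eq_op _ (@?P p) (@?Q p))) =>
      first [apply: (@pt_eqn _ _ _ _ _ P Q) | apply: (@pt_eqb _ _ _ _ _ P Q)]
  | |- pt _ _ _ _ (fun p => nat_of_bool (leq (@?P p) (@?Q p))) => apply: (@pt_leq _ _ _ _ _ P Q)
  | |- pt _ _ _ _ (fun p => nat_of_bool (odd (@?P p))) => apply: (@pt_odd _ _ _ _ _ P)
  | |- pt _ _ _ _ (fun p => nat_of_bool (bitn (@?P p) (@?Q p))) => apply: (@pt_bitn _ _ _ _ _ P Q)
  | |- pt _ _ _ _ (fun p => nat_of_bool (all (@?P p) (iota 0 (@?n p)))) => apply: (@pt_all _ _ _ _ _ n P)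
  | |- pt _ _ _ _ (fun p => nat_of_bool (has (@?P p) (iota 0 (@?n p)))) => apply: (@pt_has _ _ _ _ _ n P)
  end.

Ltac pt_nat := lazymatch goal with
  | |- pt _ _ _ _ (fun p => addn (@?P p) (@?Q p)) => apply: (@pt_add _ _ _ _ _ P Q)
  | |- pt _ _ _ _ (fun p => subn (@?P p) (@?Q p)) => apply: (@pt_sub _ _ _ _ _ P Q)
  | |- pt _ _ _ _ (fun p => muln (@?P p) (@?Q p)) => apply: (@pt_mul _ _ _ _ _ P Q)
  | |- pt _ _ _ _ (fun p => divn (@?P p) (@?Q p)) => apply: (@pt_divn _ _ _ _ _ P Q)
  | |- pt _ _ _ _ (fun p => modn (@?P p) (@?Q p)) => apply: (@pt_modn _ _ _ _ _ P Q)
  | |- pt _ _ _ _ (fun p => minn (@?P p) (@?Q p)) => apply: (@pt_minn _ _ _ _ _ P Q)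
  | |- pt _ _ _ _ (fun p => xorn (@?P p) (@?Q p)) => apply: (@pt_xorn _ _ _ _ _ P Q)
  | |- pt _ _ _ _ (fun p => S (@?P p)) => apply: (@pt_succ _ _ _ _ _ P)
  | |- pt _ _ _ _ (fun p => half (@?P p)) => apply: (@pt_half _ _ _ _ _ P)
  | |- pt _ _ _ _ (fun p => expn (@?P p) ?d) => apply: (@pt_exp _ _ _ _ _ P d)
  end.

Ltac pt_ite := lazymatch goal with
  | |- pt _ _ _ _ (fun p => nat_of_bool (if _ then _ else _)) => apply: pt_ifb
  | |- pt _ _ _ _ (fun p => if _ then _ else _) => apply: pt_if
  end.

(** The program is found from the syntax of the function; a term free of the innermost variable is
    moved to the outer context by [pt_weaken]. *)
Ltac pt_step := cbv beta; first
  [ eassumption | exact: pt_var0 | exact: pt_const | pt_bool | pt_nat | pt_weaken | pt_ite ].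
Ltac pt_auto := repeat pt_step.

(** * The tree-independence number of a doubled graph *)

Lemma connect_inv (T : finType) (e : rel T) (P : pred T) x y :
  (forall a b, P a -> e a b -> P b) -> connect e x y -> P x -> P y.
Proof.
move=> h /connectP[p]; elim: p x => [|z p IH] x /=; first by move=> _ ->.
by move=> /andP[exz pp] yE Px; apply: (IH z) => //; apply: h Px exz.
Qed.

Section TreeBag.
Variables (V : finType) (G : graph V) (D : tree_decomposition G).
Notation node := (td_node D).
Notation T := (td_tree D).

(** Otherwise a simple path between them inside [F], closed up through [t], is a cycle of the
    tree. *)
Lemma two_neighbours (t x x' : node) (F : pred node) :
  ~~ F t -> T t x -> T t x' ->
  connect (fun a b => [&& T a b, F a & F b]) x x' -> F x -> x = x'.
Proof.
move=> Ft tx tx' /connectP[p0 pp0 x'E] Fx.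
move: x'E tx'; case/shortenP: pp0 => p pp up _ -> tx'.
apply/eqP; apply: contraT => ne.
have [_ _ /(_ (t :: x :: p))] := td_is_tree D.
have Fp : all F (x :: p).
  by elim: (p) (x) pp Fx => [|z q IH] a /=; [move=> _ ->|move=> /andP[/and3P[_ -> Fz] /IH h] _; apply: h].
have pT : path T x p by apply: sub_path pp => a b /and3P[].
case: p pp up ne tx' Fp pT => [|z q] pp up ne tx' Fp pT; first by rewrite eqxx in ne.
move=> h; suff : ucycle T [:: t, x, z & q] by move/h.
have -> : ucycle T [:: t, x, z & q] = (path T t (x :: rcons (z :: q) t) && uniq (t :: x :: z :: q)) by [].
rewrite [path _ _ _]/(T t x && path T x (rcons (z :: q) t)) tx rcons_path pT (edge_sym T) tx' !andTb cons_uniq up andbT.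
by apply/negP => tin; move: Ft; rewrite (allP Fp t tin).
Qed.

(** If the bag at [t] misses some [w] on the side opposite to [v], the nodes of [w] avoid [t] but
    meet those of [v]. Being connected, they lie in one component of the region without [t]; the
    argument continues in this smaller region with the sides exchanged. *)
Lemma bag_side (I : bool -> {set V}) :
  (forall u w, u \in I false -> w \in I true -> G u w) ->
  exists (t : node) (b : bool), I b \subset td_bag t.
Proof.
move=> adj.
have [t0] : exists t0 : node, true.
  by case: (td_is_tree D) => /card_gt0P[t _] _ _; exists t.
case I0 : (I false == set0); first by exists t0, false; rewrite (eqP I0) sub0set.
have [v0 v0I] : exists v0, v0 \in I false by apply/set0Pn; rewrite I0.
have share b u w : u \in I b -> w \in I (~~ b) -> exists t : node, (u \in td_bag t) && (w \in td_bag t).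
  case: b => uI wI; last exact: td_edge (adj _ _ uI wI).
  by have [t] := td_edge D (adj _ _ wI uI); rewrite andbC; exists t.
pose sub_v v := [set t : node | v \in td_bag t].
(* A region is a set of nodes all of whose boundary edges leave from [t]; we
   look for a smallest region containing all the nodes of some vertex. *)
suff main : forall n (F : {set node}) t b v, #|F| <= n -> t \in F ->
    (forall x y, x \in F -> y \notin F -> T x y -> x = t) ->
    v \in I b -> sub_v v \subset F -> exists (t : node) (b : bool), I b \subset td_bag t.
  by move=> _; apply: (main #|[set: node]| setT t0 false v0) => //; rewrite ?inE ?subsetT // => x y _; rewrite inE.
elim=> [|n IH] F t b v leF tF bd vI vF.
  by move: leF; rewrite leqn0 cards_eq0 => /eqP F0; rewrite F0 inE in tF.
case: (boolP (I (~~ b) \subset td_bag t)) => [|/subsetPn[w wI wt]]; first by exists t, (~~ b).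
have [t1 /andP[vt1 wt1]] := share _ _ _ vI wI.
have t1F : t1 \in F by apply: (fintype.subsetP vF); rewrite inE.
(* The nodes of [w] form a subtree through [t1], so a property spreads along its edges. *)
have inv (P : pred node) : P t1 -> (forall x y, P x -> T x y -> w \in td_bag x -> w \in td_bag y -> P y) ->
    forall y, w \in td_bag y -> P y.
  move=> P1 st y wy.
  have t1w : t1 \in sub_v w by rewrite inE.
  have yw : y \in sub_v w by rewrite inE.
  have := @td_subtree _ _ D w (exist _ t1 t1w) (exist _ y yw).
  move/(@connect_inv _ _ (fun x : {x | x \in sub_v w} => P (val x))); apply => //.
  move=> [a ha] [c hc] /= Pa Tac; apply: (st a) => //.
    by move: ha; rewrite inE.
  by move: hc; rewrite inE.
have wF : forall y, w \in td_bag y -> y \in F.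
  apply: inv => // x y xF Txy wx wy; apply: contraT => yF.
  by move: wt; rewrite -(bd x y xF yF Txy) wx.
pose Q := [pred x | (x \in F) && (x != t)].
pose e' := fun a c : node => [&& T a c, Q a & Q c].
have Q1 : Q t1 by rewrite /Q /= t1F; apply: contraNneq wt => <-.
pose F' := [set y | connect e' t1 y].
have F'Q y : y \in F' -> Q y.
  by rewrite inE => /(@connect_inv _ _ Q); apply => // a c _ /and3P[].
have e'sym : symmetric e' by move=> a c; rewrite /e' (edge_sym T) [Q a && _]andbC.
have leave x y : x \in F' -> y \notin F' -> T x y -> y = t.
  move=> xF' yF' Txy; have /andP[xF xt] := F'Q x xF'.
  apply: contraTeq yF' => yt; rewrite negbK.
  have yF : y \in F.
    by apply: contraT => yF; move: xt; rewrite (bd x y xF yF Txy) eqxx.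
  move: xF'; rewrite !inE => h; apply: connect_trans h (connect1 _).
  by rewrite /e' Txy /Q /= xF xt yF yt.
have wF' : sub_v w \subset F'.
  apply/fintype.subsetP => y; rewrite inE => wy; move: y wy; apply: inv; first by rewrite inE connect0.
  move=> x y xF' Txy wx wy; apply: contraT => yF'.
  by move: wt; rewrite -(leave x y xF' yF' Txy) wy.
have ltF : #|F'| <= n.
  rewrite -ltnS; apply: leq_trans leF; apply: proper_card; apply/properP; split.
    by apply/fintype.subsetP => y /F'Q /andP[].
  by exists t => //; apply/negP => /F'Q; rewrite /Q /= eqxx andbF.
(* All edges leaving the component [F'] end in [t]; by acyclicity they start at a single node, the
   new exit. If there are none, any node of [F'] will do. *)
case: (pickP [pred x | (x \in F') && T x t]) => [t' /andP[t'F' Tt']|none].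
  apply: (IH F' t' (~~ b) w ltF t'F' _ wI wF') => x y xF' yF' Txy.
  have yt := leave x y xF' yF' Txy; rewrite yt in Txy.
  apply: (@two_neighbours t x t' Q); rewrite ?[T t _](edge_sym T) //; last exact: F'Q.
    by rewrite /Q /= eqxx andbF.
  move: xF' t'F'; rewrite !inE => h1 h2.
  apply: connect_trans h2; rewrite -/e' in h1 *.
  by have := sym_connect_sym e'sym t1 x; rewrite h1 => <-.
apply: (IH F' t1 (~~ b) w ltF _ _ wI wF'); first by rewrite inE connect0.
move=> x y xF' yF' Txy; have yt := leave x y xF' yF' Txy.
by have := none x; rewrite /= xF' -yt Txy.
Qed.

End TreeBag.

Lemma alpha_ge (V : finType) (G : graph V) (A : {set V}) : stable G A -> #|A| <= alpha G.
Proof. by move=> sA; rewrite /alpha; apply: (leq_bigmax_cond (F := fun A : {set V} => #|A|)). Qed.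

Lemma alpha_induced_ge (V : finType) (G : graph V) (X A : {set V}) :
  stable G A -> A \subset X -> #|A| <= alpha (Defs.induced G X).
Proof.
move=> sA AX.
pose B := [set x : {x | x \in X} | val x \in A].
have <- : #|B| = #|A|.
  rewrite -(card_imset _ val_inj); apply: eq_card => a; apply/imsetP/idP => [[x xB ->]|aA].
    by rewrite inE in xB.
  by exists (exist _ a (fintype.subsetP AX a aA)); rewrite ?inE.
apply: alpha_ge; apply/forallP => u; apply/implyP; rewrite inE => uA.
apply/forallP => v; apply/implyP; rewrite inE => vA.
by have /forallP/(_ (val u))/implyP/(_ uA)/forallP/(_ (val v))/implyP/(_ vA) := sA.
Qed.

Lemma alpha_induced_le (V : finType) (G : graph V) (X : {set V}) : alpha (Defs.induced G X) <= alpha G.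
Proof.
apply/bigmax_leqP => B sB; rewrite -(card_imset _ val_inj); apply: alpha_ge.
apply/forallP => u; apply/implyP => /imsetP[u' u'B ->].
apply/forallP => v; apply/implyP => /imsetP[v' v'B ->].
by have /forallP/(_ u')/implyP/(_ u'B)/forallP/(_ v')/implyP/(_ v'B) := sB.
Qed.

(** Witnessed by the decomposition with a single bag. *)
Lemma tree_alpha_le_alpha (V : finType) (G : graph V) : tree_alpha G <= alpha G.
Proof.
pose T := Graph no_edge_sym no_edge_irr.
have tT : is_tree T.
  split; first by rewrite card_unit.
  - by move=> [] []; apply: connect0.
  - by move=> [|[] [|[] p]].
have D : {D : tree_decomposition G | td_alpha D <= alpha G}.
  have h1 v : exists t : unit, v \in [set: V] by exists tt; rewrite inE.
  have h2 u v : G u v -> exists t : unit, (u \in [set: V]) && (v \in [set: V]) by move=> _; exists tt; rewrite !inE.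
  have h3 v : connected_graph (Defs.induced T [set t | v \in [set: V]]).
    move=> [[] su] [[] sv].
    by rewrite (bool_irrelevance su sv); apply: connect0.
  exists (@TreeDecomposition V G _ T (fun _ => [set: V]) tT h1 h2 h3).
  by apply/bigmax_leqP => t _; apply: alpha_induced_le.
case: D => D le; rewrite /tree_alpha; case: ex_minnP => m _ /(_ (td_alpha D)) h.
by apply: leq_trans le; apply: h; apply/asboolP; exists D.
Qed.

Lemma tree_alpha_attained (V : finType) (G : graph V) :
  exists D : tree_decomposition G, td_alpha D = tree_alpha G.
Proof. by rewrite /tree_alpha; case: ex_minnP => m /asboolP. Qed.

Section Double.
Variables (N : nat) (R : rel nat).
Hypothesis Rsym : symmetric R.

(* The join of two copies of the graph whose edges are the pairs of distinct
   [R]-unrelated vertices; the parity of a vertex is its side. *)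
Definition dbl (i j : nat) : bool :=
  (odd i != odd j) || (i./2 != j./2) && ~~ R i./2 j./2.

Lemma dbl_sym : symmetric (fun i j : 'I_(N * 2) => dbl i j).
Proof. by move=> i j; rewrite /dbl eq_sym [i./2 == _]eq_sym Rsym. Qed.

Lemma dbl_irr : irreflexive (fun i j : 'I_(N * 2) => dbl i j).
Proof. by move=> i; rewrite /dbl !eqxx. Qed.

Definition dblG : graph 'I_(N * 2) := Graph dbl_sym dbl_irr.

Lemma half_ltN (i : 'I_(N * 2)) : i./2 < N.
Proof. by rewrite ltn_half_double -muln2. Qed.

Lemma dbl_ltN (b : bool) (i : 'I_N) : b + i.*2 < N * 2.
Proof. by have := ltn_ord i; case: b; lia. Qed.

Lemma tree_alpha_dbl_ge (A : {set 'I_N}) :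
  {in A &, forall u v : 'I_N, u != v -> R u v} -> #|A| <= tree_alpha dblG.
Proof.
move=> RA; have [D <-] := tree_alpha_attained dblG.
pose J b := [set Ordinal (dbl_ltN b i) | i in A].
have [|t [b JX]] := @bag_side _ _ D J.
  move=> u w /imsetP[i iA ->] /imsetP[j jA ->].
  by rewrite /= /dbl /= !oddD !odd_double.
have cJ : #|J b| = #|A|.
  by rewrite card_imset // => i j /(congr1 val) /= h; apply: val_inj => /=; lia.
have sJ : stable dblG (J b).
  apply/forallP => u; apply/implyP => /imsetP[i iA ->].
  apply/forallP => v; apply/implyP => /imsetP[j jA ->].
  rewrite /= /dbl /= !oddD !odd_double eqxx /= !halfD !odd_double !doubleK !andbF !add0n.
  rewrite (_ : (b : nat)./2 = 0) ?add0n; last by case: (b).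
  by rewrite negb_and negbK; case: eqVneq => //= ne; rewrite negbK RA //; apply: contraNneq ne => ->.
rewrite -cJ; apply: leq_trans (alpha_induced_ge sJ JX) _.
exact: (leq_bigmax_cond (F := fun t => alpha (Defs.induced dblG (td_bag t)))).
Qed.

(** An independent set of a join lies on one side, so halving is injective on it and its image is a
    clique of [R]. *)
Lemma tree_alpha_dbl_gt m : 0 < m < tree_alpha dblG ->
  exists2 A : {set 'I_N}, m < #|A| & {in A &, forall u v : 'I_N, u != v -> R u v}.
Proof.
move=> /andP[m0 mlt].
have {mlt} mlt : m < alpha dblG := leq_trans mlt (tree_alpha_le_alpha _).
have [B sB cB] : exists2 B : {set 'I_(N * 2)}, stable dblG B & m < #|B|.
  have [|B sB e] := @eq_bigmax_cond _ (fun B => stable dblG B) (fun B : {set 'I_(N * 2)} => #|B|).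
    by apply/card_gt0P; exists set0; rewrite unfold_in; apply/forallP => u; rewrite inE.
  by exists B => //; rewrite -e.
have sB' i j : i \in B -> j \in B -> ~~ dbl i j.
  by move=> iB jB; have /forallP/(_ i)/implyP/(_ iB)/forallP/(_ j)/implyP/(_ jB) := sB.
pose h (i : 'I_(N * 2)) : 'I_N := Ordinal (half_ltN i).
have par i j : i \in B -> j \in B -> odd i = odd j.
  by move=> iB jB; have := sB' i j iB jB; rewrite /dbl negb_or negbK => /andP[/eqP].
have hinj : {in B &, injective h}.
  move=> i j iB jB /(congr1 val) /= e; apply: val_inj => /=.
  by rewrite -(odd_double_half i) -(odd_double_half j) e (par i j).
exists (h @: B); first by rewrite card_in_imset.
move=> u v /imsetP[i iB ->] /imsetP[j jB ->] ne.
have := sB' i j iB jB; rewrite /dbl negb_or negb_and !negbK => /andP[_ /orP[/eqP e|//]].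
by move: ne; rewrite (_ : h i = h j) ?eqxx //; apply: val_inj.
Qed.

End Double.

(** * Deciding by a query to a machine *)

Section Emit.
Variable A : finType.
Notation G := (bool + A)%type.
Notation cmd := (cmd A).
Notation st := (st A).
Variable T : Type.
Variables (X : T -> seq bool) (S : T -> nat) (B : seq (T -> nat)).

Definition emits (y : T -> seq bool) : Prop :=
  exists (E : seq nat -> nat -> cmd) (tau : T -> nat),
    [/\ pbd S (fun t => size (y t)), pbd S tau &
    forall t rs b s, 0 < b -> all (fun r => r < b) rs ->
      s 0 = [seq inl x | x <- X t] ->
      [seq s r | r <- rs] = [seq un A (g t) | g <- B] ->
      (forall i, b <= i -> s i = [::]) ->
      runs (E rs b) s (tau t) (upd s b [seq inl x | x <- y t])].

(** A stack is filled from the bottom, so the bits are computed from last to first. The number of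
    rounds left is then the index of the current bit, and the loop counter itself serves as the
    bound variable. *)
Lemma emitP (n : T -> nat) (P : T -> nat -> bool) : pt A X S B n ->
  pt A (eX X) (eS S) (eB B) (fun p => nat_of_bool (P p.1 p.2)) ->
  emits (fun t => mkseq (P t) (n t)).
Proof.
move=> [Pn [tau [bn btau hP]]] [R [sig [_ [c hsig] hR]]].
pose body b rs := Seq (R (b.+1 :: rs) b.+2)
  (Seq (Case b.+2 (fun g => Push b (inl (isSome g)))) (clear A b.+2)).
pose D t := (S t + n t + 2) ^ c + 20.
have bD : pbd S D.
  apply: pbd_add; last exact: pbd_const.
  apply: pbd_exp; apply: pbd_add; last exact: pbd_const.
  by apply: pbd_add => //; apply: pbd_size.
exists (fun rs b => Seq (Pn rs b.+1) (While b.+1 isSome (Seq (Pop A b.+1) (body b rs)))).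
exists (fun t => (tau t + (n t * (D t + 3)).+1).+1); split.
- by apply: pbd_le bn => t; rewrite size_mkseq.
- apply: pbd_succ; apply: pbd_add => //; apply: pbd_succ; apply: pbd_mul => //.
  by apply: pbd_add => //; apply: pbd_const.
move=> t rs b s b0 ars s0 srs sb.
have bb1 : b <= b.+1 by []. have bb2 : b <= b.+2 by rewrite -addn2 leq_addr.
have [b1 ars1 s10 srs1] := frame_ok b0 bb1 ars s0 srs (fun i _ => erefl).
have sb1 i : b < i -> s i = [::] by move=> ib; apply: sb; apply: ltnW.
have h1 := hP t rs b.+1 s b1 ars1 s0 srs sb1.
pose out i := [seq inl x | x <- drop (n t - i) (mkseq (P t) (n t))] : seq G.
pose Inv i := upd (upd s b (out i)) b.+1 (un A (n t - i)).
have n01 : (b == b.+1) = false by lia.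
have n02 : (b == b.+2) = false by lia.
have n10 : (b.+1 == b) = false by lia.
have n12 : (b.+1 == b.+2) = false by lia.
have n20 : (b.+2 == b) = false by lia.
have n21 : (b.+2 == b.+1) = false by lia.
pose nE := (updE, eqxx, n01, n02, n10, n12, n20, n21).
have e1 : upd s b.+1 (un A (n t)) = Inv 0.
  apply/funext => i; rewrite /Inv /out subn0 drop_oversize ?size_mkseq // !updE.
  by case: eqP => // _; case: eqP => [->|//]; rewrite sb.
rewrite e1 in h1.
have h2 : runs (While b.+1 isSome (Seq (Pop A b.+1) (body b rs))) (Inv 0) (n t * (D t + 3)).+1 (Inv (n t)).
  apply: (@runs_for A b.+1) => i lt; first by rewrite /Inv !nE.
  set s3 := upd _ _ _.
  have e3 : s3 = upd (upd s b (out i)) b.+1 (un A (n t - i.+1)) by rewrite /s3 /Inv upd_upd.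
  have es j : j < b -> s3 j = s j by move=> jb; rewrite e3 !upd_other //; lia.
  have [b3 ars3 s30 srs3] := frame_ok b0 bb2 ars s0 srs es.
  have h4 : runs (R (b.+1 :: rs) b.+2) s3 (sig (t, n t - i.+1)) (upd s3 b.+2 (un A (P t (n t - i.+1)))).
    apply: (hR (t, n t - i.+1)) => //.
    - by rewrite /= ars3 andbT; lia.
    - by rewrite /= -!map_comp; congr (_ :: _); [rewrite e3 !nE|rewrite srs3].
    - by move=> j jb; rewrite e3 !upd_other ?sb //; lia.
  set s4 := upd _ _ _ in h4.
  have s4b2 : s4 b.+2 = un A (P t (n t - i.+1)) by rewrite /s4 upd_same.
  have h5 : runs (Case b.+2 (fun g => Push b (inl (isSome g)))) s4 3 (upd s4 b (inl (P t (n t - i.+1)) :: s4 b)).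
    apply: runs_case; rewrite s4b2.
    have -> : isSome (ohead (un A (P t (n t - i.+1)))) = P t (n t - i.+1) by case: (P t _).
    exact: runs_push.
  set s5 := upd _ _ _ in h5.
  have h6 := runs_clear b.+2 s5.
  have s5b2 : s5 b.+2 = s4 b.+2 by rewrite /s5 !nE.
  rewrite s5b2 s4b2 size_nseq in h6.
  apply: runs_eq (runs_le _ (runs_seq h4 (runs_seq h5 h6))) => [j|]; last first.
    have : sig (t, n t - i.+1) <= (S t + n t + 2) ^ c.
      apply: leq_trans (hsig _) _; case: (c) => // c'; rewrite leq_exp2r // /eS /=.
      by rewrite leq_add2r leq_add2l leq_subr.
    by rewrite /D; case: (P t _); lia.
  have s4b : s4 b = out i by rewrite /s4 e3 !nE.
  have eo : out i.+1 = inl (P t (n t - i.+1)) :: out i.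
    rewrite /out (drop_nth false) ?size_mkseq; last by lia.
    have -> : (n t - i.+1).+1 = n t - i by lia.
    by rewrite nth_mkseq //; lia.
  rewrite /s5 s4b -eo /s4 e3 /Inv !updE.
  case: (eqVneq j b.+2) => [->|m2]; first by rewrite n20 n21 sb.
  by case: (eqVneq j b) => [->|m0]; rewrite ?n01.
apply: runs_eq (runs_seq h1 h2) => i.
rewrite /Inv /out subnn drop0 !updE; case: (eqVneq i b.+1) => [->|//].
by rewrite n10 sb.
Qed.

Section Decide.
Variables (M : TM) (e : symbol (tm_work M) + tm_state M -> A).
Hypothesis e_inj : injective e.

(** The context values will be hard-wired constants, but they reach the program through registers,
    which keeps the polynomial bound [tau] uniform in them. *)
Fixpoint push_consts (r : nat) (cs : seq nat) : cmd :=
  if cs is c :: cs' then Seq (pushn A r c) (push_consts r.+1 cs') else Skip A.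

Lemma runs_push_consts r cs (s : st) : (forall i, r <= i -> s i = [::]) ->
  runs (push_consts r cs) s (4 * (sumn cs + size cs)).+1
    (fun i => if i < r then s i else if i < r + size cs then un A (nth 0 cs (i - r)) else [::]).
Proof.
elim: cs r s => [|c cs IH] r s hs /=.
  apply: runs_eq (runs_skip s) => i; rewrite addn0; case: ltnP => // le; rewrite hs //.
have h1 := runs_pushn r c s; rewrite hs // cats0 in h1.
have hs' i : r < i -> upd s r (un A c) i = [::] by move=> le; rewrite upd_other ?hs //; lia.
have h2 := IH r.+1 _ hs'.
apply: runs_eq (runs_le _ (runs_seq h1 h2)) => [i|]; last by lia.
rewrite updE; case: (eqVneq i r) => [->|ne].
    by rewrite ltnSn ltnn subnn /= -addSnnS ltnS leq_addr.
  rewrite ltnS leq_eqVlt (negbTE ne) /=; case: ltnP => // le.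
  rewrite addSnnS; case: ifP => // lt.
  by have -> : i - r = (i - r.+1).+1 by lia.
Qed.

Definition answer (b : nat) : cmd :=
  Case b (fun g => Seq (clear A b) (Seq (clear A 0)
    (Push 0 (inl (if g is Some (inl false) then true else false))))).

(* Runs [M] on the string [y t] and answers [true] when its output starts with
   [false]. *)
Lemma decider (y : T -> seq bool) : emits y ->
  exists (c : seq nat -> cmd) (tau : T -> nat), pbd S tau /\
    forall (cs : seq nat) t s time z, s 0 = [seq inl x | x <- X t] ->
      (forall i, 0 < i -> s i = [::]) ->
      [seq g t | g <- B] = cs ->
      computes_within M time (y t) z ->
      exists2 s', runs (c cs) s (tau t + 4 * (sumn cs + size cs) + (call_cost M + 4) * (time + size (y t)).+1 + 2 * size (X t) + 20) s' &
        s' 0 = [:: inl (if z is false :: _ then true else false)].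
Proof.
move=> [E [tau [by_ btau hE]]].
exists (fun cs => Seq (push_consts 1 cs) (Seq (E (iota 1 (size cs)) (size cs).+1)
   (Seq (call e (size cs).+1) (answer (size cs).+1)))), tau; split => //.
move=> cs t s time z s0 sz csE cw.
have h1 := runs_push_consts cs sz.
set s1 := (fun i => _) in h1.
pose b := (size cs).+1.
have s1z i : b <= i -> s1 i = [::].
  by move=> le; rewrite /s1 !ifN //; rewrite /b in le; lia.
have s10 : s1 0 = [seq inl x | x <- X t] by [].
have s1rs : [seq s1 r | r <- iota 1 (size cs)] = [seq un A (g t) | g <- B].
  have -> : [seq un A (g t) | g <- B] = [seq un A c | c <- cs] by rewrite -csE -map_comp.
  rewrite -[in RHS](mkseq_nth 0 cs) /mkseq -map_comp -[1]addn0 iotaDl -map_comp.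
  apply/eq_in_map => i; rewrite mem_iota /= /s1 /= => lt.
  by rewrite add1n ltnS lt subSS subn0.
have ars : all (fun r => r < b) (iota 1 (size cs)).
  by apply/allP => r; rewrite mem_iota /b; lia.
have h2 := hE t _ b s1 isT ars s10 s1rs s1z.
set s2 := upd _ _ _ in h2.
have s2b : s2 b = [seq inl x | x <- y t] by rewrite /s2 upd_same.
have s2z i : b < i -> s2 i = [::] by move=> le; rewrite /s2 upd_other ?s1z //; lia.
have [h3 szz] := callP e_inj cw s2b s2z.
set s3 := upd _ _ _ in h3.
have s3b : s3 b = [seq inl x | x <- z] by rewrite /s3 upd_same.
have h4 := runs_clear b s3; rewrite s3b size_map in h4.
set s4 := upd _ _ _ in h4.
have h5 := runs_clear 0 s4.
have s40 : s4 0 = [seq inl x | x <- X t] by rewrite /s4 /s3 /s2 !upd_other.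
rewrite s40 size_map in h5.
set s5 := upd _ _ _ in h5.
have h6 := runs_push 0 (inl (if z is false :: _ then true else false)) s5.
exists (upd s5 0 [:: inl (if z is false :: _ then true else false)]); last by rewrite upd_same.
have e5 : s5 0 = [::] by rewrite /s5 upd_same.
rewrite e5 in h6.
have h7 : runs (answer b) s3 ((2 * size z).+1 + ((2 * size (X t)).+1 + 2).+1).+2
   (upd s5 0 [:: inl (if z is false :: _ then true else false)]).
  apply: runs_case; rewrite s3b.
  have -> : (if ohead [seq inl x | x <- z] is Some (inl false) then true else false : bool) =
     (if z is false :: _ then true else false).
    by case: (z) => [|[] l].
  exact: (runs_seq h4 (runs_seq h5 h6)).
apply: runs_le (runs_seq h1 (runs_seq h2 (runs_seq h3 h7))).
by move: szz; nia.
Qed.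

End Decide.
End Emit.

(** The measure [S] is arbitrary, so [f] may outgrow every polynomial: [S] gathers the running times
    of the machines that the program calls. *)
Lemma computable_of_pt (A : finType) (S f : nat -> nat) :
  pt A (fun _ : nat => [::]) S [:: id] f -> computable f.
Proof.
move=> [P [tau [_ _ hP]]].
pose ist (g : option (bool + A)) := if g is Some (inl true) then true else false.
pose c := Seq (transfer ist 0 1) (Seq (Pop A 0) (Seq (P [:: 1] 2) (Seq (Push 0 (inl false)) (move_all A 2 0)))).
exists (compile c) => n.
pose s0 := init_st A (enc_nat n).
have s00 : s0 0 = un A n ++ [:: inl false] by rewrite /s0 /init_st /= map_enc_nat cats1.
have alln : all (fun g => ist (Some g)) (un A n) by apply/allP => g /nseqP[-> _].
have h1 := @runs_transfer A ist 0 1 s0 (un A n) [:: inl false] isT s00 alln isT.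
rewrite rev_un cats0 in h1.
set s1 := upd _ _ _ in h1.
have h2 := runs_pop 0 s1.
have s10 : s1 0 = [:: inl false] by [].
rewrite s10 /= in h2.
set s2 := upd _ _ _ in h2.
have s2z i : 2 <= i -> s2 i = [::] by case: i => [|[]].
have h3 := hP n [:: 1] 2 s2 isT isT erefl erefl s2z.
set s3 := upd _ _ _ in h3.
have h4 := runs_push 0 (inl false) s3.
set s4 := upd _ _ _ in h4.
have h5 := @runs_move A 2 0 s4 isT.
have [t _ rn] := runs_seq h1 (runs_seq h2 (runs_seq h3 (runs_seq h4 h5))).
exists t; have := compileP rn (leqnn t).
by rewrite upd_same rev_un -[X in lead X]/(un A (f n) ++ [:: inl false]) cats1 -map_enc_nat lead_inl.
Qed.

(** * Gap amplification by linear functions *)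

Lemma xornCA : left_commutative xorn.
Proof. by move=> a b c; rewrite !xornA [xorn a b]xornC. Qed.

Lemma xornACA : interchange xorn xorn.
Proof. by move=> a b c d; rewrite -!xornA [xorn b _]xornCA. Qed.

Definition dig (D v j : nat) : nat := (v %/ D ^ j) %% D.

Lemma digS D v j : dig D v j.+1 = dig D (v %/ D) j.
Proof. by rewrite /dig expnS divnMA. Qed.

Lemma dig0 D v : dig D v 0 = v %% D.
Proof. by rewrite /dig expn0 divn1. Qed.

Lemma dig_lt D v j : 0 < D -> dig D v j < D.
Proof. by move=> D0; rewrite ltn_pmod. Qed.

Lemma dig_exists D Q (f : nat -> nat) : (forall j, j < Q -> f j < D) ->
  exists2 v, v < D ^ Q & forall j, j < Q -> dig D v j = f j.
Proof.
elim: Q f => [|Q IH] f hf; first by exists 0; rewrite ?expn0.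
have [j jQ|v vD hv] := IH (fun j => f j.+1); first exact: hf.
have f0 := hf 0 isT.
exists (v * D + f 0).
  rewrite expnS [D * _]mulnC; apply: leq_trans (_ : v.+1 * D <= _); first by rewrite mulSn; lia.
  by rewrite leq_mul2r vD orbT.
case=> [|j] jQ; first by rewrite dig0 modnMDl modn_small.
rewrite digS divnMDl ?(leq_ltn_trans _ f0) // (divn_small f0) addn0; exact: hv.
Qed.

Lemma dig_inj D Q v w : v < D ^ Q -> w < D ^ Q ->
  (forall j, j < Q -> dig D v j = dig D w j) -> v = w.
Proof.
elim: Q v w => [|Q IH] v w; first by rewrite expn0; case: v; case: w.
rewrite expnS => vD wD h.
have D0 : 0 < D by case: (D) vD.
rewrite (divn_eq v D) (divn_eq w D) -!dig0 (h 0) //; congr (_ * _ + _).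
apply: IH; rewrite ?ltn_divLR // 1?mulnC // => j jQ.
by have := h j.+1 jQ; rewrite !digS.
Qed.

Section Gap.
Variables (kappa h Q0 : nat).
Let K := 2 ^ kappa.
Let H := 2 ^ h.
Let Q := Q0.+2.
Let D := K * H.
Variable Phi : (nat -> nat) -> (nat -> nat) -> bool.
Hypothesis Phi_ext : forall c c' u u',
  (forall j, j < Q -> c j = c' j) -> (forall j, j < Q -> u j = u' j) -> Phi c u = Phi c' u'.

(* Coordinate [j < Q] of a vertex is a point of F_2^kappa, coded by a number,
   together with the claimed value in F_2^h of the unknown linear function at
   that point; coordinate [Q] stands for the sum of the first two points. *)
Definition acoord (v j : nat) : nat := dig D v j %% K.
Definition ycoord (v j : nat) : nat := dig D v j %/ K.
Definition apt (v j : nat) : nat := if j < Q then acoord v j else xorn (acoord v 0) (acoord v 1).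
Definition ypt (v j : nat) : nat := if j < Q then ycoord v j else xorn (ycoord v 0) (ycoord v 1).
Definition is_pow (c : nat) : bool := has (fun i => c == 2 ^ i) (iota 0 kappa).

(** A clique thus describes one partial function on the points. Coordinate [Q] takes part, which
    builds the linearity test into consistency. *)
Definition consistent (v w : nat) : bool :=
  all (fun j => all (fun j' => (apt v j == apt w j') ==> (ypt v j == ypt w j'))
    (iota 0 Q.+1)) (iota 0 Q.+1).
(** If the points differ by a unit vector, the difference of the claimed values is the value of the
    linear function at that vector, that is, one of the unknown numbers. *)
Definition checked (v w : nat) : bool :=
  all (fun j => is_pow (xorn (acoord v j) (acoord w j))) (iota 0 Q) ==>
  Phi (fun j => xorn (acoord v j) (acoord w j)) (fun j => xorn (ycoord v j) (ycoord w j)).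
Definition compat (v w : nat) : bool := consistent v w && checked v w.

Lemma compat_sym : symmetric compat.
Proof.
suff imp v w : compat v w -> compat w v by move=> v w; apply/idP/idP; apply: imp.
move=> /andP[c1 c2]; apply/andP; split.
  apply/allP => j jQ; apply/allP => j' j'Q; have /allP/(_ _ jQ) := allP c1 _ j'Q.
  by rewrite eq_sym [ypt v _ == _]eq_sym.
move: c2; rewrite /checked.
have -> : (fun j => xorn (acoord v j) (acoord w j)) = (fun j => xorn (acoord w j) (acoord v j)).
  by apply/funext => j; rewrite xornC.
have -> : (fun j => xorn (ycoord v j) (ycoord w j)) = (fun j => xorn (ycoord w j) (ycoord v j)).
  by apply/funext => j; rewrite xornC.
by congr (_ ==> _); apply: eq_all => j; rewrite xornC.
Qed.

Let K0 : 0 < K. Proof. by rewrite /K expn_gt0. Qed.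
Let H0 : 0 < H. Proof. by rewrite /H expn_gt0. Qed.
Let D0 : 0 < D. Proof. by rewrite /D muln_gt0 K0 H0. Qed.

Lemma acoord_lt v j : acoord v j < K.
Proof. exact: ltn_pmod. Qed.

Lemma ycoord_lt v j : ycoord v j < H.
Proof. by rewrite /ycoord ltn_divLR // mulnC dig_lt. Qed.

Lemma coords_exist (a y : nat -> nat) : (forall j, j < Q -> a j < K) -> (forall j, j < Q -> y j < H) ->
  exists2 v, v < D ^ Q & forall j, j < Q -> acoord v j = a j /\ ycoord v j = y j.
Proof.
move=> ha hy; have [j jQ|v vD hv] := @dig_exists D Q (fun j => y j * K + a j).
  have h1 := ha j jQ; have h2 := hy j jQ.
  apply: leq_trans (_ : (y j).+1 * K <= _); first by rewrite mulSn addnC ltn_add2r.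
  by rewrite /D mulnC leq_mul2l h2 orbT.
exists v => // j jQ; rewrite /acoord /ycoord hv // modnMDl modn_small ?ha //.
by rewrite divnMDl // divn_small ?ha // addn0.
Qed.

Lemma coords_inj v w : v < D ^ Q -> w < D ^ Q ->
  (forall j, j < Q -> acoord v j = acoord w j /\ ycoord v j = ycoord w j) -> v = w.
Proof.
move=> vD wD e; apply: (dig_inj vD wD) => j jQ.
have [e1 e2] := e j jQ.
by rewrite (divn_eq (dig D v j) K) (divn_eq (dig D w j) K) -!/(ycoord _ _) -!/(acoord _ _) e1 e2.
Qed.

(** The linear function on F_2^kappa with value [u i] at the unit vector [2 ^ i]. *)
Definition lincomb (u : nat -> nat) (a : nat) : nat :=
  foldr xorn 0 [seq if bitn a i then u i else 0 | i <- iota 0 kappa].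

Lemma lincomb_xor u a b : lincomb u (xorn a b) = xorn (lincomb u a) (lincomb u b).
Proof.
rewrite /lincomb; elim: (iota 0 kappa) => [|i l IH] /=; first by rewrite xornn.
rewrite IH bitn_xor; move: (foldr _ _ _) (foldr _ _ _) => p q.
case: (bitn a i); case: (bitn b i) => /=; rewrite ?[xorn 0 _]xornC ?xorn0 //.
- by rewrite xornACA xornn [RHS]xornC xorn0.
- by rewrite xornA.
- by rewrite xornCA.
Qed.

Lemma bitn_pow2 i j : bitn (2 ^ i) j = (i == j).
Proof.
rewrite /bitn; case: (ltngtP i j) => [lt|lt|->].
- by rewrite divn_small // ltn_exp2l.
- rewrite -(subnK (ltnW lt)) expnD mulnK ?expn_gt0 // oddX orbF.
  by rewrite subn_eq0 leqNgt lt.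
- by rewrite divnn expn_gt0.
Qed.

Lemma lincomb_pow2 u i : i < kappa -> lincomb u (2 ^ i) = u i.
Proof.
move=> lt; have : i \in iota 0 kappa by rewrite mem_iota.
have : uniq (iota 0 kappa) by apply: iota_uniq.
rewrite /lincomb; elim: (iota 0 kappa) => //= j l IH /andP[jl ul].
rewrite inE bitn_pow2; case: (eqVneq i j) => [ij|ne] /=; last by rewrite xornC xorn0; apply: IH.
rewrite -ij in jl *.
suff -> : foldr xorn 0 [seq if bitn (2 ^ i) k then u k else 0 | k <- l] = 0 by rewrite xorn0.
elim: l jl {IH ul} => //= k l IH; rewrite inE negb_or => /andP[jk jl].
rewrite bitn_pow2 IH //; case: (eqVneq i k) => [ik|_]; last exact: xornn.
by rewrite -ik eqxx in jk.
Qed.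

Lemma lincomb_lt u a : (forall i, i < kappa -> u i < H) -> lincomb u a < H.
Proof.
move=> hu; have : {in iota 0 kappa, forall i, u i < H} by move=> i; rewrite mem_iota; apply: hu.
rewrite /lincomb; elim: (iota 0 kappa) => [_|i l IH hl] //=.
apply: xorn_lt; last by apply: IH => j jl; apply: hl; rewrite inE jl orbT.
by case: ifP => // _; apply: hl; rewrite inE eqxx.
Qed.

(** The clique consists of the vertices that tell the truth about [lincomb u], one for each
    [Q]-tuple of points. *)
Lemma gap_complete (u : nat -> nat) : (forall i, i < kappa -> u i < H) ->
  (forall idx : nat -> nat, (forall j, j < Q -> idx j < kappa) ->
     Phi (fun j => 2 ^ idx j) (fun j => u (idx j))) ->
  exists2 C : {set 'I_(D ^ Q)}, #|C| = K ^ Q & {in C &, forall v w : 'I_(D ^ Q), compat v w}.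
Proof.
move=> hu hPhi.
pose good (v : nat) := forall j, j < Q -> ycoord v j = lincomb u (acoord v j).
have ex (P : {ffun 'I_Q -> 'I_K}) : {v : 'I_(D ^ Q) | good v /\ forall j : 'I_Q, acoord v j = P j}.
  apply: cid.
  have [j jQ|j jQ|v vD hv] := @coords_exist (fun j => P (inord j)) (fun j => lincomb u (P (inord j))).
  - exact: ltn_ord.
  - exact: lincomb_lt.
  exists (Ordinal vD); split => [j jQ|j].
    by have [-> ->] := hv j jQ.
  by have [-> _] := hv j (ltn_ord j); rewrite inord_val.
exists [set sval (ex P) | P : {ffun 'I_Q -> 'I_K}].
  rewrite card_imset ?card_ffun ?card_ord // => P P' e.
  apply/ffunP => j; apply: val_inj.
  by rewrite /= -(proj2 (svalP (ex P))) e (proj2 (svalP (ex P'))).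
have gpt v j : good v -> j < Q.+1 -> ypt v j = lincomb u (apt v j).
  move=> gv; rewrite /ypt /apt ltnS => jQ; case: ifP => [/gv //|_].
  by rewrite !gv // lincomb_xor.
move=> _ _ /imsetP[P _ ->] /imsetP[P' _ ->].
have [g1 _] := svalP (ex P); have [g2 _] := svalP (ex P').
move: (sval (ex P)) (sval (ex P')) g1 g2 => v w gv gw.
apply/andP; split.
  apply/allP => j; rewrite mem_iota => jQ; apply/allP => j'; rewrite mem_iota => j'Q.
  by apply/implyP => /eqP e; rewrite !gpt // e.
apply/implyP => /allP pw.
have /choice[idx idxP] : forall j, exists i, j < Q -> i < kappa /\ xorn (acoord v j) (acoord w j) = 2 ^ i.
  move=> j; case: (ltnP j Q) => jQ; last by exists 0.
  have := pw j; rewrite mem_iota => /(_ jQ) /seq.hasP[i].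
  by rewrite mem_iota => ik /eqP e; exists i.
rewrite -(@Phi_ext (fun j => 2 ^ idx j) _ (fun j => u (idx j))).
- by apply: hPhi => j /idxP[].
- by move=> j /idxP[_ ->].
- by move=> j jQ; have [ik e] := idxP j jQ; rewrite gv // gw // -lincomb_xor e lincomb_pow2.
Qed.

Section Sound.
Variable C : {set 'I_(D ^ Q)}.
Hypothesis Ccompat : {in C &, forall v w : 'I_(D ^ Q), compat v w}.
Notation E := {ffun 'I_Q -> 'I_K}.

Definition group (v : 'I_(D ^ Q)) : E := [ffun j : 'I_Q => Ordinal (acoord_lt v j)].

Lemma C_cons v w j j' : v \in C -> w \in C -> j < Q.+1 -> j' < Q.+1 ->
  apt v j = apt w j' -> ypt v j = ypt w j'.
Proof.
move=> vC wC jQ j'Q e; have /andP[/allP/(_ j) + _] := Ccompat vC wC.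
rewrite mem_iota => /(_ jQ) /allP/(_ j'); rewrite mem_iota => /(_ j'Q).
by rewrite e eqxx => /eqP.
Qed.

(** Consistency fixes the values once the points are known, so the clique is counted by its tuples
    of points, and a nearly maximal clique misses few of them. *)
Lemma group_inj : {in C &, injective group}.
Proof.
move=> v w vC wC e; apply: val_inj; apply: (coords_inj (ltn_ord v) (ltn_ord w)) => j jQ.
have ea : acoord v j = acoord w j.
  by have /ffunP/(_ (Ordinal jQ)) := e; rewrite !ffunE => /(congr1 val).
split => //; have := @C_cons v w j j vC wC (ltnW jQ) (ltnW jQ).
by rewrite /apt /ypt jQ; apply.
Qed.

(** The partial function described by the clique, extended by 0 to points that it does not
    mention. *)
Definition xval (p : nat) : nat :=
  if [pick z : 'I_(D ^ Q) * 'I_Q.+1 | (z.1 \in C) && (apt z.1 z.2 == p)] is Some z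
  then ypt z.1 z.2 else 0.

Lemma xvalE v j : v \in C -> j < Q.+1 -> xval (apt v j) = ypt v j.
Proof.
move=> vC jQ; rewrite /xval; case: pickP => [[w j'] /= /andP[wC /eqP e]|/(_ (v, Ordinal jQ))].
  exact: (@C_cons w v j' j).
by rewrite /= vC eqxx.
Qed.

Lemma xval_coord v j : v \in C -> j < Q -> xval (acoord v j) = ycoord v j.
Proof. by move=> vC jQ; have := @xvalE v j vC (ltnW jQ); rewrite /apt /ypt jQ. Qed.

Lemma xval_sum v : v \in C ->
  xval (xorn (acoord v 0) (acoord v 1)) = xorn (xval (acoord v 0)) (xval (acoord v 1)).
Proof.
move=> vC; have := @xvalE v Q vC (ltnSn Q); rewrite /apt /ypt ltnn => ->.
by rewrite !xval_coord.
Qed.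

Definition addK (a c : 'I_K) : 'I_K := Ordinal (xorn_lt (ltn_ord a) (ltn_ord c)).
Definition addE (P : E) (c : 'I_Q -> 'I_K) : E := [ffun j => addK (P j) (c j)].

Lemma addKK c : involutive (addK^~ c).
Proof. by move=> a; apply: val_inj => /=; rewrite xorKn. Qed.

Lemma addEK c : involutive (addE^~ c).
Proof. by move=> P; apply/ffunP => j; rewrite !ffunE (addKK (c j)). Qed.

Definition bad : {set E} := ~: [set group v | v in C].

Lemma card_bad : #|bad| + #|C| = K ^ Q.
Proof.
by rewrite /bad -(card_in_imset group_inj) addnC cardsC card_ffun !card_ord.
Qed.

Lemma notbad P : P \notin bad -> exists2 v, v \in C & group v = P.
Proof. by rewrite inE negbK => /imsetP[v vC ->]; exists v. Qed.

(** The value at [c] as read off at [a]; for a linear function it does not depend on [a]. *)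
Definition delta (c a : 'I_K) : nat := xorn (xval (addK a c)) (xval a).

Let i0 : 'I_Q := ord0.
Let i1 : 'I_Q := Ordinal (isT : 1 < Q).

Lemma notbad_sum (P : E) : P \notin bad ->
  xval (addK (P i0) (P i1)) = xorn (xval (P i0)) (xval (P i1)).
Proof. by move=> /notbad[v vC <-]; rewrite !ffunE /= xval_sum. Qed.

Lemma card_involutive (f : E -> E) (A : {set E}) : involutive f -> #|[set P | f P \in A]| = #|A|.
Proof.
move=> fK; rewrite -(card_imset A (inv_inj fK)); apply: eq_card => P.
by rewrite inE; apply/idP/imsetP => [fP|[P' P'A ->]]; [exists (f P)|]; rewrite ?fK.
Qed.

(** If adding [c] to the first point and adding [c] to the second point both lead to tuples present
    in the clique, linearity evaluates the same sum in two ways, and the two differences agree. *)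
Lemma delta_pairs c : #|[set P : E | delta c (P i0) != delta c (P i1)]| <= #|bad| + #|bad|.
Proof.
pose s0 (P : E) := addE P (fun j => if j == i0 then c else Ordinal K0).
pose s1 (P : E) := addE P (fun j => if j == i1 then c else Ordinal K0).
rewrite -{1}(card_involutive bad (addEK _ : involutive s0)) -(card_involutive bad (addEK _ : involutive s1)).
apply: leq_trans (leq_card_setU _ _); apply: subset_leq_card; apply/fintype.subsetP => P.
rewrite !inE; apply: contraR; rewrite negb_or => /andP[h0 h1].
have a0 a : addK a (Ordinal K0) = a by apply: val_inj => /=; rewrite xorn0.
have s00 : s0 P i0 = addK (P i0) c by rewrite ffunE eqxx.
have s01 : s0 P i1 = P i1 by rewrite ffunE (_ : i1 == i0 = false) ?a0.
have s10 : s1 P i0 = P i0 by rewrite ffunE (_ : i0 == i1 = false) ?a0.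
have s11 : s1 P i1 = addK (P i1) c by rewrite ffunE eqxx.
have := notbad_sum (P := s0 P); rewrite inE => /(_ h0); rewrite s00 s01 => e0.
have := notbad_sum (P := s1 P); rewrite inE => /(_ h1); rewrite s10 s11 => e1.
apply/eqP; rewrite /delta.
have e2 : addK (addK (P i0) c) (P i1) = addK (P i0) (addK (P i1) c).
  by apply: val_inj => /=; rewrite -xornA [xorn c _]xornC.
have e3 : xorn (xval (addK (P i0) c)) (xval (P i1)) = xorn (xval (P i0)) (xval (addK (P i1) c)).
  by rewrite -e0 -e1 e2.
move: e3; move: (xval _) (xval _) (xval _) (xval _) => p q r s e3.
rewrite -[s](xorKn s r) e3 [xorn q p]xornC -!xornA [xorn r q]xornC [xorn q (xorn q r)]xornA.
by rewrite xornn [xorn 0 r]xornC xorn0.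
Qed.

Lemma swap_card (j : 'I_Q) c u :
  #|[set P : E | delta c (P j) != u]| = #|[set P : E | delta c (P i0) != u]|.
Proof.
pose f (P : E) : E := [ffun k => P (tperm i0 j k)].
have fK : involutive f by move=> P; apply/ffunP => k; rewrite !ffunE tpermK.
rewrite -(card_involutive [set P : E | delta c (P i0) != u] fK); apply: eq_card => P.
by rewrite !inE ffunE tpermL.
Qed.

(** Averaging: the best reference point [b] disagrees no more often than a random one, and
    disagreements of two independent points are counted by [delta_pairs]. *)
Lemma delta_major c : exists b : 'I_K, forall j : 'I_Q,
  #|[set P : E | delta c (P j) != delta c b]| <= #|bad| + #|bad|.
Proof.
pose F b := #|[set P : E | delta c (P i0) != delta c b]|.
pose b := [arg min_(b < Ordinal K0) F b].
exists b => j; rewrite swap_card -/(F b).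
have bmin b' : F b <= F b' by rewrite /b; case: arg_minnP => // b1 _ ->.
rewrite -(leq_pmul2l K0); apply: leq_trans (_ : \sum_(b' : 'I_K) F b' <= _).
  by rewrite -[X in X * _](card_ord K) -sum_nat_const; apply: leq_sum => b' _.
pose Z := [set z : 'I_K * E | delta c (z.2 i0) != delta c z.1].
have -> : \sum_(b' : 'I_K) F b' = #|Z|.
  transitivity (\sum_(b' : 'I_K) \sum_(P : E | delta c (P i0) != delta c b') 1).
    by apply: eq_bigr => a _; rewrite /F -sum1_card; apply: eq_bigl => P; rewrite inE.
  by rewrite pair_big_dep /= -sum1_card; apply: eq_bigl => z; rewrite inE.
(* Exchanging [b'] with the second point of the tuple turns a disagreement with a separate point
   into one within the tuple. *)
pose g (z : 'I_K * E) : 'I_K * E := (z.2 i1, [ffun k => if k == i1 then z.1 else z.2 k]).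
have gK : involutive g.
  move=> [a P]; rewrite /g /= ffunE eqxx; congr (_, _); apply/ffunP => k; rewrite !ffunE.
  by case: eqP => [->|].
rewrite -(card_imset _ (inv_inj gK)).
apply: leq_trans (_ : #|setX [set: 'I_K] [set P : E | delta c (P i0) != delta c (P i1)]| <= _); last first.
  by rewrite cardsX cardsT card_ord leq_mul2l delta_pairs orbT.
apply: subset_leq_card; apply/fintype.subsetP => _ /imsetP[[a P] + ->].
by rewrite !inE /= !ffunE /=.
Qed.

(** The decoded numbers are the values at unit vectors given by [delta_major]. For prescribed
    indices, a tuple is suitable if it is present, if its shift by the unit vectors is present, and
    if it agrees with the decoded value in each of the [Q] coordinates. The failures number at most
    [1 + 1 + 2 * Q] times the missing tuples, and the two vertices belonging to a suitable tuple and
    its shift run the test. *)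
Lemma gap_sound : (2 * Q + 2) * (K ^ Q - #|C|) < K ^ Q ->
  exists2 u : nat -> nat, (forall i, i < kappa -> u i < H) &
    (forall idx : nat -> nat, (forall j, j < Q -> idx j < kappa) ->
     Phi (fun j => 2 ^ idx j) (fun j => u (idx j))).
Proof.
move=> small.
have badE : K ^ Q - #|C| = #|bad| by rewrite -card_bad addnK.
rewrite badE in small.
have plt (i : 'I_kappa) : 2 ^ i < K by rewrite /K ltn_exp2l.
pose cc (i : 'I_kappa) : 'I_K := Ordinal (plt i).
pose bb i := sval (cid (delta_major (cc i))).
have bbP i := svalP (cid (delta_major (cc i))).
pose u (n : nat) := if insub n is Some i then delta (cc i) (bb i) else 0.
have uE (i : 'I_kappa) : u i = delta (cc i) (bb i) by rewrite /u valK.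
have key (idx : 'I_Q -> 'I_kappa) : exists v w, [/\ v \in C, w \in C &
   forall j : 'I_Q, xorn (acoord v j) (acoord w j) = 2 ^ idx j /\
     xorn (ycoord v j) (ycoord w j) = u (idx j)].
  pose s (P : E) := addE P (fun j => cc (idx j)).
  pose bj (j : 'I_Q) := [set P : E | delta (cc (idx j)) (P j) != delta (cc (idx j)) (bb (idx j))].
  pose U := bad :|: [set P | s P \in bad] :|: \bigcup_(j : 'I_Q) bj j.
  have cU : #|U| < K ^ Q.
    apply: leq_ltn_trans small.
    apply: leq_trans (leq_card_setU _ _) _.
    have h1 : #|bad :|: [set P | s P \in bad]| <= #|bad| + #|bad|.
      by apply: leq_trans (leq_card_setU _ _) _; rewrite (card_involutive bad (addEK _ : involutive s)).
    have h2 : #|\bigcup_(j : 'I_Q) bj j| <= Q * (#|bad| + #|bad|).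
      apply: leq_trans (_ : \sum_(j : 'I_Q) #|bj j| <= _).
        elim/big_ind2: _ => [|m A n B hA hB|//]; first by rewrite cards0.
        by apply: leq_trans (leq_card_setU _ _) _; apply: leq_add.
      rewrite -[X in X * _](card_ord Q) -sum_nat_const; apply: leq_sum => j _.
      exact: bbP.
    by apply: leq_trans (leq_add h1 h2) _; nia.
  have [P] : exists P, P \notin U.
    apply/existsP; rewrite -negb_forall; apply: contraTN cU => /forallP hU.
    rewrite -leqNgt -[X in X ^ _](card_ord K) -[X in _ ^ X](card_ord Q) -card_ffun -cardsT.
    by apply: subset_leq_card; apply/fintype.subsetP => P _; apply: hU.
  rewrite !inE !negb_or => /andP[/andP[P1 P2] P3].
  have [v vC vP] : exists2 v, v \in C & group v = P by apply: notbad; rewrite inE.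
  have [w wC wP] : exists2 v, v \in C & group v = s P by apply: notbad; rewrite inE.
  exists v, w; split => // j.
  have ev : acoord v j = P j by rewrite -vP ffunE.
  have ew : acoord w j = addK (P j) (cc (idx j)) by have := congr1 (fun f : E => val (f j)) wP; rewrite /s !ffunE.
  have jP : P \notin bj j.
    by apply: contra P3 => jP; apply/bigcupP; exists j.
  split; first by rewrite ev ew /= xornA xornn xornC xorn0.
  rewrite -!xval_coord // ev ew uE.
  by move: jP; rewrite inE negbK => /eqP <-; rewrite xornC.
exists u => [i ik|idx idxP].
  have [v [w [vC wC hvw]]] := key (fun _ => Ordinal ik).
  by have [_ <-] := hvw i0; apply: xorn_lt; apply: ycoord_lt.
pose idx' (j : 'I_Q) : 'I_kappa := Ordinal (idxP j (ltn_ord j)).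
have [v [w [vC wC hvw]]] := key idx'.
have /andP[_ /implyP ck] := Ccompat vC wC.
have hh j : j < Q -> xorn (acoord v j) (acoord w j) = 2 ^ idx j /\ xorn (ycoord v j) (ycoord w j) = u (idx j).
  by move=> jQ; have := hvw (Ordinal jQ).
rewrite (@Phi_ext _ (fun j => xorn (acoord v j) (acoord w j)) _ (fun j => xorn (ycoord v j) (ycoord w j))).
- apply: ck; apply/allP => j; rewrite mem_iota => jQ; apply/seq.hasP; exists (idx j).
    by rewrite mem_iota add0n; exact: (idxP j jQ).
  by have [-> _] := hh j jQ.
- by move=> j jQ; have [-> _] := hh j jQ.
- by move=> j jQ; have [_ ->] := hh j jQ.
Qed.

End Sound.
End Gap.

(** * Powers of a relation and their cliques *)

Section Product.
Variables (D r : nat) (R : rel nat).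
Hypothesis D0 : 0 < D.

Definition prod_rel (v w : nat) : bool :=
  all (fun l => R (dig D v l) (dig D w l)) (iota 0 r).

Lemma prod_rel_sym : symmetric R -> symmetric prod_rel.
Proof. by move=> Rs v w; apply: eq_all => l; rewrite Rs. Qed.

Lemma prod_complete (C : {set 'I_D}) : {in C &, forall v w : 'I_D, R v w} ->
  exists2 C' : {set 'I_(D ^ r)}, #|C'| = #|C| ^ r & {in C' &, forall v w : 'I_(D ^ r), prod_rel v w}.
Proof.
move=> hC.
have ex (P : {ffun 'I_r -> 'I_D}) : {v : 'I_(D ^ r) | forall j : 'I_r, dig D v j = P j}.
  apply: cid.
  pose f j := if insub j is Some j' then nat_of_ord (P j') else 0.
  have [j jQ|v vD hv] := @dig_exists D r f.
    by rewrite /f insubT; apply: ltn_ord.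
  by exists (Ordinal vD) => j; rewrite /= hv // /f valK.
exists [set sval (ex P) | P in ffun_on (mem C)].
  rewrite card_in_imset ?card_ffun_on ?card_ord // => P P' _ _ e.
  by apply/ffunP => j; apply: val_inj; rewrite /= -(svalP (ex P)) e (svalP (ex P')).
move=> _ _ /imsetP[P PC ->] /imsetP[P' P'C ->].
apply/allP => l; rewrite mem_iota => lr.
have := svalP (ex P) (Ordinal lr); have := svalP (ex P') (Ordinal lr) => /= -> ->.
by apply: hC; apply/ffun_onP.
Qed.

(** A clique is contained in the product of its [r] projections, and each projection is a clique. *)
Lemma prod_sound (C' : {set 'I_(D ^ r)}) s : {in C' &, forall v w : 'I_(D ^ r), prod_rel v w} ->
  s ^ r < #|C'| -> exists2 C : {set 'I_D}, s < #|C| & {in C &, forall v w : 'I_D, R v w}.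
Proof.
move=> hC lt.
pose pr (l : 'I_r) (v : 'I_(D ^ r)) : 'I_D := Ordinal (dig_lt v l D0).
pose Cl (l : 'I_r) := [set pr l v | v in C'].
have [l ltl] : exists l, s < #|Cl l|.
  apply/existsP; rewrite -[[exists _, _]]negbK negb_exists; apply: contraTN lt => /forallP h.
  rewrite -leqNgt.
  pose f (v : 'I_(D ^ r)) : {ffun 'I_r -> 'I_D} := [ffun l => pr l v].
  have finj : injective f.
    move=> v w e; apply: val_inj; apply: (dig_inj (ltn_ord v) (ltn_ord w)) => j jr.
    by have /ffunP/(_ (Ordinal jr)) := e; rewrite !ffunE => /(congr1 val).
  rewrite -(card_imset _ finj).
  apply: leq_trans (_ : #|family (fun l => mem (Cl l))| <= _).
    apply: subset_leq_card; apply/fintype.subsetP => _ /imsetP[v vC ->].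
    by apply/familyP => l; rewrite ffunE; apply: imset_f.
  rewrite card_family -[X in s ^ X](card_ord r) cardE /image_mem.
  elim: (enum 'I_r) => //= l ls IH; rewrite expnS leq_mul //.
  by rewrite leqNgt; apply: h.
exists (Cl l) => // _ _ /imsetP[v vC ->] /imsetP[w wC ->].
have := hC v w vC wC; move=> /allP/(_ (l : nat)); rewrite mem_iota add0n /=.
by move=> /(_ (ltn_ord l)).
Qed.

End Product.

(** * Parsing circuits *)

Definition cnt0 (y : seq bool) (l : nat) : nat := \sum_(i < l) ~~ nth false y i.
(** Every number is a run of ones closed by a zero, so the ones of number [j] are those preceded by
    exactly [j] zeros. *)
Definition num (y : seq bool) (j : nat) : nat :=
  \sum_(l < size y) (nth false y l && (cnt0 y l == j)).

Lemma cnt0_cat_enc n y l : cnt0 (enc_nat n ++ y) (n.+1 + l) = (cnt0 y l).+1.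
Proof.
have sz : size (enc_nat n) = n.+1 by rewrite /enc_nat size_rcons size_nseq.
rewrite /cnt0 big_split_ord -[RHS]add1n; congr addn.
  rewrite big_ord_recr /= big1 ?add0n => [|i _].
    by rewrite nth_cat sz ltnSn /enc_nat nth_rcons size_nseq ltnn eqxx.
  by rewrite nth_cat sz ltnS ltnW ?ltn_ord // /enc_nat nth_rcons size_nseq ltn_ord nth_nseq ltn_ord.
by apply: eq_bigr => i _; rewrite nth_cat sz ltnNge leq_addr /= addKn.
Qed.

Lemma cnt0_enc_lt n y l : l <= n -> cnt0 (enc_nat n ++ y) l = 0.
Proof.
have sz : size (enc_nat n) = n.+1 by rewrite /enc_nat size_rcons size_nseq.
move=> le; rewrite /cnt0 big1 // => i _; have lt := leq_trans (ltn_ord i) le.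
by rewrite nth_cat sz ltnS ltnW // /enc_nat nth_rcons size_nseq lt nth_nseq lt.
Qed.

Lemma num_cat_enc n y j : num (enc_nat n ++ y) j = if j is j'.+1 then num y j' else n.
Proof.
have sz : size (enc_nat n) = n.+1 by rewrite /enc_nat size_rcons size_nseq.
have nthE i : nth false (enc_nat n ++ y) (n.+1 + i) = nth false y i.
  by rewrite nth_cat sz ltnNge leq_addr /= addKn.
rewrite /num size_cat sz big_split_ord /=.
have -> : \sum_(i < n.+1) (nth false (enc_nat n ++ y) i && (cnt0 (enc_nat n ++ y) i == j)) = if j is 0 then n else 0.
  rewrite big_ord_recr /= nth_cat sz ltnSn {2}/enc_nat nth_rcons size_nseq ltnn eqxx addn0.
  case: j => [|j].
    rewrite (eq_bigr (fun _ => 1)) ?sum1_card ?card_ord // => i _.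
    rewrite cnt0_enc_lt ?(ltnW (ltn_ord i)) // nth_cat sz ltnS ltnW ?ltn_ord //.
    by rewrite /enc_nat nth_rcons size_nseq ltn_ord nth_nseq ltn_ord.
  by rewrite big1 // => i _; rewrite cnt0_enc_lt ?andbF // ltnW // ltn_ord.
case: j => [|j].
  by rewrite big1 ?addn0 // => i _; rewrite cnt0_cat_enc andbF.
by rewrite add0n; apply: eq_bigr => i _; rewrite nthE cnt0_cat_enc eqSS.
Qed.

Lemma num_enc_nats ns j : num (enc_nats ns) j = nth 0 ns j.
Proof.
elim: ns j => [|n ns IH] j; first by rewrite /num big_ord0 nth_nil.
by rewrite /enc_nats /= num_cat_enc -/(enc_nats ns); case: j => [|j].
Qed.

Lemma cnt0_enc_nats ns : cnt0 (enc_nats ns) (size (enc_nats ns)) = size ns.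
Proof.
elim: ns => [|n ns IH]; first by rewrite /cnt0 big_ord0.
rewrite [enc_nats _]/= -/(enc_nats ns) size_cat.
have -> : size (enc_nat n) = n.+1 by rewrite /enc_nat size_rcons size_nseq.
by rewrite cnt0_cat_enc IH.
Qed.

Lemma enc_nats_last (y : seq bool) : last false y = false -> exists ns, y = enc_nats ns.
Proof.
have main z m : exists ns r, nseq m true ++ z = enc_nats ns ++ nseq r true.
  elim: z m => [|[] z IH] m.
  - by exists [::], m; rewrite cats0.
  - by have [ns [r e]] := IH m.+1; exists ns, r; rewrite -e -cat_rcons -cats1 -[[:: true]]/(nseq 1 true) -nseqD addn1.
  - have [ns [r e]] := IH 0; exists (m :: ns), r.
    by rewrite /enc_nats /= -/(enc_nats ns) -catA -e /enc_nat cat_rcons.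
have [ns [r e]] := main y 0; rewrite /= in e; rewrite e => h.
case: r e h => [|r] e; first by move=> _; exists ns; rewrite cats0.
have lr : last true (nseq r true) = true by elim: (r).
by rewrite last_cat -[nseq _ _]/(true :: nseq r true) [last _ _]/= lr.
Qed.

Lemma num_le y j : num y j <= size y.
Proof.
rewrite /num -[X in _ <= X](card_ord (size y)) -sum1_card; apply: leq_sum => i _.
by case: (_ && _).
Qed.

Section Decode.
Variable y : seq bool.
Notation nu := (num y).

(** Number 0 is the parameter; the codes of the gates start at number 4. *)
Definition inp := nu 1.
Definition outp := nu 2.
Definition ngate := nu 3.
Definition ntot := inp + ngate.
(** The place in the list of numbers where the code of gate [i] begins. A negation takes two
    numbers; another gate takes a tag, a length and its predecessors. *)
Definition gst (i : nat) : nat :=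
  iteri i (fun _ p => p + (if nu p == 0 then 2 else 2 + nu p.+1)) 4.
Definition pos (v : nat) := gst (v - inp).
Definition gtag (v : nat) := nu (pos v).
Definition fan (v : nat) := if gtag v == 0 then 1 else nu (pos v).+1.
Definition child (v j : nat) := nu (pos v + (if gtag v == 0 then 1 else 2) + j).
Definition children (v : nat) := [seq child v j | j <- iota 0 (fan v)].
Definition gate_of (v : nat) : gate :=
  if gtag v == 0 then Neg (child v 0)
  else if gtag v == 1 then And (children v) else Or (children v).
Definition circ : circuit := Circuit inp [seq gate_of (inp + i) | i <- iota 0 ngate] outp.

(** The last number is complete, the header is present, the code lengths add up and the tags are
    legal; this characterizes the encodings of circuits with a parameter. *)
Definition parse_ok : bool :=
  [&& ~~ nth false y (size y).-1, 3 < cnt0 y (size y), gst ngate == cnt0 y (size y)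
    & all (fun i => gtag (inp + i) <= 2) (iota 0 ngate)].

Lemma fanin_gate v : fanin (gate_of v) = children v.
Proof.
rewrite /gate_of /children /fan; case t0: (gtag v == 0); first by [].
by case: ifP.
Qed.

Lemma gst_bound i : gst i <= 4 + i * (size y + 2).
Proof.
elim: i => [|i IH]; first by rewrite mul0n addn0.
rewrite /gst /= -/(gst i); case: ifP => _; have := num_le y (gst i).+1; nia.
Qed.

Lemma code_gate_of v : gtag v <= 2 ->
  code_gate (gate_of v) = [seq nu p | p <- iota (pos v) (gst (v - inp).+1 - pos v)].
Proof.
move=> t2; have -> : gst (v - inp).+1 - pos v = if gtag v == 0 then 2 else 2 + nu (pos v).+1.
  by rewrite /gst /= -/(gst _) -/(pos v) addKn.
rewrite /gate_of /children /fan /child; case: ifP => [/eqP t0|t0].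
  by rewrite /= -/(gtag v) t0 addn0 addn1.
have e : [seq nu (pos v + 2 + j) | j <- iota 0 (nu (pos v).+1)] = [seq nu p | p <- iota (pos v).+2 (nu (pos v).+1)].
  by rewrite -[(pos v).+2]addn0 iotaDl -map_comp; apply: eq_map => j /=; rewrite addn2.
case: ifP => [/eqP t1|t1].
  by rewrite /= size_map size_iota -/(gtag v) t1 e.
have -> : gtag v = 2 by move: t0 t1 t2; case: (gtag v) => [|[|[]]].
by rewrite /= size_map size_iota e -/(gtag v); move: t0 t1 t2; case: (gtag v) => [|[|[]]].
Qed.

Lemma parse_okP : parse_ok -> y = enc_nat (nu 0) ++ enc_circuit circ.
Proof.
move=> /and4P[yl nz4 /eqP gstn /allP tags].
have [ns yE] : exists ns, y = enc_nats ns.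
  by apply: enc_nats_last; rewrite -nth_last; apply: negbTE.
have sns : size ns = cnt0 y (size y) by rewrite yE cnt0_enc_nats.
have nuE p : nu p = nth 0 ns p by rewrite yE num_enc_nats.
have fl i : i <= ngate -> flatten [seq code_gate (gate_of (inp + l)) | l <- iota 0 i] =
     [seq nu p | p <- iota 4 (gst i - 4)].
  elim: i => [|i IH] le //.
  rewrite -addn1 iotaD map_cat flatten_cat IH ?(ltnW le) //= cats0 code_gate_of; last first.
    by apply: tags; rewrite mem_iota.
  have g4 : 4 <= gst i by elim: (i) => // j hj; rewrite /gst /= -/(gst j); apply: leq_trans hj (leq_addr _ _).
  have gS : gst i <= gst i.+1 by rewrite {2}/gst /= -/(gst i) leq_addr.
  rewrite /pos addKn -map_cat -[X in iota X _ ++ _]/(4) addn1.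
  have e2 : gst i = 4 + (gst i - 4) by lia.
  rewrite [in X in _ ++ X]e2 -iotaD; congr map; congr iota.
  by rewrite -e2 add0n; lia.
have := fl ngate (leqnn _); rewrite gstn -sns => fln.
rewrite {1}yE /enc_circuit /= size_map size_iota -map_comp [flatten _]fln.
rewrite -[enc_nat (nu 0) ++ _]/(enc_nats (nu 0 :: [:: inp, outp, ngate & _])).
congr enc_nats; rewrite -sns in nz4.
rewrite /inp /outp /ngate -[RHS]/([seq nu p | p <- iota 0 (4 + (size ns - 4))]).
rewrite subnKC // (eq_map nuE).
by apply: (@eq_from_nth _ 0); rewrite ?size_map ?size_iota // => i il; rewrite (nth_map 0) ?size_iota // nth_iota.
Qed.

Lemma parse_enc k C : y = enc_nat k ++ enc_circuit C ->
  [/\ nu 0 = k, circ = C & parse_ok].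
Proof.
move=> yE; pose ns := [:: k, inputs C, output C, size (gates C) & flatten (map code_gate (gates C))].
have yE' : y = enc_nats ns by rewrite yE.
have nuE p : nu p = nth 0 ns p by rewrite yE' num_enc_nats.
have inpE : inp = inputs C by rewrite /inp nuE.
have ngE : ngate = size (gates C) by rewrite /ngate nuE.
have core i : i < size (gates C) ->
   gst i = 4 + size (flatten (map code_gate (take i (gates C)))) ->
   [/\ gate_of (inp + i) = nth (Neg 0) (gates C) i, gtag (inp + i) <= 2 &
     gst i.+1 = gst i + size (code_gate (nth (Neg 0) (gates C) i))].
  move=> lt gE; set g := nth (Neg 0) (gates C) i.
  have nuG l : l < size (code_gate g) -> nu (gst i + l) = nth 0 (code_gate g) l.
    move=> ll; rewrite nuE gE -addnA /ns /=.
    rewrite -[X in flatten (map _ X)](cat_take_drop i (gates C)) map_cat flatten_cat.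
    rewrite add0n nth_cat ltnNge leq_addr /= addKn (drop_nth (Neg 0) lt) /= nth_cat -/g.
    by rewrite ll.
  have posE : pos (inp + i) = gst i by rewrite /pos addKn.
  have nu0 := nuG 0; rewrite addn0 in nu0; have nu1 := nuG 1; rewrite addn1 in nu1.
  have nu2 l := nuG (2 + l).
  have nu1' := nuG 1.
  have gS : gst i.+1 = gst i + (if nu (gst i) == 0 then 2 else 2 + nu (gst i).+1) by [].
  rewrite gS /gate_of /children /fan /child /gtag posE.
  clearbody g; clear nuG lt gE yE yE' nuE.
  case: g nu0 nu1 nu2 nu1' => [u|us|us] /= nu0 nu1 nu2 nu1'.
  - by rewrite nu0 // addn0 nu1' // eqxx.
  - rewrite nu0 //= nu1 //; split => //; congr And.
    apply: (@eq_from_nth _ 0); rewrite size_map size_iota // => l ll.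
    rewrite (nth_map 0) ?size_iota // nth_iota // add0n -addnA nu2 //.
  - rewrite nu0 //= nu1 //; split => //; congr Or.
    apply: (@eq_from_nth _ 0); rewrite size_map size_iota // => l ll.
    rewrite (nth_map 0) ?size_iota // nth_iota // add0n -addnA nu2 //.
have gstE i : i <= size (gates C) -> gst i = 4 + size (flatten (map code_gate (take i (gates C)))).
  elim: i => [|i IH] le; first by rewrite take0.
  have [_ _ ->] := core i le (IH (ltnW le)).
  rewrite IH ?(ltnW le) // (take_nth (Neg 0) le) map_rcons -cats1 flatten_cat size_cat /= cats0.
  by rewrite addnA.
have gE i : i < size (gates C) -> gate_of (inp + i) = nth (Neg 0) (gates C) i.
  by move=> lt; have [] := core i lt (gstE i (ltnW lt)).
have tE i : i < size (gates C) -> gtag (inp + i) <= 2.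
  by move=> lt; have [] := core i lt (gstE i (ltnW lt)).
have c0 : cnt0 y (size y) = size ns by rewrite yE' cnt0_enc_nats.
split.
- by rewrite nuE.
- rewrite /circ inpE /outp nuE /= ngE -inpE.
  have -> : [seq gate_of (inp + i) | i <- iota 0 (size (gates C))] = gates C.
    apply: (@eq_from_nth _ (Neg 0)); rewrite size_map size_iota // => l ll.
    by rewrite (nth_map 0) ?size_iota // nth_iota // add0n gE.
  by rewrite inpE; case: (C).
- apply/and4P; split.
  + have e : last false y = false.
      rewrite yE' /ns /enc_nats; elim/last_ind: [:: k, _, _, _ & _] => // l n _.
      by rewrite map_rcons -cats1 flatten_cat /= cats0 last_cat /enc_nat last_rcons.
    by rewrite nth_last e.
  + by rewrite c0.
  + by rewrite c0 ngE gstE // take_size.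
  + by apply/allP => i; rewrite mem_iota ngE => /tE.
Qed.

End Decode.

(** * Partial information forcing the value of a circuit *)

(** A gate looks only at earlier nodes and later labels do not change earlier ones, so each rule may
    be applied to the final list. *)
Lemma labels_spec (T : Type) (x0 : T) (rule : seq T -> gate -> T) (base : seq T) (gs : seq gate) :
  (forall vs vs' g, (forall u, u \in fanin g -> nth x0 vs u = nth x0 vs' u) -> rule vs g = rule vs' g) ->
  (forall i, i < size gs -> all (fun u => u < size base + i) (fanin (nth (Neg 0) gs i))) ->
  let vs := foldl (fun vs g => rcons vs (rule vs g)) base gs in
  [/\ size vs = size base + size gs,
      forall v, v < size base -> nth x0 vs v = nth x0 base v &
      forall i, i < size gs -> nth x0 vs (size base + i) = rule vs (nth (Neg 0) gs i)].
Proof.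
move=> ext; elim/last_ind: gs => [|gs g IH] wf /=.
  by split; rewrite ?addn0.
have wf' i : i < size gs -> all (fun u => u < size base + i) (fanin (nth (Neg 0) gs i)).
  by move=> lt; have := wf i; rewrite size_rcons ltnW // nth_rcons lt; apply.
have [sz bs gsE] := IH wf'.
rewrite foldl_rcons; set vs := foldl _ _ _ in sz bs gsE *.
have same g' v : (forall u, u \in fanin g' -> u < size vs) -> rule (rcons vs v) g' = rule vs g'.
  by move=> h; apply: ext => u /h lt; rewrite nth_rcons lt.
split.
- by rewrite !size_rcons sz addnS.
- by move=> v lt; rewrite nth_rcons sz ltn_addr // bs.
- move=> i; rewrite size_rcons ltnS => le; rewrite [nth _ (rcons vs _) _]nth_rcons sz ltn_add2l eqn_add2l.
  have lei : forall u, u \in fanin (nth (Neg 0) (rcons gs g) i) -> u < size vs.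
    move=> u hu; rewrite sz; apply: leq_trans (_ : size base + i <= _); last by rewrite leq_add2l.
    by apply: (allP (wf i _)) hu; rewrite size_rcons ltnS.
  rewrite same // nth_rcons.
  by case: (ltngtP i (size gs)) le => // lt _; rewrite gsE.
Qed.

Section CircuitCheck.
Variable y : seq bool.
Notation n := (inp y).
Notation nt := (ntot y).
Notation gtag := (gtag y).
Notation fan := (fan y).
Notation child := (child y).

Definition wfb : bool :=
  (outp y < nt) &&
  all (fun i => let v := n + i in
    [&& all (fun j => child v j < v) (iota 0 (fan v)),
        all (fun j => all (fun j' => (j == j') || (child v j != child v j')) (iota 0 (fan v))) (iota 0 (fan v))
      & (gtag v == 0) || (1 < fan v)]) (iota 0 (ngate y)).

Lemma uniq_children v :
  all (fun j => all (fun j' => (j == j') || (child v j != child v j')) (iota 0 (fan v))) (iota 0 (fan v))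
  = uniq (children y v).
Proof.
apply/idP/idP => [/allP h|u].
  rewrite map_inj_in_uniq ?iota_uniq // => j j' jf j'f e.
  by have /allP/(_ _ j'f) := h j jf; rewrite e eqxx orbF => /eqP.
apply/allP => j jf; apply/allP => j' j'f; case: eqVneq => //= ne.
apply: contra ne => /eqP e.
have sz : size (children y v) = fan v by rewrite size_map size_iota.
move: jf j'f; rewrite !mem_iota /= => jf j'f.
rewrite -(nth_uniq 0 _ _ u) ?sz // !(nth_map 0) ?size_iota // !nth_iota // !add0n.
by apply/eqP.
Qed.

Lemma is_neg_gate v : is_neg (gate_of y v) = (gtag v == 0).
Proof. by rewrite /gate_of; case: ifP => // _; case: ifP. Qed.

Lemma wfbP : reflect (wf_circuit (circ y)) wfb.
Proof.
have gE i : i < ngate y -> nth (Neg 0) (gates (circ y)) i = gate_of y (n + i).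
  by move=> lt; rewrite (nth_map 0) ?size_iota // nth_iota.
have szg : size (gates (circ y)) = ngate y by rewrite size_map size_iota.
have allE i : all (fun u => u < n + i) (children y (n + i)) = all (fun j => child (n + i) j < n + i) (iota 0 (fan (n + i))).
  by rewrite all_map.
have szc v : size (children y v) = fan v by rewrite size_map size_iota.
apply: (iffP andP) => [[h1 /allP h2]|[h1 h2]]; split.
- by rewrite szg.
- move=> i; rewrite szg => lt; have := h2 i; rewrite mem_iota => /(_ lt) /and3P[c1 c2 c3].
  by rewrite /= gE // fanin_gate is_neg_gate allE c1 -uniq_children c2 szc c3.
- by move: h1; rewrite szg.
- apply/allP => i; rewrite mem_iota => lt; have := h2 i; rewrite szg => /(_ lt).
  by rewrite /= gE // fanin_gate is_neg_gate allE -uniq_children szc => -[-> -> ->].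
Qed.

(** A top-down form of the bounds on depth and weft: the recursion is on the constant [d], so that a
    program can unfold it. *)
Fixpoint dw (d w v : nat) : bool :=
  if v < n then true else
  if d is d'.+1 then
    ((2 < fan v) <= w) && all (fun j => dw d' (w - (2 < fan v)) (child v j)) (iota 0 (fan v))
  else false.

Section Kn.
Variables (F : nat -> bool) (known : nat -> bool -> bool).

(* [kn d v b]: the partial information [known] on the inputs forces the value
   [b] at node [v], when large gates only see their in-neighbours in [F]. *)
Fixpoint kn (d v : nat) (b : bool) : bool :=
  if v < n then known v b else
  if d is d'.+1 then
    if gtag v == 0 then kn d' (child v 0) (~~ b)
    else if b == (gtag v == 1) then
      all (fun j => ((2 < fan v) && ~~ F (child v j)) || kn d' (child v j) b) (iota 0 (fan v))
    else has (fun j => ~~ ((2 < fan v) && ~~ F (child v j)) && kn d' (child v j) b) (iota 0 (fan v))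
  else false.

End Kn.

Hypothesis wf : wfb.

Lemma gate_wf v : n <= v < nt ->
  [/\ forall j, j < fan v -> child v j < v, uniq (children y v) & (gtag v == 0) || (1 < fan v)].
Proof.
move=> /andP[nv vt]; have /andP[_ /allP/(_ (v - n))] := wf.
rewrite mem_iota /= ltn_subLR // => /(_ vt); rewrite subnKC // => /and3P[/allP c1 c2 c3].
split => //; last by rewrite -uniq_children.
by move=> j lt; apply: c1; rewrite mem_iota.
Qed.

Lemma child_lt v j : n <= v < nt -> j < fan v -> child v j < nt.
Proof. by move=> h jf; have [c _ _] := gate_wf h; apply: ltn_trans (c j jf) _; case/andP: h. Qed.

Lemma fan_gt0 v : n <= v < nt -> 0 < fan v.
Proof.
move=> h; have [_ _] := gate_wf h; rewrite /fan; case: ifP => //= _; exact: ltnW.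
Qed.

Section Labels.
Variables (T : Type) (x0 : T) (rule : seq T -> gate -> T) (base : seq T).
Hypothesis ext : forall vs vs' g, (forall u, u \in fanin g -> nth x0 vs u = nth x0 vs' u) -> rule vs g = rule vs' g.
Hypothesis szb : size base = n.
Let vs := foldl (fun vs g => rcons vs (rule vs g)) base (gates (circ y)).

Lemma labelsE : (forall v, v < n -> nth x0 vs v = nth x0 base v) /\
  (forall v, n <= v < nt -> nth x0 vs v = rule vs (gate_of y v)).
Proof.
have gE i : i < ngate y -> nth (Neg 0) (gates (circ y)) i = gate_of y (n + i).
  by move=> lt; rewrite (nth_map 0) ?size_iota // nth_iota.
have szg : size (gates (circ y)) = ngate y by rewrite size_map size_iota.
have [|_ h1 h2] := @labels_spec T x0 rule base (gates (circ y)) ext.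
  move=> i; rewrite szg szb => lt; rewrite gE // fanin_gate.
  have /andP[_ /allP/(_ i)] := wf; rewrite mem_iota => /(_ lt) /and3P[c1 _ _].
  by rewrite all_map.
rewrite szb szg in h1 h2; split => // v /andP[nv vt].
have lt : v - n < ngate y by rewrite ltn_subLR.
by have := h2 _ lt; rewrite subnKC // gE // subnKC.
Qed.
End Labels.

Definition dep (v : nat) := nth 0 (foldl (fun vs g => rcons vs (\max_(u <- fanin g) nth 0 vs u).+1)
  (nseq n 0) (gates (circ y))) v.
Definition wft (v : nat) := nth 0 (foldl (fun vs g => rcons vs ((\max_(u <- fanin g) nth 0 vs u) + (2 < size (fanin g))))
  (nseq n 0) (gates (circ y))) v.

Lemma dwE d w v : v < nt -> dw d w v = (dep v <= d) && (wft v <= w).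
Proof.
have ed : forall (vs vs' : seq nat) g, (forall u, u \in fanin g -> nth 0 vs u = nth 0 vs' u) ->
   (\max_(u <- fanin g) nth 0 vs u) = (\max_(u <- fanin g) nth 0 vs' u).
  by move=> vs vs' g h; apply: eq_big_seq.
have [d1 d2] := @labelsE nat 0 (fun vs g => (\max_(u <- fanin g) nth 0 vs u).+1) (nseq n 0)
  (fun vs vs' g h => congr1 S (ed vs vs' g h)) (size_nseq _ _).
have [w1 w2] := @labelsE nat 0 (fun vs g => (\max_(u <- fanin g) nth 0 vs u) + (2 < size (fanin g))) (nseq n 0)
  (fun vs vs' g h => congr1 (addn^~ _) (ed vs vs' g h)) (size_nseq _ _).
elim: d w v => [|d IH] w v vt /=; case: ltnP => nv.
- by rewrite /dep /wft d1 // w1 // nth_nseq nv.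
- by rewrite /dep d2 ?nv.
- by rewrite /dep /wft d1 // w1 // nth_nseq nv.
have h : n <= v < nt by rewrite nv.
have szc : size (children y v) = fan v by rewrite size_map size_iota.
rewrite [in RHS]/dep d2 // [in RHS]/wft w2 // fanin_gate szc ltnS.
apply/andP/andP => [[fw /allP ch]|[/bigmax_leqP_seq dd ww]].
  have hc u : u \in children y v -> (dep u <= d) /\ (wft u <= w - (2 < fan v)).
    move=> /mapP[j]; rewrite mem_iota => jf ->.
    by have := ch j; rewrite mem_iota IH ?child_lt // => /(_ jf) /andP[].
  split; first by apply/bigmax_leqP_seq => u /hc[].
  by rewrite -[X in _ <= X](subnK fw) leq_add2r; apply/bigmax_leqP_seq => u /hc[].
split; first by apply: leq_trans ww; rewrite leq_addl.
apply/allP => j; rewrite mem_iota => jf; rewrite IH ?child_lt //.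
have uc : child v j \in children y v by apply: map_f; rewrite mem_iota.
rewrite [dep _ <= d](dd _ uc) //= leq_subRL; last by apply: leq_trans ww; rewrite leq_addl.
apply: leq_trans ww; rewrite addnC leq_add2r.
by rewrite /wft; apply: leq_bigmax_seq.
Qed.

Lemma dw_depth_weft d : outp y < nt -> dw d 1 (outp y) = (depth (circ y) <= d) && (weft (circ y) <= 1).
Proof. by move=> lt; rewrite dwE. Qed.

Section Values.
Variable a : seq bool.
Hypothesis sza : size a = n.

Definition value (v : nat) := nth false (foldl (fun vs g => rcons vs (gate_value vs g)) a (gates (circ y))) v.
Definition T (x : nat) := nth false a x.
Definition KT (x : nat) (b : bool) := T x == b.

Lemma valueE : (forall v, v < n -> value v = T v) /\
  (forall v, n <= v < nt -> value v = if gtag v == 0 then ~~ value (child v 0)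
     else if gtag v == 1 then all (fun j => value (child v j)) (iota 0 (fan v))
     else has (fun j => value (child v j)) (iota 0 (fan v))).
Proof.
have ext : forall vs vs' g, (forall u, u \in fanin g -> nth false vs u = nth false vs' u) -> gate_value vs g = gate_value vs' g.
  move=> vs vs' [u|us|us] /= h.
  - by rewrite h ?inE.
  - exact: eq_in_all.
  - exact: eq_in_has.
have [v1 v2] := labelsE ext sza.
split => // v h; rewrite /value v2 // /gate_of; case: ifP => //= _.
by case: ifP => //= _; rewrite /children ?all_map ?has_map.
Qed.

(** When all inputs are known, the evaluation stays two-valued, since a hidden child of a large gate
    counts as the neutral value of that gate. *)
Lemma kn_dual F d w v b : v < nt -> dw d w v -> kn F KT d v (~~ b) = ~~ kn F KT d v b.
Proof.
elim: d w v b => [|d IH] w v b vt /=; case: ltnP => // nv.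
- by move=> _; rewrite /KT; case: (T v); case: b.
- by move=> _; rewrite /KT; case: (T v); case: b.
move=> /andP[_ /allP ch]; have h : n <= v < nt by rewrite nv.
have IHc j b' : j < fan v -> kn F KT d (child v j) (~~ b') = ~~ kn F KT d (child v j) b'.
  by move=> jf; apply: (IH (w - (2 < fan v))); rewrite ?child_lt // ch // mem_iota.
case: ifP => [t0|_]; first by rewrite IHc ?fan_gt0.
have -> : (~~ b == (gtag v == 1)) = ~~ (b == (gtag v == 1)) by case: b; case: (gtag v == 1).
case: (b == _) => /=.
  rewrite -has_predC; apply: eq_in_has => j; rewrite mem_iota => jf /=.
  by rewrite negb_or IHc.
rewrite -all_predC; apply: eq_in_all => j; rewrite mem_iota => jf /=.
by rewrite negb_and negbK IHc.
Qed.

Lemma kn_value0 F d v b : v < nt -> dw d 0 v -> kn F KT d v b = (value v == b).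
Proof.
have [v1 v2] := valueE.
elim: d v b => [|d IH] v b vt /=; first by case: ltnP => // nv _; rewrite v1.
case: ltnP => nv; first by rewrite v1.
rewrite leqn0 => /andP[/eqP f0 /allP ch]; have h : n <= v < nt by rewrite nv.
rewrite f0 in ch *; rewrite v2 //=.
have IHc j b' : j < fan v -> kn F KT d (child v j) b' = (value (child v j) == b').
  by move=> jf; apply: IH; rewrite ?child_lt // ch // mem_iota.
have nf : (2 < fan v) = false by case: (2 < fan v) f0.
case: ifP => [t0|_]; first by rewrite IHc ?fan_gt0 //; case: (value _); case: b.
rewrite nf /=; case t1: (gtag v == 1); case: b => /=.
- by rewrite eqb_id; apply: eq_in_all => j; rewrite mem_iota => jf; rewrite IHc ?eqb_id.
- by rewrite eqbF_neg -has_predC; apply: eq_in_has => j; rewrite mem_iota => jf /=; rewrite IHc ?eqbF_neg.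
- by rewrite eqb_id; apply: eq_in_has => j; rewrite mem_iota => jf; rewrite IHc ?eqb_id.
- by rewrite eqbF_neg -all_predC; apply: eq_in_all => j; rewrite mem_iota => jf /=; rewrite IHc ?eqbF_neg.
Qed.

Lemma choose_lists (P : nat -> seq nat -> Prop) (js : seq nat) m :
  (forall j, j \in js -> exists L, P j L /\ size L <= m) ->
  exists L_ : nat -> seq nat, (forall j, j \in js -> P j (L_ j)) /\ size (flatten (map L_ js)) <= size js * m.
Proof.
move=> h; have /choice[L_ hL] : forall j, exists L, j \in js -> P j L /\ size L <= m.
  by move=> j; case: (boolP (j \in js)) => [/h[L hL]|_]; [exists L|exists [::]].
exists L_; split; first by move=> j /hL[].
elim: js hL {h} => [|j js IH] hL //=; rewrite size_cat mulSn leq_add //.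
  by apply: (hL j _).2; rewrite inE eqxx.
by apply: IH => i ij; apply: hL; rewrite inE ij orbT.
Qed.

(** Below a large gate on a path of weft 1 nothing is hidden, and its value is certified by one
    child that decides it, or by no child if all are neutral. Small gates have at most two children,
    hence [2 ^ d]. Enlarging [F] is harmless because it only uncovers children with their true
    values. *)
Lemma kn_witness d v : v < nt -> dw d 1 v -> exists J : seq nat,
  [/\ size J <= 2 ^ d, all (fun x => x < nt) J &
      forall (F : nat -> bool) b, (forall x, x \in J -> F x) -> kn F KT d v b = (value v == b)].
Proof.
have [v1 v2] := valueE.
elim: d v => [|d IH] v vt; case: (ltnP v n) => nv.
- by move=> _; exists [::]; split => // F b _; rewrite /= nv v1.
- by rewrite /= ltnNge nv.
- by move=> _; exists [::]; split => // F b _; rewrite /= nv v1.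
have h : n <= v < nt by rewrite nv.
move=> dwv.
have /andP[_ /allP ch] : ((2 < fan v) <= 1) && all (fun j => dw d (1 - (2 < fan v)) (child v j)) (iota 0 (fan v)).
  by move: dwv; rewrite /= ltnNge nv.
have dual F b : kn F KT d.+1 v (~~ b) = ~~ kn F KT d.+1 v b by apply: kn_dual dwv.
suff [J [J1 J2 J3]] : exists J : seq nat, [/\ size J <= 2 ^ d.+1, all (fun x => x < nt) J &
   forall F : nat -> bool, (forall x, x \in J -> F x) -> kn F KT d.+1 v true = value v].
  exists J; split => // F [] hF; first by rewrite J3 // eqb_id.
  by rewrite -[false]/(~~ true) (dual F true) J3 //; case: (value v).
have [big|small] := ltnP 2 (fan v).
  rewrite big subnn in ch.
  have IHc F j b' : j < fan v -> kn F KT d (child v j) b' = (value (child v j) == b').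
    by move=> jf; apply: kn_value0; rewrite ?child_lt // ch // mem_iota.
  have t0 : (gtag v == 0) = false by move: big; rewrite /fan; case: ifP.
  pose b := gtag v == 1.
  case ex: (has (fun j => value (child v j) == ~~ b) (iota 0 (fan v))).
    have /seq.hasP[j] := ex; rewrite mem_iota add0n /= => jf jb.
    exists [:: child v j]; split; first by rewrite /= expn_gt0.
      by rewrite /= child_lt.
    move=> F hF; have Fj : F (child v j) by apply: hF; rewrite inE.
    rewrite /= ltnNge nv /= t0 v2 // t0 -/b [true == b]eq_sym eqb_id; move: jb; case: (b) => /= jb.
      transitivity false; [|apply/esym]; apply/negbTE/seq.allPn; exists j; rewrite ?mem_iota // ?IHc // ?Fj ?(eqP jb) //.
      by rewrite big.
    transitivity true; [|apply/esym]; apply/seq.hasP; exists j; rewrite ?mem_iota // ?IHc // ?Fj ?(eqP jb) //.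
    by rewrite big.
  exists [::]; split => // F _.
  have all_b j : j < fan v -> value (child v j) = b.
    move=> jf; have /negbT := ex; rewrite -all_predC => /allP/(_ j); rewrite mem_iota => /(_ jf) /=.
    by case: (value _); case: (b).
  rewrite /= ltnNge nv /= t0 v2 // t0 -/b [true == b]eq_sym eqb_id; case eb: (b) => /=.
    transitivity true; [|apply/esym]; apply/allP => j; rewrite mem_iota => jf; rewrite ?IHc // all_b // eb //.
    by rewrite orbT.
  transitivity false; [|apply/esym]; apply/negbTE/seq.hasPn => j; rewrite mem_iota => jf; rewrite ?IHc // all_b // eb //.
  by rewrite andbF.
have nf : (2 < fan v) = false by rewrite ltnNge small.
rewrite nf subn0 in ch.
have [|J_ [hJ szJ]] := @choose_lists (fun j J => all (fun x => x < nt) J /\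
   forall (F : nat -> bool) b, (forall x, x \in J -> F x) -> kn F KT d (child v j) b = (value (child v j) == b))
   (iota 0 (fan v)) (2 ^ d).
  move=> j jm; have jf : j < fan v by move: jm; rewrite mem_iota.
  by have [J [J1 J2 J3]] := IH _ (child_lt h jf) (ch j jm); exists J.
exists (flatten (map J_ (iota 0 (fan v)))); split.
- by apply: leq_trans szJ _; rewrite size_iota expnS leq_mul2r small orbT.
- by apply/allP => x /flattenP[l /mapP[j jf ->]]; have [/allP h1 _] := hJ j jf; apply: h1.
move=> F hF.
have hc j b : j < fan v -> kn F KT d (child v j) b = (value (child v j) == b).
  move=> jf; have jm : j \in iota 0 (fan v) by rewrite mem_iota.
  have [_ h1] := hJ j jm; apply: h1 => x xJ; apply: hF; apply/flattenP.
  by exists (J_ j) => //; apply: map_f.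
rewrite /= ltnNge nv /= v2 // nf /=.
case: ifP => [t0|_]; first by rewrite hc ?fan_gt0 //; case: (value _).
rewrite [true == _]eq_sym eqb_id; case: ifP => _.
  by apply: eq_in_all => j; rewrite mem_iota => jf; rewrite hc ?eqb_id.
by apply: eq_in_has => j; rewrite mem_iota => jf; rewrite hc ?eqb_id.
Qed.

Lemma kn_mono F (known known' : nat -> bool -> bool) d v b : (forall x b', x < n -> known x b' -> known' x b') ->
  kn F known d v b -> kn F known' d v b.
Proof.
move=> hk; elim: d v b => [|d IH] v b /=; case: ltnP => // nv; try exact: hk.
case: ifP => _; first exact: IH.
case: ifP => _.
  by apply: sub_all => j /orP[->//|/IH ->]; rewrite orbT.
by apply: sub_has => j /andP[-> /IH ->].
Qed.

(** A large gate depends only on its children in [F], a small one on at most two, so the evaluation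
    tree branches at most [m] times. The children of a gate are distinct, which turns the size of
    [Fs] into a bound on their number. *)
Lemma kn_local (F : nat -> bool) (Fs : seq nat) m d w v b : (forall x, F x -> x \in Fs) ->
  size Fs <= m -> 1 < m -> v < nt -> dw d w v -> kn F KT d v b ->
  exists L : seq nat, [/\ size L <= m ^ d, all (fun x => x < n) L &
    forall known : nat -> bool -> bool, (forall x, x \in L -> known x (T x)) -> kn F known d v b].
Proof.
move=> FFs szF m1; elim: d w v b => [|d IH] w v b vt /=; case: ltnP => // nv.
- by move=> _ /eqP <-; exists [:: v]; split; rewrite /= ?nv // => known; apply; rewrite inE.
- move=> _ /eqP <-; exists [:: v]; split; rewrite /= ?nv ?expn_gt0 ?(ltnW m1) // => known.
  by apply; rewrite inE.
have h : n <= v < nt by rewrite nv.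
move=> /andP[_ /allP ch].
have IHc j b' : j < fan v -> kn F KT d (child v j) b' ->
  exists L, (all (fun x => x < n) L /\ forall known : nat -> bool -> bool, (forall x, x \in L -> known x (T x)) -> kn F known d (child v j) b') /\ size L <= m ^ d.
  move=> jf kj; have jm : j \in iota 0 (fan v) by rewrite mem_iota.
  by have [L [h1 h2 h3]] := IH _ _ b' (child_lt h jf) (ch j jm) kj; exists L.
have mS : m ^ d <= m ^ d.+1 by rewrite leq_exp2l.
case: ifP => [t0|_].
  move=> kj; have [|L [[h1 h2] h3]] := IHc 0 (~~ b) _ kj; first by rewrite fan_gt0.
  by exists L; split => //; apply: leq_trans mS.
case: ifP => _; last first.
  move=> /seq.hasP[j jf /andP[fj kj]].
  have [|L [[h1 h2] h3]] := IHc j b _ kj; first by move: jf; rewrite mem_iota.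
  exists L; split => //; first exact: leq_trans mS.
  by move=> known hk; apply/seq.hasP; exists j => //; rewrite fj h2.
move=> /allP ka.
pose js := [seq j <- iota 0 (fan v) | ~~ ((2 < fan v) && ~~ F (child v j))].
have szjs : size js <= m.
  have [_ uc _] := gate_wf h.
  case: (ltnP 2 (fan v)) => f2; last first.
    apply: leq_trans m1; apply: leq_trans f2.
    by rewrite size_filter -[X in _ <= X](size_iota 0) count_size.
  apply: leq_trans szF; rewrite -(size_map (child v) js).
  apply: uniq_leq_size.
    by apply: subseq_uniq uc; apply: map_subseq; apply: filter_subseq.
  by move=> x /mapP[j]; rewrite mem_filter f2 /= negbK => /andP[Fj _] ->; apply: FFs.
have [|L_ [hL szL]] := @choose_lists (fun j L => all (fun x => x < n) L /\ forall known : nat -> bool -> bool,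
   (forall x, x \in L -> known x (T x)) -> kn F known d (child v j) b) js (m ^ d).
  move=> j; rewrite mem_filter => /andP[nf jf]; apply: IHc; first by move: jf; rewrite mem_iota.
  by have := ka j jf; rewrite (negbTE nf).
exists (flatten (map L_ js)); split.
- by apply: leq_trans szL _; rewrite expnS leq_mul2r szjs orbT.
- by apply/allP => x /flattenP[l /mapP[j jf ->]]; have [/allP h1 _] := hL j jf; apply: h1.
move=> known hk; apply/allP => j jf.
case nf: ((2 < fan v) && ~~ F (child v j)) => //=.
have jjs : j \in js by rewrite mem_filter nf.
have [_ h1] := hL j jjs; apply: h1 => x xL; apply: hk; apply/flattenP.
by exists (L_ j) => //; apply: map_f.
Qed.

End Values.
End CircuitCheck.

(** * Weighted circuit satisfiability as a system of constraints *)

Section CSP.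
Variables (d : nat) (y : seq bool).
Notation n := (inp y).
Notation nt := (ntot y).
Notation k := (num y 0).

Definition wit_size := 2 ^ d.
(** The bound of [kn_local] when the visible nodes come from two lists of length [wit_size]. *)
Definition num_pos := (2 * wit_size) ^ d.
(** The arity is [2 * num_pos + 1]: two positions for each input that matters and one place for the
    witness list. The shape [arity0.+2] provides the two points of the linearity test. *)
Definition arity0 := (2 * num_pos).-1.
Definition arity := arity0.+2.

(* The unknowns are indexed by 0 .. k+2: unknown i <= k+1 is the position,
   shifted by one, of the i-th true input, with sentinels 0 and n+1 at both
   ends; unknown k+2 codes a list of nodes in base [ntot]. *)
Definition in_code (J x : nat) : bool := has (fun l => dig nt J l == x) (iota 0 wit_size).

(** The number [c j] is the unit vector of the [j]-th queried unknown. A true input is one of the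
    positions; a false input lies strictly between two consecutive ones. *)
Definition revealed (c u : nat -> nat) (x : nat) (b : bool) : bool :=
  if b then has (fun j => (c j < 2 ^ k.+2) && (u j == x.+1)) (iota 0 arity)
  else has (fun j => has (fun j' =>
    [&& c j' == c j * 2, c j' < 2 ^ k.+2, u j < x.+1 & x.+1 < u j']) (iota 0 arity)) (iota 0 arity).

Definition ordered (c u : nat -> nat) : bool :=
  all (fun j => [&& (c j == 1) ==> (u j == 0), (c j == 2 ^ k.+1) ==> (u j == n.+1) &
    all (fun j' => (c j' == c j * 2) && (c j' < 2 ^ k.+2) ==> (u j < u j')) (iota 0 arity)]) (iota 0 arity).

(** Two lists are needed. The arbitrary list [J0] gives soundness: it can be a certificate of the
    value false. The coded list [u j] gives completeness: if it certifies the value true, no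
    additional list can overturn it. *)
Definition unrefuted (c u : nat -> nat) : bool :=
  all (fun j => (c j == 2 ^ k.+2) ==>
    all (fun J0 => ~~ kn y (fun x => in_code (u j) x || in_code J0 x) (revealed c u) d (outp y) false)
      (iota 0 (nt ^ wit_size))) (iota 0 arity).

Definition Phi (c u : nat -> nat) : bool := ordered c u && unrefuted c u.

Definition valid : bool := [&& parse_ok y, wfb y & dw y d 1 (outp y)].
End CSP.

Section CSPProofs.
Variables (d : nat) (y : seq bool).
Notation n := (inp y).
Notation nt := (ntot y).
Notation k := (num y 0).
Notation s := (wit_size d).
Notation Q := (arity d).

Lemma arityE : Q = 2 * num_pos d + 1.
Proof.
have : 0 < num_pos d by rewrite /num_pos /wit_size expn_gt0 muln_gt0 expn_gt0.
by rewrite /arity /arity0; lia.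
Qed.

Lemma Phi_ext c c' u u' : (forall j, j < Q -> c j = c' j) -> (forall j, j < Q -> u j = u' j) ->
  Phi d y c u = Phi d y c' u'.
Proof.
move=> hc hu.
have mQ j : j \in iota 0 Q -> (c j = c' j) * (u j = u' j) by rewrite mem_iota => jQ; rewrite hc // hu.
have eR : revealed d y c u = revealed d y c' u'.
  apply/funext => x; apply/funext => b; rewrite /revealed; case: b.
    by apply: eq_in_has => j /mQ[-> ->].
  by apply: eq_in_has => j /mQ[-> ->]; apply: eq_in_has => j' /mQ[-> ->].
rewrite /Phi /ordered /unrefuted eR; congr (_ && _).
  apply: eq_in_all => j /mQ[-> ->]; congr [&& _, _ & _].
  by apply: eq_in_all => j' /mQ[-> ->].
by apply: eq_in_all => j /mQ[-> ->].
Qed.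

Lemma code_exists (J : seq nat) : size J <= s -> all (fun x => x < nt) J -> 0 < nt ->
  exists2 Jc, Jc < nt ^ s & forall x, x \in J -> in_code d y Jc x.
Proof.
move=> szJ /allP aJ nt0.
have [l ls|Jc JcD hJ] := @dig_exists nt s (nth 0 J).
  case: (ltnP l (size J)) => lJ; first by apply: aJ; apply: mem_nth.
  by rewrite nth_default.
exists Jc => // x xJ; apply/seq.hasP; exists (index x J).
  by rewrite mem_iota /=; apply: leq_trans szJ; rewrite index_mem.
by rewrite hJ ?nth_index //; apply: leq_trans szJ; rewrite index_mem.
Qed.

Hypothesis val : valid d y.
Let wf : wfb y. Proof. by case/and3P: val. Qed.
Let dwo : dw y d 1 (outp y). Proof. by case/and3P: val. Qed.
Let out_lt : outp y < nt. Proof. by case/andP: wf. Qed.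
Let nt0 : 0 < nt. Proof. exact: leq_ltn_trans out_lt. Qed.

Lemma pow2_inj i j : 2 ^ i = 2 ^ j -> i = j.
Proof. by move/eqP; rewrite eqn_exp2l // => /eqP. Qed.

Lemma pow2_succ i j : 2 ^ j = 2 ^ i * 2 -> j = i.+1.
Proof. by rewrite mulnC -expnS; apply: pow2_inj. Qed.

Lemma csp_complete (a : seq bool) H : size a = n -> count id a = k -> value y a (outp y) ->
  n.+2 <= H -> nt ^ s <= H ->
  exists2 u : nat -> nat, (forall i, i < k + 3 -> u i < H) &
    forall idx : nat -> nat, (forall j, j < Q -> idx j < k + 3) ->
      Phi d y (fun j => 2 ^ idx j) (fun j => u (idx j)).
Proof.
move=> sza cnt vt nH ntH.
have [J [J1 J2 J3]] := kn_witness wf sza out_lt dwo.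
have [Jc JcD hJc] := code_exists J1 J2 nt0.
pose zs := [seq x.+1 | x <- iota 0 n & nth false a x].
have szs : size zs = k.
  rewrite size_map size_filter -cnt -[in RHS](mkseq_nth false a) /mkseq count_map sza.
  by apply: eq_count => x.
(* The sentinels ensure that every false input lies between two neighbouring positions. *)
pose zz := 0 :: rcons zs n.+1.
have szz : size zz = k.+2 by rewrite /= size_rcons szs.
have szs_lt x : x \in zs -> 0 < x < n.+1.
  by move=> /mapP[x']; rewrite mem_filter mem_iota => /andP[_ /andP[_ h]] ->.
have memzs x : x < n -> (x.+1 \in zs) = nth false a x.
  by move=> xn; rewrite mem_map ?mem_filter ?mem_iota /= ?xn ?andbT // => p q [].
have sortzz : sorted ltn zz.
  rewrite /zz /= path_sortedE; last exact: ltn_trans.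
  rewrite all_rcons /=; apply/andP; split; first by apply/allP => x /szs_lt /andP[].
  have -> : sorted ltn (rcons zs n.+1) = sorted ltn zs && all (fun x => x < n.+1) zs.
    case: (zs) => //= z l; rewrite rcons_path.
    elim: l z => [|z' l IH] z /=; first by rewrite andbT.
    by rewrite -!andbA; case zz': (z < z') => //=; rewrite IH; case: path => //=; case: (ltnP z' n.+1) => h; rewrite ?andbF //= (ltn_trans zz' h).
  apply/andP; split; last by apply/allP => x /szs_lt /andP[].
  rewrite sorted_map; apply: sorted_filter; first by move=> x y' z; rewrite /= !ltnS; apply: ltn_trans.
  by have := iota_ltn_sorted 0 n.
have zmono i j : i <= j -> j < k.+2 -> nth 0 zz i <= nth 0 zz j.
  move=> ij jk; case: (ltngtP i j) ij => // [lt _|-> //].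
  apply: ltnW; apply: (sorted_ltn_nth ltn_trans 0 sortzz); rewrite ?inE ?szz //.
  exact: ltn_trans jk.
pose u i := if i < k.+2 then nth 0 zz i else Jc.
have zn i : i < k.+2 -> nth 0 zz i <= n.+1.
  move=> ik; have -> : n.+1 = nth 0 zz k.+1 by rewrite /= nth_rcons szs ltnn eqxx.
  by apply: zmono.
exists u => [i _|idx idxP].
  rewrite /u; case: (ltnP i k.+2) => ik; last exact: leq_trans JcD ntH.
  by apply: leq_ltn_trans (zn i ik) _.
have lt2 i : (2 ^ i < 2 ^ k.+2) = (i < k.+2) by rewrite ltn_exp2l.
apply/andP; split; apply/allP => j jQ.
  apply/and3P; split.
  - by apply/implyP => /eqP; rewrite -[1](expn0 2) => /pow2_inj ->; rewrite /u.
  - by apply/implyP => /eqP /pow2_inj ->; rewrite /u ltnSn /= nth_rcons szs ltnn eqxx.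
  - apply/allP => j' _; apply/implyP => /andP[/eqP/pow2_succ e]; rewrite lt2 => lt.
    rewrite /u lt; rewrite e in lt *; rewrite (ltnW lt).
    by have /sortedP := sortzz; apply; rewrite szz.
apply/implyP => /eqP/pow2_inj ej; apply/allP => J0 _.
apply/negP => /(kn_mono (known' := KT a)) kF.
have := kF _; rewrite J3 => [h|x xJ]; last first.
  by rewrite /u ej ltnn hJc.
suff hk : forall x b', x < n -> revealed d y (fun j => 2 ^ idx j) (fun j => u (idx j)) x b' -> KT a x b'.
  by have := h hk; rewrite vt.
move=> x [] xn; rewrite /revealed.
  move=> /seq.hasP[i _ /andP[]]; rewrite lt2 /u => ik; rewrite ik => /eqP e.
  rewrite /KT /T eqb_id -memzs // -e.
  have : nth 0 zz (idx i) \in zz by apply: mem_nth; rewrite szz.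
  by rewrite inE mem_rcons inE e eqSS (ltn_eqF xn).
move=> /seq.hasP[i _ /seq.hasP[i' _ /and4P[/eqP/pow2_succ e]]].
rewrite lt2 /u => i'k; rewrite i'k; rewrite e in i'k *; rewrite (ltnW i'k) => l1 l2.
rewrite /KT /T eqbF_neg -memzs //; apply/negP => xz.
have xzz : x.+1 \in zz by rewrite inE mem_rcons inE xz !orbT.
have := nth_index 0 xzz; have := xzz; rewrite -index_mem szz; set l := index _ _ => lk el.
case: (leqP l (idx i)) => li.
  by have := zmono l (idx i) li (ltnW i'k); rewrite el leqNgt l1.
by have := zmono (idx i).+1 l li lk; rewrite el leqNgt l2.
Qed.

(** The positions define one assignment. If it made the output false, a certificate of that value,
    used as [J0], would give a refutation depending on few inputs by [kn_local], and one tuple of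
    indices reveals all of these inputs. *)
Lemma csp_sound (u : nat -> nat) :
  (forall idx : nat -> nat, (forall j, j < Q -> idx j < k + 3) ->
      Phi d y (fun j => 2 ^ idx j) (fun j => u (idx j))) ->
  exists2 a : seq bool, size a = n & count id a = k /\ value y a (outp y).
Proof.
move=> hPhi.
have Q1 : 1 < Q by [].
have mQ j : (j \in iota 0 Q) = (j < Q) by rewrite mem_iota.
have lt2 i : (2 ^ i < 2 ^ k.+2) = (i < k.+2) by rewrite ltn_exp2l.
have z0 : u 0 = 0.
  have /andP[/allP/(_ 0) + _] := hPhi (fun _ => 0) (fun _ _ => ltn_addl _ (isT : 0 < 3)).
  by rewrite mQ => /(_ isT) /and3P[/implyP h _ _]; apply/eqP; apply: h.
have zk : u k.+1 = n.+1.
  have hk : k.+1 < k + 3 by lia.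
  have /andP[/allP/(_ 0) + _] := hPhi (fun _ => k.+1) (fun _ _ => hk).
  by rewrite mQ => /(_ isT) /and3P[_ /implyP h _]; apply/eqP; apply: h.
have zlt i : i <= k -> u i < u i.+1.
  move=> ik; pose idx j := if j == 0 then i else i.+1.
  have hi j : j < Q -> idx j < k + 3 by move=> _; rewrite /idx; case: ifP => _; lia.
  have /andP[/allP/(_ 0) + _] := hPhi idx hi.
  rewrite mQ => /(_ isT) /and3P[_ _ /allP/(_ 1)]; rewrite mQ => /(_ Q1).
  by rewrite /idx /= expnS mulnC eqxx /= mulnC -expnS lt2 !ltnS ik.
have zmono i j : i < j -> j <= k.+1 -> u i < u j.
  elim: j => // j IH; rewrite ltnS leq_eqVlt => /orP[/eqP -> jk|lt jk]; first exact: zlt.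
  exact: ltn_trans (IH lt (ltnW jk)) (zlt j jk).
pose a := mkseq (fun x => has (fun i => u i.+1 == x.+1) (iota 0 k)) n.
have sza : size a = n by rewrite size_mkseq.
have aE x : x < n -> nth false a x = has (fun i => u i.+1 == x.+1) (iota 0 k) by move=> xn; rewrite nth_mkseq.
exists a => //.
have cnt : count id a = k.
  pose zs := [seq u i.+1 | i <- iota 0 k].
  pose xs := [seq x <- iota 0 n | x.+1 \in zs].
  have -> : count id a = size xs.
    rewrite /a /mkseq count_map size_filter; apply: eq_count => x /=.
    apply/seq.hasP/mapP => [[i ik /eqP e]|[i ik e]]; exists i => //; by rewrite -e.
  rewrite -(size_map S); transitivity (size zs); last by rewrite size_map size_iota.
  apply: perm_size; apply: uniq_perm.
  - by rewrite map_inj_uniq ?filter_uniq ?iota_uniq // => p q [].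
  - rewrite map_inj_in_uniq ?iota_uniq // => i j; rewrite !mem_iota /= !add0n => ik jk e.
    case: (ltngtP i j) => // lt.
    + by have := zmono i.+1 j.+1 lt (ltnW jk); rewrite e ltnn.
    + by have := zmono j.+1 i.+1 lt (ltnW ik); rewrite e ltnn.
  move=> z; apply/mapP/idP => [[x]|zz].
    by rewrite mem_filter => /andP[xz _] ->.
  have /mapP[i] := zz; rewrite mem_iota /= add0n => ik ez.
  have zgt : 0 < z by rewrite ez -z0; apply: zmono => //; apply: ltnW.
  have zle : z < n.+1 by rewrite ez -zk; apply: zmono.
  by exists z.-1; rewrite ?mem_filter ?mem_iota ?prednK // zz; lia.
split => //; apply: contraT => vf.
have [J [J1 J2 J3]] := kn_witness wf sza out_lt dwo.
have [J0 J0D hJ0] := code_exists J1 J2 nt0.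
pose uw := u k.+2.
pose F x := in_code d y uw x || in_code d y J0 x.
have kF : kn y F (KT a) d (outp y) false.
  by rewrite J3 ?eqbF_neg // => x xJ; rewrite /F hJ0 ?orbT.
pose Fs := [seq dig nt uw l | l <- iota 0 s] ++ [seq dig nt J0 l | l <- iota 0 s].
have FFs x : F x -> x \in Fs.
  by move=> /orP[]/seq.hasP[l ls /eqP <-]; rewrite mem_cat map_f ?orbT.
have szF : size Fs <= 2 * s by rewrite size_cat !size_map size_iota; lia.
have s0 : 0 < s by rewrite /wit_size expn_gt0.
have m1 : 1 < 2 * s by lia.
have [L [L1 /allP L2 L3]] := kn_local wf FFs szF m1 out_lt dwo kF.
have reveal x : exists p : nat * nat, x < n -> [/\ p.1 < k.+2, p.2 < k.+2 &
   if nth false a x then (u p.1 == x.+1) else [&& p.2 == p.1.+1, u p.1 < x.+1 & x.+1 < u p.2]].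
  case: (ltnP x n) => xn; last by exists (0, 0).
  case Tx: (nth false a x).
    have := Tx; rewrite aE // => /seq.hasP[i]; rewrite mem_iota add0n => ik e.
    by exists (i.+1, i.+1) => _; split; rewrite //= ltnS // ltnW.
  (* A false input is enclosed by the first position beyond it and the preceding one. *)
  have ex : exists i, (i <= k.+1) && (x.+1 < u i) by exists k.+1; rewrite leqnn zk ltnS.
  case: (ex_minnP ex) => -[|i] /andP[ik xi] imin; first by rewrite z0 in xi.
  exists (i, i.+1) => _; split; rewrite /= ?ltnS // ?eqxx; first exact: ltnW.
  apply/andP; split => //=; rewrite xi andbT.
  have nlt : ~~ (x.+1 < u i) by apply/negP => h; have := imin i; rewrite (ltnW ik) h => /(_ isT); rewrite ltnn.
  rewrite -ltnS ltn_neqAle leqNgt nlt andbT; apply/negP => /eqP e.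
  case: i ik e {xi imin nlt} => [|i] ik e; first by rewrite z0 in e.
  by move: Tx; rewrite aE // => /negbT/seq.hasPn/(_ i); rewrite mem_iota add0n e eqxx => /(_ ik).
have /choice[p hp] := reveal.
pose lst := flatten [seq [:: (p x).1; (p x).2] | x <- L].
have szl : size lst <= 2 * num_pos d.
  have -> : size lst = 2 * size L by rewrite /lst; elim: (L) => //= x l ->; lia.
  by rewrite leq_mul2l L1.
pose idx j := nth k.+2 lst j.
have idxlt j : j < Q -> idx j < k + 3.
  move=> _; rewrite /idx; case: (ltnP j (size lst)) => jl; last by rewrite nth_default //; lia.
  have /flattenP[l /mapP[x xL ->]] := mem_nth k.+2 jl.
  have [h1 h2 _] := hp x (L2 x xL).
  by rewrite !inE => /orP[]/eqP ->; lia.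
have /andP[_ /allP/(_ (2 * num_pos d))] := hPhi idx idxlt.
rewrite mQ arityE addn1 ltnSn => /(_ isT).
have -> : idx (2 * num_pos d) = k.+2 by rewrite /idx nth_default.
rewrite eqxx /= => /allP/(_ J0); rewrite mem_iota add0n => /(_ J0D) /negP[].
apply: L3 => x xL.
have pos_of i : i \in [:: (p x).1; (p x).2] -> exists2 j, j < Q & idx j = i.
  move=> il; have il' : i \in lst by apply/flattenP; exists [:: (p x).1; (p x).2] => //; apply: map_f.
  exists (index i lst); last by rewrite /idx nth_index.
  by rewrite arityE addn1 ltnS; apply: leq_trans szl; apply: ltnW; rewrite index_mem.
have [j1 j1Q e1] := pos_of (p x).1 (mem_head (p x).1 [:: (p x).2]).
have in2 : (p x).2 \in [:: (p x).1; (p x).2] by rewrite !inE eqxx orbT.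
have [j2 j2Q e2] := pos_of (p x).2 in2.
have [h1 h2] := hp x (L2 x xL).
rewrite /T /revealed; case: (nth false a x) => h3.
  by apply/seq.hasP; exists j1; [rewrite mQ|rewrite e1 lt2 h1; exact: h3].
have /and3P[/eqP e3 l1 l2] := h3.
apply/seq.hasP; exists j1; first by rewrite mQ.
apply/seq.hasP; exists j2; first by rewrite mQ.
by rewrite e1 e2 lt2 h2 l1 l2 e3 expnS mulnC eqxx.
Qed.

End CSPProofs.

(** * Computing the constraints *)

Lemma pbd_sizeX (T : Type) (X : T -> seq bool) (S : T -> nat) :
  pbd S (fun t => size (X t)) -> pbd (eS S) (fun p => size (eX X p)).
Proof. exact: (@pbd_weak T S (fun t => size (X t))). Qed.

Section CircuitPT.
Variable A : finType.

Section S1.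
Variable T : Type.
Variables (X : T -> seq bool) (S : T -> nat) (B : seq (T -> nat)).
Hypothesis hX : pbd S (fun t => size (X t)).

Lemma pt_cnt0 f : pt A X S B f -> pt A X S B (fun t => cnt0 (X t) (f t)).
Proof.
move=> hf; apply: (@pt_sum A T X S B f (fun t i => nat_of_bool (~~ nth false (X t) i))) => //.
apply: (@pt_neg _ _ _ _ _ (fun p : T * nat => nth false (eX X p) p.2)).
by apply: pt_bit; [exact: pbd_sizeX|exact: pt_var0].
Qed.
End S1.

Section S2.
Variable T : Type.
Variables (X : T -> seq bool) (S : T -> nat) (B : seq (T -> nat)).
Hypothesis hX : pbd S (fun t => size (X t)).

Lemma pt_num f : pt A X S B f -> pt A X S B (fun t => num (X t) (f t)).
Proof.
move=> hf; apply: (@pt_sum A T X S B (fun t => size (X t)) (fun t l => nat_of_bool (nth false (X t) l && (cnt0 (X t) l == f t)))).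
  exact: pt_size.
apply: pt_and; first by apply: (@pt_bit _ _ (eX X)); [exact: pbd_sizeX|exact: pt_var0].
apply: pt_eqn; last exact: (pt_weak hf).
by apply: (@pt_cnt0 _ (eX X)); [exact: pbd_sizeX|exact: pt_var0].
Qed.
End S2.

Ltac pt_x := first [assumption | exact: pbd_sizeX | by apply: pbd_sizeX; pt_x
  | by do 2 apply: pbd_sizeX | by do 3 apply: pbd_sizeX | by do 4 apply: pbd_sizeX | by do 5 apply: pbd_sizeX].
Ltac pt_go := repeat first [pt_step | apply: pt_num; first by pt_x].

Section S3.
Variable T : Type.
Variables (X : T -> seq bool) (S : T -> nat) (B : seq (T -> nat)).
Hypothesis hX : pbd S (fun t => size (X t)).

Lemma pt_gst f : pt A X S B f -> pt A X S B (fun t => gst (X t) (f t)).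
Proof.
move=> hf.
apply: (@pt_iter A T X S B f (fun _ => 4) (fun t i p => p + (if num (X t) p == 0 then 2 else 2 + num (X t) p.+1))
  (fun t => 4 + f t * (size (X t) + 2))) => //.
- exact: pt_const.
- apply: pt_add; first exact: pt_var0.
  apply: pt_if; [apply: pt_eqn; last exact: pt_const|exact: pt_const|apply: pt_add; first exact: pt_const].
    by apply: (@pt_num _ (eX (eX X))); [do 2!apply: pbd_sizeX|exact: pt_var0].
  by apply: (@pt_num _ (eX (eX X))); [do 2!apply: pbd_sizeX|apply: pt_succ; exact: pt_var0].
- apply: pbd_add; first exact: pbd_const.
  by apply: pbd_mul; [exact: pt_pbd hf|apply: pbd_add => //; exact: pbd_const].
- move=> t i le; apply: leq_trans (gst_bound (X t) i) _.
  by rewrite leq_add2l leq_mul2r le orbT.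
Qed.

Lemma pt_inp : pt A X S B (fun t => inp (X t)).
Proof. by apply: (pt_num hX); exact: pt_const. Qed.

Lemma pt_ngate : pt A X S B (fun t => ngate (X t)).
Proof. by apply: (pt_num hX); exact: pt_const. Qed.

Lemma pt_outp : pt A X S B (fun t => outp (X t)).
Proof. by apply: (pt_num hX); exact: pt_const. Qed.

Lemma pt_ntot : pt A X S B (fun t => ntot (X t)).
Proof. exact: (pt_add pt_inp pt_ngate). Qed.
End S3.

Section S4.
Variable T : Type.
Variables (X : T -> seq bool) (S : T -> nat) (B : seq (T -> nat)).
Hypothesis hX : pbd S (fun t => size (X t)).

Lemma pt_pos f : pt A X S B f -> pt A X S B (fun t => pos (X t) (f t)).
Proof. by move=> hf; apply: (pt_gst hX); apply: pt_sub => //; exact: pt_inp. Qed.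

Lemma pt_gtag f : pt A X S B f -> pt A X S B (fun t => gtag (X t) (f t)).
Proof. by move=> hf; apply: (pt_num hX); exact: pt_pos. Qed.

Lemma pt_fan f : pt A X S B f -> pt A X S B (fun t => fan (X t) (f t)).
Proof.
move=> hf; apply: pt_if; last by apply: (pt_num hX); apply: pt_succ; exact: pt_pos.
  by apply: pt_eqn; [exact: pt_gtag|exact: pt_const].
exact: pt_const.
Qed.

Lemma pt_child f g : pt A X S B f -> pt A X S B g -> pt A X S B (fun t => child (X t) (f t) (g t)).
Proof.
move=> hf hg; apply: (pt_num hX); apply: pt_add => //; apply: pt_add; first exact: pt_pos.
by apply: pt_if; [apply: pt_eqn; [exact: pt_gtag|]| |]; exact: pt_const.
Qed.

Lemma pt_dig D f j : pt A X S B D -> pt A X S B f -> pt A X S B j ->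
  pt A X S B (fun t => dig (D t) (f t) (j t)).
Proof.
move=> hD hf hj.
have e D' v i : iteri i (fun _ p => p %/ D') v = v %/ D' ^ i.
  by elim: i => [|i IH]; rewrite ?expn0 ?divn1 // [LHS]/= IH expnSr divnMA.
apply: (@pt_ext _ _ _ _ _ (fun t => (iteri (j t) (fun _ p => p %/ D t) (f t)) %% D t)) => [t|].
  by rewrite /dig e.
apply: pt_modn => //.
apply: (@pt_iter A T X S B j f (fun t i p => p %/ D t) f) => //.
- by apply: pt_divn; [exact: pt_var0|exact: (pt_weak (pt_weak hD))].
- exact: pt_pbd hf.
- by move=> t i _; rewrite e leq_div.
Qed.
End S4.

Ltac pt_c := lazymatch goal with
  | |- pt _ _ _ _ (fun p => num _ _) => apply: pt_num
  | |- pt _ _ _ _ (fun p => cnt0 _ _) => apply: pt_cnt0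
  | |- pt _ _ _ _ (fun p => size _) => apply: pt_size
  | |- pt _ _ _ _ (fun p => gst _ _) => apply: pt_gst
  | |- pt _ _ _ _ (fun p => inp _) => apply: pt_inp
  | |- pt _ _ _ _ (fun p => ngate _) => apply: pt_ngate
  | |- pt _ _ _ _ (fun p => outp _) => apply: pt_outp
  | |- pt _ _ _ _ (fun p => ntot _) => apply: pt_ntot
  | |- pt _ _ _ _ (fun p => gtag _ _) => apply: pt_gtag
  | |- pt _ _ _ _ (fun p => fan _ _) => apply: pt_fan
  | |- pt _ _ _ _ (fun p => child _ _ _) => apply: pt_child
  | |- pt _ _ _ _ (fun p => dig _ _ _) => apply: pt_dig
  | |- pt _ _ _ _ (fun p => nat_of_bool (nth false _ _)) => apply: pt_bit
  | |- pbd _ _ => first [assumption | apply: pbd_sizeX]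
  end.
Ltac pt_all_auto := repeat first [pt_c | pt_step].

Section S5.
Variable d : nat.

(** The depth [j] is a constant, so the recursion unfolds into nested bounded quantifiers; each of
    them extends the context, hence an induction over all contexts. *)
Lemma pt_dw j : forall (T : Type) (X : T -> seq bool) (S : T -> nat) (B : seq (T -> nat)),
  pbd S (fun t => size (X t)) -> forall w f, pt A X S B w -> pt A X S B f ->
  pt A X S B (fun t => nat_of_bool (dw (X t) j (w t) (f t))).
Proof.
elim: j => [|j IH] T X S B hX w f hw hf.
  apply: (@pt_ext _ _ _ _ _ (fun t => nat_of_bool (f t < inp (X t)))) => [t|]; first by rewrite /=; case: ifP.
  by pt_all_auto.
apply: (@pt_ext _ _ _ _ _ (fun t => nat_of_bool ((f t < inp (X t)) ||
   ((nat_of_bool (2 < fan (X t) (f t)) <= w t) && all (fun i => dw (X t) j (w t - nat_of_bool (2 < fan (X t) (f t))) (child (X t) (f t) i)) (iota 0 (fan (X t) (f t))))))) => [t|].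
  by rewrite /=; case: ifP.
apply: pt_or; first by pt_all_auto.
apply: pt_and; first by pt_all_auto.
apply: pt_all; first by pt_all_auto.
by apply: (IH _ (eX X)); pt_all_auto.
Qed.

Lemma pt_parse_ok (T : Type) (X : T -> seq bool) (S : T -> nat) (B : seq (T -> nat)) :
  pbd S (fun t => size (X t)) -> pt A X S B (fun t => nat_of_bool (parse_ok (X t))).
Proof.
move=> hX; rewrite /parse_ok; under eq_fun => t do rewrite -subn1.
by pt_all_auto.
Qed.

Lemma pt_wfb (T : Type) (X : T -> seq bool) (S : T -> nat) (B : seq (T -> nat)) :
  pbd S (fun t => size (X t)) -> pt A X S B (fun t => nat_of_bool (wfb (X t))).
Proof. by move=> hX; rewrite /wfb /=; pt_all_auto. Qed.

Lemma pt_valid (T : Type) (X : T -> seq bool) (S : T -> nat) (B : seq (T -> nat)) :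
  pbd S (fun t => size (X t)) -> pt A X S B (fun t => nat_of_bool (valid d (X t))).
Proof.
move=> hX; apply: pt_and; first exact: pt_parse_ok.
by apply: pt_and; [exact: pt_wfb|apply: pt_dw => //; pt_all_auto].
Qed.

Lemma pt_in_code (T : Type) (X : T -> seq bool) (S : T -> nat) (B : seq (T -> nat)) :
  pbd S (fun t => size (X t)) -> forall J f, pt A X S B J -> pt A X S B f ->
  pt A X S B (fun t => nat_of_bool (in_code d (X t) (J t) (f t))).
Proof. by move=> hX J f hJ hf; rewrite /in_code; pt_all_auto. Qed.

End S5.

Section S6.
Variables (d kap0 : nat).

(* The two vertices [v] and [w] reveal the unknowns with coefficients
   [cv v w j] and values [uv v w j]. *)
Variables (cv uv : seq bool -> nat -> nat -> nat -> nat).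
Hypothesis pt_cv : forall (T : Type) (X : T -> seq bool) (S : T -> nat) (B : seq (T -> nat)),
  pbd S (fun t => size (X t)) -> pbd S (fun t => 2 ^ num (X t) 0) -> forall v w j, pt A X S B v -> pt A X S B w -> pt A X S B j ->
  pt A X S B (fun t => cv (X t) (v t) (w t) (j t)).
Hypothesis pt_uv : forall (T : Type) (X : T -> seq bool) (S : T -> nat) (B : seq (T -> nat)),
  pbd S (fun t => size (X t)) -> pbd S (fun t => 2 ^ num (X t) 0) -> forall v w j, pt A X S B v -> pt A X S B w -> pt A X S B j ->
  pt A X S B (fun t => uv (X t) (v t) (w t) (j t)).

Lemma pbd_pow2X (T : Type) (X : T -> seq bool) (S : T -> nat) :
  pbd S (fun t => 2 ^ num (X t) 0) -> pbd (eS S) (fun p => 2 ^ num (eX X p) 0).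
Proof. exact: (@pbd_weak T S (fun t => 2 ^ num (X t) 0)). Qed.

(** Powers of two in the parameter force the size measure to dominate [2 ^ k]; here polynomial time
    turns into fixed-parameter time. *)
Lemma pt_pow2k (T : Type) (X : T -> seq bool) (S : T -> nat) (B : seq (T -> nat)) c :
  pbd S (fun t => size (X t)) -> pbd S (fun t => 2 ^ num (X t) 0) ->
  pt A X S B (fun t => 2 ^ (num (X t) 0 + c)).
Proof.
move=> hX hk; apply: (@pt_ext _ _ _ _ _ (fun t => 2 ^ num (X t) 0 * 2 ^ c)) => [t|]; first by rewrite expnD.
apply: pt_mul; last exact: pt_const.
by apply: pt_pow2 => //; pt_all_auto.
Qed.

Lemma pt_pow2k1 (T : Type) (X : T -> seq bool) (S : T -> nat) (B : seq (T -> nat)) :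
  pbd S (fun t => size (X t)) -> pbd S (fun t => 2 ^ num (X t) 0) ->
  pt A X S B (fun t => 2 ^ (num (X t) 0).+1).
Proof. by move=> hX hk; apply: pt_ext (pt_pow2k B 1 hX hk) => t; rewrite addn1. Qed.

Lemma pt_pow2k2 (T : Type) (X : T -> seq bool) (S : T -> nat) (B : seq (T -> nat)) :
  pbd S (fun t => size (X t)) -> pbd S (fun t => 2 ^ num (X t) 0) ->
  pt A X S B (fun t => 2 ^ (num (X t) 0).+2).
Proof. by move=> hX hk; apply: pt_ext (pt_pow2k B 2 hX hk) => t; rewrite addn2. Qed.

Ltac pt_d := lazymatch goal with
  | |- pt _ _ _ _ (fun p => nat_of_bool (in_code _ _ _ _)) => apply: pt_in_code
  | |- pt _ _ _ _ (fun p => cv _ _ _ _) => apply: pt_cv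
  | |- pt _ _ _ _ (fun p => uv _ _ _ _) => apply: pt_uv
  | |- pt _ _ _ _ (fun p => 2 ^ (num _ 0 + _)) => apply: pt_pow2k
  | |- pt _ _ _ _ (fun p => 2 ^ (num _ 0).+1) => apply: pt_pow2k1
  | |- pt _ _ _ _ (fun p => 2 ^ (num _ 0).+2) => apply: pt_pow2k2
  | |- pbd _ (fun t => 2 ^ _) => first [assumption | apply: pbd_pow2X]
  end.
Ltac pt_all_d := repeat first [pt_d | pt_c | pt_step].

Lemma pt_revealed (T : Type) (X : T -> seq bool) (S : T -> nat) (B : seq (T -> nat)) (b : bool) :
  pbd S (fun t => size (X t)) -> pbd S (fun t => 2 ^ num (X t) 0) ->
  forall v w x, pt A X S B v -> pt A X S B w -> pt A X S B x ->
  pt A X S B (fun t => nat_of_bool (revealed d (X t) (cv (X t) (v t) (w t)) (uv (X t) (v t) (w t)) (x t) b)).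
Proof.
move=> hX hk v w x hv hw hx; rewrite /revealed.
by case: b; pt_all_d.
Qed.

Lemma pt_kn j : forall (T : Type) (X : T -> seq bool) (S : T -> nat) (B : seq (T -> nat)),
  pbd S (fun t => size (X t)) -> pbd S (fun t => 2 ^ num (X t) 0) ->
  forall v w J J0 f b, pt A X S B v -> pt A X S B w -> pt A X S B J -> pt A X S B J0 -> pt A X S B f ->
  pt A X S B (fun t => nat_of_bool (kn (X t) (fun x => in_code d (X t) (J t) x || in_code d (X t) (J0 t) x)
    (revealed d (X t) (cv (X t) (v t) (w t)) (uv (X t) (v t) (w t))) j (f t) b)).
Proof.
elim: j => [|j IH] T X S B hX hk v w J J0 f b hv hw hJ hJ0 hf.
  apply: pt_ifb; [by pt_all_d|exact: pt_revealed|exact: pt_const].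
apply: pt_ifb; [by pt_all_d|exact: pt_revealed|].
apply: pt_ifb; [by pt_all_d|by apply: IH => //; pt_all_d|].
have hX' := pbd_sizeX hX; have hk' := pbd_pow2X hk.
have hrec b' : pt A (eX X) (eS S) (eB B) (fun p => nat_of_bool (kn (eX X p) (fun x => in_code d (eX X p) (J p.1) x || in_code d (eX X p) (J0 p.1) x)
    (revealed d (eX X p) (cv (eX X p) (v p.1) (w p.1)) (uv (eX X p) (v p.1) (w p.1))) j (child (X p.1) (f p.1) p.2) b')).
  by apply: IH => //; [exact: (pt_weak hv)|exact: (pt_weak hw)|exact: (pt_weak hJ)|exact: (pt_weak hJ0)|pt_all_d].
apply: pt_ifb.
- by case: b; pt_all_d.
- apply: pt_all; first by pt_all_d.
  by apply: pt_or; [pt_all_d|exact: hrec].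
- apply: pt_has; first by pt_all_d.
  by apply: pt_and; [pt_all_d|exact: hrec].
Qed.

Lemma pt_Phi (T : Type) (X : T -> seq bool) (S : T -> nat) (B : seq (T -> nat)) :
  pbd S (fun t => size (X t)) -> pbd S (fun t => 2 ^ num (X t) 0) ->
  forall v w, pt A X S B v -> pt A X S B w ->
  pt A X S B (fun t => nat_of_bool (Phi d (X t) (cv (X t) (v t) (w t)) (uv (X t) (v t) (w t)))).
Proof.
move=> hX hk v w hv hw; apply: pt_and.
  rewrite /ordered.
  by pt_all_d.
rewrite /unrefuted.
apply: pt_all; first exact: pt_const.
apply: pt_imply; first by pt_all_d.
apply: pt_all; first by pt_all_d.
apply: pt_neg; apply: (@pt_kn d _ (eX (eX X))); pt_all_d.
Qed.

End S6.
End CircuitPT.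

Ltac pt_c := lazymatch goal with
  | |- pt _ _ _ _ (fun p => num _ _) => apply: pt_num
  | |- pt _ _ _ _ (fun p => cnt0 _ _) => apply: pt_cnt0
  | |- pt _ _ _ _ (fun p => size _) => apply: pt_size
  | |- pt _ _ _ _ (fun p => gst _ _) => apply: pt_gst
  | |- pt _ _ _ _ (fun p => inp _) => apply: pt_inp
  | |- pt _ _ _ _ (fun p => ngate _) => apply: pt_ngate
  | |- pt _ _ _ _ (fun p => outp _) => apply: pt_outp
  | |- pt _ _ _ _ (fun p => ntot _) => apply: pt_ntot
  | |- pt _ _ _ _ (fun p => gtag _ _) => apply: pt_gtag
  | |- pt _ _ _ _ (fun p => fan _ _) => apply: pt_fan
  | |- pt _ _ _ _ (fun p => child _ _ _) => apply: pt_child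
  | |- pt _ _ _ _ (fun p => dig _ _ _) => apply: pt_dig
  | |- pt _ _ _ _ (fun p => nat_of_bool (nth false _ _)) => apply: pt_bit
  | |- pbd _ _ => first [assumption | apply: pbd_sizeX]
  end.
Ltac pt_all_auto := repeat first [pt_c | pt_step].

Ltac pt_d := lazymatch goal with
  | |- pt _ _ _ _ (fun p => nat_of_bool (in_code _ _ _ _)) => apply: pt_in_code
  | |- pt _ _ _ _ (fun p => 2 ^ (num _ 0 + _)) => apply: pt_pow2k
  | |- pbd _ (fun t => 2 ^ _) => first [assumption | apply: pbd_pow2X]
  end.

(** * The graphs of part (a) *)

(** The first two terms of the binomial expansion. *)
Lemma bernoulli m j : m ^ j + j * m ^ j.-1 <= m.+1 ^ j.
Proof.
elim: j => [|[|j] IH]; [by rewrite !expn0 mul0n| by rewrite !expn1 expn0; lia|].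
rewrite expnS [in X in _ <= X]expnS /=; rewrite /= in IH.
by rewrite expnS in IH *; move: (m ^ j) (m.+1 ^ j.+1) IH => p q IH; nia.
Qed.

Lemma expn_double m : 0 < m -> m ^ m * 2 <= m.+1 ^ m.
Proof.
move=> m0; apply: leq_trans (bernoulli m m).
by rewrite muln2 -addnn leq_add2l -expnS prednK.
Qed.

(** The [c]-th power of [(1 + 1/m) ^ m >= 2] exceeds [c]. *)
Lemma expn_gap m c : 0 < m -> c * m ^ (m * c) < m.+1 ^ (m * c).
Proof.
move=> m0; apply: leq_trans (_ : 2 ^ c * m ^ (m * c) <= _).
  by rewrite ltn_mul2r expn_gt0 m0 /= ltn_expl.
rewrite !expnM -expnMn mulnC; case: c => // c.
by rewrite leq_exp2r // expn_double.
Qed.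

Lemma sym_core (R : rel nat) : symmetric R -> symmetric (fun v w => [&& R v w, R v v & R w w]).
Proof. by move=> sR v w; rewrite sR [R v v && _]andbC. Qed.

Section GapA.
Variables (d r : nat) (y : seq bool).
Notation k := (num y 0).
Notation Q := (arity d).

(** Room for positions up to [n.+1] and for the codes of node lists. *)
Definition zbound := (inp y).+2 + ntot y ^ wit_size d.
Definition hbits := up_log 2 zbound.
Definition kap := k + 3.
Definition dbase := 2 ^ kap * 2 ^ hbits.
Definition nbase := dbase ^ Q.
Definition ncopy := nbase ^ r.
Definition rel0 (v w : nat) : bool :=
  valid d y && prod_rel nbase r (compat kap hbits (arity0 d) (Phi d y)) v w.
(** Cliques of a graph say nothing about a pair [v, v], but decoding also needs the consistency of a
    vertex with itself; hence the two reflexive conditions. *)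
Definition relA (v w : nat) : bool := [&& rel0 v w, rel0 v v & rel0 w w].
Definition yes_val := ((2 ^ kap) ^ Q) ^ r.
(* A function of the parameter [k] of the instance only, hence usable as the
   parameter of the gap problem. *)
Definition no_val := ((2 ^ kap) ^ Q - (2 ^ kap) ^ Q %/ (2 * Q + 2)) ^ r.

Lemma zbound_le : zbound <= 2 ^ hbits.
Proof. by apply: up_logP. Qed.

Lemma nbase_gt0 : 0 < nbase.
Proof. by rewrite /nbase expn_gt0 /dbase muln_gt0 !expn_gt0. Qed.

Lemma rel0_sym : symmetric rel0.
Proof.
move=> v w; apply: (f_equal (andb (valid d y))).
apply: prod_rel_sym; exact: compat_sym.
Qed.

Lemma relA_sym : symmetric relA.
Proof. exact: (sym_core rel0_sym). Qed.

Lemma relA_yes a : valid d y -> size a = inp y -> count id a = k -> value y a (outp y) ->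
  yes_val <= tree_alpha (dblG ncopy relA_sym).
Proof.
move=> vy sza cnt va.
have [||u u1 u2] := csp_complete vy sza cnt va (H := 2 ^ hbits). 
  by apply: leq_trans zbound_le; apply: leq_addr.
  by apply: leq_trans zbound_le; apply: leq_addl.

have [C cC hC] := @gap_complete kap hbits (arity0 d) (Phi d y) (@Phi_ext d y) u u1 u2.
have [C' cC' hC'] := prod_complete r hC.
rewrite cC in cC'; rewrite /yes_val -cC'.
apply: tree_alpha_dbl_ge => v w vC wC _.
by rewrite /relA /rel0 vy /= !hC'.
Qed.

Lemma no_val_gt0 : 0 < no_val.
Proof.
rewrite /no_val expn_gt0 subn_gt0; apply/orP; left.
by rewrite ltn_Pdiv // ?expn_gt0 //; lia.
Qed.

Lemma relA_no : no_val < tree_alpha (dblG ncopy relA_sym) ->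
  valid d y /\ exists2 a : seq bool, size a = inp y & count id a = k /\ value y a (outp y).
Proof.
move=> lt.
have [|A cA hA] := @tree_alpha_dbl_gt ncopy relA relA_sym no_val; first by rewrite no_val_gt0.
have hA' : {in A &, forall v w : 'I_ncopy, rel0 v w}.
  move=> v w vA wA; case: (eqVneq v w) => [<-|ne]; last by case/and3P: (hA v w vA wA ne).
  have [w' w'A ne] : exists2 w', w' \in A & v != w'.
    apply/exists_inP; rewrite -[[exists _ in _, _]]negbK negb_exists_in; apply/negP => /forall_inP h.
    have : A \subset [set v] by apply/fintype.subsetP => w' /h; rewrite negbK inE eq_sym.
    move/subset_leq_card; rewrite cards1 leqNgt => /negP[].
    by apply: leq_ltn_trans cA; apply: no_val_gt0.
  by case/and3P: (hA v w' vA w'A ne).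
have [v vA] : exists v, v \in A by apply/set0Pn; rewrite -card_gt0; apply: leq_trans cA.
have vy : valid d y by case/andP: (hA' v v vA vA).
split => //.
have hA'' : {in A &, forall v w : 'I_ncopy, prod_rel nbase r (compat kap hbits (arity0 d) (Phi d y)) v w}.
  by move=> p q pA qA; case/andP: (hA' p q pA qA).
have [C cC hC] := prod_sound nbase_gt0 hA'' cA.
have [|u _ u2] := gap_sound (@Phi_ext d y) hC; last exact: csp_sound vy u u2.
rewrite -/(arity d).
set KQ := (2 ^ kap) ^ Q in cC *; set m := 2 * Q + 2 in cC *.
have m0 : 0 < m by rewrite /m addn2.
have KQ0 : 0 < KQ by rewrite /KQ !expn_gt0.
have le : #|C| <= nbase by rewrite -[X in _ <= X]card_ord; apply: max_card.
have h1 : KQ - #|C| < KQ %/ m \/ KQ - #|C| = 0 by have := leq_div KQ m; lia.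
case: h1 => [h1|->]; last by rewrite muln0.
apply: leq_trans (_ : m * (KQ %/ m) <= _); first by rewrite ltn_mul2l m0.
by rewrite mulnC leq_trunc_div.
Qed.

(** As [m <= KQ], rounding costs at most a factor 2: the quotient [KQ %/ m] is at least
    [KQ / (2 * m)], where [2 * m] is [4 * Q + 4]. Each of the [r] factors thus gains at least
    [(4 * Q + 4) / (4 * Q + 3)], and [expn_gap] gives the choice of [r]. *)
Lemma yes_no_gap c : 0 < c -> r = (4 * Q + 3) * c -> c * no_val < yes_val.
Proof.
move=> c0 rE; rewrite /no_val /yes_val; set KQ := (2 ^ kap) ^ Q; set m := 2 * Q + 2.
have KQ0 : 0 < KQ by rewrite /KQ !expn_gt0.
have m0 : 0 < m by rewrite /m addn2.
have mK : m <= KQ.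
  rewrite /KQ /kap -expnM; apply: leq_trans (_ : 2 ^ (3 * Q) <= _).
    rewrite mulnC expnM; have : Q < 2 ^ Q by rewrite ltn_expl.
    have : 0 < 2 ^ Q by rewrite expn_gt0.
    have Q1 : 1 < Q by [].
    have : 2 ^ 2 <= 2 ^ Q by rewrite leq_exp2l.
    rewrite !expnS expn0 muln1 /m; move: (2 ^ Q) => p h1 h2 h3; nia.
  by rewrite leq_exp2l // leq_mul2r leq_addl orbT.
have h1 : KQ <= KQ %/ m * (2 * m).
  have e := divn_eq KQ m; have lt : KQ %% m < m by rewrite ltn_pmod.
  have : 0 < KQ %/ m by rewrite divn_gt0.
  nia.
have h2 : (KQ - KQ %/ m) * (4 * Q + 4) <= KQ * (4 * Q + 3).
  have e : 2 * m = 4 * Q + 4 by rewrite /m; lia.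
  rewrite e in h1; have := leq_div KQ m; nia.
have gap := @expn_gap (4 * Q + 3) c _; rewrite -rE in gap.
have g0 : 0 < 4 * Q + 3 by rewrite addn3.
have {}gap := gap g0; rewrite -addnS in gap.
have e4 : 0 < (4 * Q + 4) ^ r by rewrite expn_gt0 addn4.
rewrite -(ltn_pmul2r e4) -mulnA -expnMn.
apply: leq_ltn_trans (_ : c * (KQ * (4 * Q + 3)) ^ r < _).
  by rewrite leq_mul2l; apply/orP; right; case: (r) => // r'; rewrite leq_exp2r.
by rewrite expnMn mulnCA ltn_pmul2l // expn_gt0 KQ0.
Qed.

End GapA.

Section GapA_PT.
Variables (A : finType) (d r : nat).

(** The logarithm counts the powers of two below [f t]; the cap keeps them small. *)
Lemma pt_up_log (T : Type) (X : T -> seq bool) (S : T -> nat) (B : seq (T -> nat)) f :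
  pt A X S B f -> pt A X S B (fun t => up_log 2 (f t)).
Proof.
move=> hf.
apply: (@pt_ext _ _ _ _ _ (fun t => \sum_(i < f t) nat_of_bool (minn (2 ^ i) (f t) < f t))) => [t|].
  rewrite (eq_bigr (fun i : 'I_(f t) => nat_of_bool (i < up_log 2 (f t)))) => [|i _].
    by rewrite sum_ltn; apply/minn_idPr; apply: up_log_min => //; apply: ltnW; rewrite ltn_expl.
  congr nat_of_bool; rewrite gtn_min ltnn orbF !ltnNge; congr negb.
  apply/idP/idP => h; first exact: up_log_min.
  by apply: leq_trans (@up_logP 2 (f t) isT) _; rewrite leq_exp2l.
apply: (@pt_sum A T X S B f (fun t i => nat_of_bool (minn (2 ^ i) (f t) < f t))) => //.
apply: pt_leq; last exact: (pt_weak hf).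
by apply: pt_succ; apply: pt_pow2cap; [exact: pt_var0|exact: (pt_weak hf)].
Qed.

Section Ctx.
Variable T : Type.
Variables (X : T -> seq bool) (S : T -> nat) (B : seq (T -> nat)).
Hypothesis hX : pbd S (fun t => size (X t)).
Hypothesis hk : pbd S (fun t => 2 ^ num (X t) 0).

Lemma pt_zbound : pt A X S B (fun t => zbound d (X t)).
Proof. by rewrite /zbound; pt_all_auto. Qed.

Lemma pt_hbits : pt A X S B (fun t => hbits d (X t)).
Proof. by apply: pt_up_log; exact: pt_zbound. Qed.

Lemma pt_pow2h : pt A X S B (fun t => 2 ^ hbits d (X t)).
Proof.
apply: pt_pow2; first exact: pt_hbits.
apply: pbd_le (pbd_mul (pbd_const S 2) (pt_pbd pt_zbound)) => t.
rewrite /hbits; case e: (up_log 2 (zbound d (X t))) => [|j]; first by rewrite expn0 muln_gt0 /= /zbound.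
rewrite expnS leq_mul2l /= leqNgt; apply/negP => /ltnW/(@up_log_min 2 _ _ isT).
by rewrite e ltnn.
Qed.

Lemma pt_pow2kap : pt A X S B (fun t => 2 ^ kap (X t)).
Proof. exact: (pt_pow2k A B 3 hX hk). Qed.

Lemma pt_kap : pt A X S B (fun t => kap (X t)).
Proof. by rewrite /kap; pt_all_auto. Qed.

Lemma pt_dbase : pt A X S B (fun t => dbase d (X t)).
Proof. by apply: pt_mul; [exact: pt_pow2kap|exact: pt_pow2h]. Qed.

Lemma pt_nbase : pt A X S B (fun t => nbase d (X t)).
Proof. by apply: pt_exp; exact: pt_dbase. Qed.

Lemma pt_ncopy : pt A X S B (fun t => ncopy d r (X t)).
Proof. by apply: pt_exp; exact: pt_nbase. Qed.

Lemma pt_acoord v j : pt A X S B v -> pt A X S B j ->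
  pt A X S B (fun t => acoord (kap (X t)) (hbits d (X t)) (v t) (j t)).
Proof.
by move=> hv hj; apply: pt_modn; [apply: (pt_dig pt_dbase)|exact: pt_pow2kap].
Qed.

Lemma pt_ycoord v j : pt A X S B v -> pt A X S B j ->
  pt A X S B (fun t => ycoord (kap (X t)) (hbits d (X t)) (v t) (j t)).
Proof.
by move=> hv hj; apply: pt_divn; [apply: (pt_dig pt_dbase)|exact: pt_pow2kap].
Qed.

Lemma pt_no_val : pt A X S B (fun t => no_val d r (X t)).
Proof.
apply: pt_exp; apply: pt_sub; first by apply: pt_exp; exact: pt_pow2kap.
by apply: pt_divn; [apply: pt_exp; exact: pt_pow2kap|exact: pt_const].
Qed.

End Ctx.

Ltac pt_e := lazymatch goal with
  | |- pt _ _ _ _ (fun p => acoord _ _ _ _) => apply: pt_acoord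
  | |- pt _ _ _ _ (fun p => ycoord _ _ _ _) => apply: pt_ycoord
  | |- pt _ _ _ _ (fun p => kap _) => apply: pt_kap
  | |- pt _ _ _ _ (fun p => nbase _ _) => apply: pt_nbase
  end.
Ltac pt_all_e := repeat first [pt_e | pt_d | pt_c | pt_step].

Lemma pt_compat (T : Type) (X : T -> seq bool) (S : T -> nat) (B : seq (T -> nat)) :
  pbd S (fun t => size (X t)) -> pbd S (fun t => 2 ^ num (X t) 0) ->
  forall v w, pt A X S B v -> pt A X S B w ->
  pt A X S B (fun t => nat_of_bool (compat (kap (X t)) (hbits d (X t)) (arity0 d) (Phi d (X t)) (v t) (w t))).
Proof.
move=> hX hk v w hv hw; apply: pt_and.
  by rewrite /consistent /apt /ypt; pt_all_e.
apply: pt_imply.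
  apply: pt_all; first exact: pt_const.
  (* Powers are capped one above the tested number, where they can no longer be equal to it. *)
  apply: (@pt_ext _ _ _ _ _ (fun p : T * nat => nat_of_bool (has (fun i =>
     xorn (acoord (kap (X p.1)) (hbits d (X p.1)) (v p.1) p.2) (acoord (kap (X p.1)) (hbits d (X p.1)) (w p.1) p.2)
      == minn (2 ^ i) (xorn (acoord (kap (X p.1)) (hbits d (X p.1)) (v p.1) p.2) (acoord (kap (X p.1)) (hbits d (X p.1)) (w p.1) p.2)).+1) (iota 0 (kap (X p.1)))))) => [p|].
    rewrite /is_pow; congr nat_of_bool; apply: eq_has => i; set c := xorn _ _.
    by rewrite /minn; case: ltnP => // le; rewrite !ltn_eqF.
  apply: pt_has; first by pt_all_e.
  apply: pt_eqn; first by pt_all_e.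
  by apply: pt_pow2cap; pt_all_e.
apply: (@pt_Phi A d (fun y v w j => xorn (acoord (kap y) (hbits d y) v j) (acoord (kap y) (hbits d y) w j))
  (fun y v w j => xorn (ycoord (kap y) (hbits d y) v j) (ycoord (kap y) (hbits d y) w j))) => //.
- by move=> T' X' S' B' hX' hk' v' w' j' hv' hw' hj'; pt_all_e.
- by move=> T' X' S' B' hX' hk' v' w' j' hv' hw' hj'; pt_all_e.
Qed.

Lemma pt_rel0 (T : Type) (X : T -> seq bool) (S : T -> nat) (B : seq (T -> nat)) :
  pbd S (fun t => size (X t)) -> pbd S (fun t => 2 ^ num (X t) 0) ->
  forall v w, pt A X S B v -> pt A X S B w ->
  pt A X S B (fun t => nat_of_bool (rel0 d r (X t) (v t) (w t))).
Proof.
move=> hX hk v w hv hw; apply: pt_and; first exact: pt_valid.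
apply: pt_all; first exact: pt_const.
by apply: (@pt_compat _ (eX X)); pt_all_e.
Qed.

Lemma pt_adjA (T : Type) (X : T -> seq bool) (S : T -> nat) (B : seq (T -> nat)) :
  pbd S (fun t => size (X t)) -> pbd S (fun t => 2 ^ num (X t) 0) ->
  forall v w, pt A X S B v -> pt A X S B w ->
  pt A X S B (fun t => nat_of_bool (dbl (relA d r (X t)) (v t) (w t))).
Proof.
move=> hX hk v w hv hw; rewrite /dbl /relA.
apply: pt_or; first by pt_all_e.
apply: pt_and; first by pt_all_e.
apply: pt_neg; apply: pt_and; first by apply: pt_rel0 => //; exact: pt_half.
by apply: pt_and; apply: pt_rel0 => //; exact: pt_half.
Qed.

End GapA_PT.

(** Random access to the encoding of a graph, as [emitP] requires. *)
Definition graph_bit (n k : nat) (adj : nat -> nat -> bool) (i : nat) : bool :=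
  if i < k then true else if i == k then false
  else if i - k.+1 < n then true else if i - k.+1 == n then false
  else adj ((i - k.+1 - n.+1) %/ n) ((i - k.+1 - n.+1) %% n).

Lemma enc_graph_mkseq n (G : graph 'I_n) k (adj : nat -> nat -> bool) :
  (forall u v : 'I_n, G u v = adj u v) ->
  enc_graph_param G k = mkseq (graph_bit n k adj) (k.+1 + (n.+1 + n * n)).
Proof.
move=> hG.
have encE m : enc_nat m = mkseq (fun i => i < m) m.+1.
  rewrite /enc_nat /mkseq -addn1 iotaD map_cat /= add0n ltnn cats1; congr rcons.
  by apply: (@eq_from_nth _ true); rewrite ?size_nseq ?size_map ?size_iota // => i im; rewrite nth_nseq im (nth_map 0) ?size_iota // nth_iota.
rewrite /enc_graph_param !encE /mkseq iotaD map_cat iotaD map_cat; congr (_ ++ (_ ++ _)).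
- apply/eq_in_map => i; rewrite mem_iota ltnS /= /graph_bit => le.
  by case: ltnP => // ge; rewrite eqn_leq le ge.
- rewrite add0n -[in RHS](addn0 k.+1) iotaDl -map_comp; apply/eq_in_map => i.
  rewrite mem_iota ltnS /= /graph_bit => le.
  rewrite addKn.
  have -> : (k.+1 + i < k) = false by lia.
  have -> : (k.+1 + i == k) = false by lia.
  by case: ltnP => // ge; rewrite eqn_leq le ge.
- rewrite add0n -[X in iota X _](addn0 (k.+1 + n.+1)) iotaDl -map_comp.
  have gen m : iota 0 (m * n) = [seq u * n + v | u <- iota 0 m, v <- iota 0 n].
    elim: m => [|m IH]; first by rewrite mul0n.
    rewrite mulSnr iotaD IH -[m.+1]addn1 [in RHS]iotaD map_cat flatten_cat; congr (_ ++ _).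
    by rewrite /= cats0 !add0n -[in LHS](addn0 (m * n)) iotaDl.
  rewrite gen.
  rewrite map_allpairs -[iota 0 n]val_enum_ord allpairs_mapl allpairs_mapr.
  apply: eq_allpairs => u v /=; rewrite hG /graph_bit.
  have e1 : k.+1 + n.+1 + (u * n + v) - k.+1 = n.+1 + (u * n + v) by lia.
  rewrite e1 addKn.
  have n0 : 0 < n := leq_ltn_trans (leq0n u) (ltn_ord u).
  rewrite divnMDl // divn_small ?addn0 // modnMDl modn_small //.
  have -> : (k.+1 + n.+1 + (u * n + v) < k) = false by lia.
  have -> : (k.+1 + n.+1 + (u * n + v) == k) = false by lia.
  have -> : (n.+1 + (u * n + v) < n) = false by lia.
  by have -> : (n.+1 + (u * n + v) == n) = false by lia.
Qed.

Lemma emit_graph (A : finType) (T : Type) (X : T -> seq bool) (S : T -> nat) (B : seq (T -> nat))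
  (n k : T -> nat) (adj : T -> nat -> nat -> bool) : pt A X S B n -> pt A X S B k ->
  (forall f g, pt A (eX X) (eS S) (eB B) f -> pt A (eX X) (eS S) (eB B) g ->
     pt A (eX X) (eS S) (eB B) (fun p => nat_of_bool (adj p.1 (f p) (g p)))) ->
  emits A X S B (fun t => mkseq (graph_bit (n t) (k t) (adj t)) ((k t).+1 + ((n t).+1 + n t * n t))).
Proof.
move=> hn hk hadj; apply: (@emitP _ _ _ _ _ (fun t => (k t).+1 + ((n t).+1 + n t * n t)) (fun t i => graph_bit (n t) (k t) (adj t) i)).
  by pt_auto.
rewrite /graph_bit; apply: pt_ifb; [by pt_auto|exact: pt_const|].
apply: pt_ifb; [by pt_auto|exact: pt_const|].
apply: pt_ifb; [by pt_auto|exact: pt_const|].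
apply: pt_ifb; [by pt_auto|exact: pt_const|].
by apply: hadj; pt_auto.
Qed.

(** * FPT = W[1] from a gap algorithm *)

Lemma computableE f : computable f ->
  exists (M : TM) (time : nat -> nat), forall n, computes_within M (time n) (enc_nat n) (enc_nat (f n)).
Proof. by move=> [M /choice[time h]]; exists M, time. Qed.

Definition tm_code (M : TM) : finType := (symbol (tm_work M) + tm_state M)%type.

Lemma enc_param_inj x k x' k' : enc_param x k = enc_param x' k' -> x = x' /\ k = k'.
Proof.
move=> e; have := num_cat_enc k x 0; rewrite -/(enc_param x k) e num_cat_enc => kE.
by split=> //; move: e; rewrite /enc_param kE => /eqP; rewrite eqseq_cat // eqxx => /eqP.
Qed.

(** * The inclusion of FPT in W[1] *)

Section FPTinW1.
Variable A : finType.

Fixpoint push_bits (l : seq bool) : cmd A :=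
  if l is b :: l' then Seq (push_bits l') (Push 0 (inl b)) else Skip A.

Lemma runs_push_bits l (s : st A) : s 0 = [::] ->
  runs (push_bits l) s (3 * size l).+1 (upd s 0 [seq inl b | b <- l]).
Proof.
move=> s0; elim: l => [|b l IH] /=.
  by have := upd_id s 0; rewrite s0 => ->; exact: runs_skip.
have := runs_seq IH (runs_push 0 (inl b) _); rewrite upd_same upd_upd => h.
by apply: runs_le h; lia.
Qed.
End FPTinW1.

(** One input wired to the output: satisfiable with exactly one true input but not with none, so the
    parameter can carry the answer to an instance that is already decided. *)
Definition wire : circuit := Circuit 1 [::] 0.

Lemma WCS_wire (b : bool) : WCS 1 1 (enc_circuit wire) b <-> b.
Proof.
split=> [[C [_ _ _ eC [a [cnt va]]]]|bT].
  have [_ h1 _] := parse_enc (erefl (enc_nat 0 ++ enc_circuit wire)).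
  have [_ h2 _] := parse_enc (f_equal (cat (enc_nat 0)) eC).
  have eC' : C = wire by rewrite -h1 -h2.
  move: a cnt va; rewrite eC' => -[[|z [|z' l]] sa] //= cnt va.
  have {}va : z by [].
  by move: cnt; rewrite va; case: (b).
exists wire; split => //.
by exists [tuple true]; rewrite bT.
Qed.

Lemma computable_mulS W f : computable f -> computable (fun k => W * (f k).+1).
Proof.
move=> /computableE[M [time hM]].
apply: (@computable_of_pt (tm_code M) (fun k => k + time k)).
have pid : pt (tm_code M) (fun _ : nat => [::]) (fun k => k + time k) [:: id] id.
  apply: (@pt_var _ _ _ _ _ 0) => //.
  by apply: pbd_le (pbd_size _) => t /=; exact: leq_addr.
apply: pt_mul; first exact: pt_const.
apply: pt_succ; apply: (pt_call (e := fun z => z) _ hM) => //.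
by apply: pbd_le (pbd_size _) => t; lia.
Qed.

(** The inequality of FPT and W[1] is refuted by proving both inclusions; in this one the instance
    is decided and replaced by [wire]. *)
Lemma FPT_W1 L : FPT L -> W 1 L.
Proof.
move=> [M [f [d [cf hM]]]]; exists 1; split => //.
pose A := tm_code M.
pose w b := enc_param (enc_circuit wire) (nat_of_bool b).
pose ans := Case 0 (fun g : option (bool + A) => Seq (clear A 0)
   (push_bits A (w (if g is Some (inl true) then true else false)))).
pose K := 4 * call_cost M + 3 * (size (w true) + size (w false)) + 20.
exists (compile (Seq (call (A := A) id 0) ans)), (fun k => K * (f k).+1), (fun=> 1), d.+1; split.
- exact: computable_mulS.
- by apply: (@computable_of_pt unit id); exact: pt_const.
move=> x k; have [b [cw hb]] := hM x k.
exists (enc_circuit wire), b; split; [|exact: leq_b1|exact: iff_trans (iff_sym hb) (iff_sym (WCS_wire b))].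
set z := enc_param x k in cw *.
have e_inj : injective (id : tm_code M -> A) by [].
have sz (i : nat) : 0 < i -> init_st A z i = [::] by case: i.
have /(_ erefl sz)[h1 _] := callP e_inj cw (b := 0) (s := init_st A z).
set s1 := upd _ _ _ in h1.
have s10 : s1 0 = [:: inl b] by rewrite /s1 upd_same.
have h2 := runs_clear 0 s1; set s2 := upd _ _ _ in h2.
have h3 := runs_push_bits (w b) (s := s2) (upd_same _ _ _).
have h4 : runs ans s1 (3 + (3 * size (w b)).+1).+2 (upd s2 0 [seq inl b | b <- w b]).
  apply: runs_case; rewrite s10 /= (_ : (if b then true else false) = b); last by case: (b).
  by rewrite s10 in h2; exact: runs_seq h2 h3.
have [t tle rn] := runs_seq h1 h4.
suff le : t <= K * (f k).+1 * size z ^ d.+1.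
  by have := compileP rn le; rewrite /s2 !upd_same lead_inl.
apply: leq_trans tle _.
have z0 : 0 < size z by rewrite /z /enc_param size_cat size_rcons.
have : size (w b) <= size (w true) + size (w false) by case: (b); lia.
have : 0 < size z ^ d by rewrite expn_gt0 z0.
rewrite /K expnS; move: (size z) (size z ^ d) (call_cost M) (size (w b)) (size (w true) + size (w false)) z0 => p q c u v p0 q0 uv.
have h : (f k * q + p).+1 <= 3 * ((f k).+1 * (p * q)) by nia.
have : c * (f k * q + p).+1 <= c * (3 * ((f k).+1 * (p * q))) by rewrite leq_mul2l h orbT.
nia.
Qed.

(** * From a gap algorithm to the inclusion of W[1] in FPT *)

Section W1inFPT.
Variables (c : nat) (M : TM) (f : nat -> nat) (e : nat).
Hypotheses (c0 : 0 < c) (cf : computable f).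
Hypothesis dist : forall (n : nat) (G : graph 'I_n) (k : nat), 0 < n -> 0 < k ->
  exists (t : nat) (y : seq bool), [/\ t <= f k * n ^ e,
    computes_within M t (enc_graph_param G k) y,
    tree_alpha G <= k -> y = [:: true] & c * k < tree_alpha G -> y = [:: false]].
Variables (d : nat) (L : param_problem) (R : TM) (fR gR : nat -> nat) (dR : nat).
Hypotheses (cfR : computable fR) (cgR : computable gR).
Hypothesis hR : forall x k, exists (x' : seq bool) (k' : nat),
  [/\ computes_within R (fR k * size (enc_param x k) ^ dR) (enc_param x k) (enc_param x' k'),
    k' <= gR k & (L x k <-> WCS 1 d x' k')].

Let r := (4 * arity d + 3) * c.
Let A : finType := (tm_code R + tm_code M)%type.

Definition gap_string (y : seq bool) : seq bool :=
  mkseq (graph_bit (ncopy d r y * 2) (no_val d r y) (dbl (relA d r y)))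
    ((no_val d r y).+1 + ((ncopy d r y * 2).+1 + ncopy d r y * 2 * (ncopy d r y * 2))).

Lemma gap_stringE y : gap_string y = enc_graph_param (dblG (ncopy d r y) (relA_sym d r y)) (no_val d r y).
Proof. by rewrite (@enc_graph_mkseq _ _ _ (dbl (relA d r y))). Qed.

(** The number [num y 0] is the parameter of the reduced instance, so bounds polynomial in this
    measure are fixed-parameter bounds. *)
Definition sizeA (y : seq bool) := size y + 2 ^ num y 0.

Lemma emits_gap : emits A id sizeA [::] gap_string.
Proof.
have hX : pbd sizeA size by apply: pbd_le (pbd_size _) => y; exact: leq_addr.
have hk : pbd sizeA (fun y => 2 ^ num y 0) by apply: pbd_le (pbd_size _) => y; exact: leq_addl.
apply: (@emit_graph A _ _ _ _ (fun y => ncopy d r y * 2) (fun y => no_val d r y) (fun y => dbl (relA d r y))).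
- by apply: pt_mul; [apply: pt_ncopy|exact: pt_const].
- exact: pt_no_val.
- by move=> a b ha hb; apply: (@pt_adjA A d r _ (eX id)) => //; [exact: pbd_sizeX|exact: pbd_pow2X].
Qed.

(** By [yes_no_gap] every instance falls on one side of the gap. The answer is negated: large
    tree-alpha, rejected by the algorithm, means a large clique and hence satisfiability. *)
Lemma gap_answer y x' k' z : y = enc_param x' k' ->
  (tree_alpha (dblG (ncopy d r y) (relA_sym d r y)) <= no_val d r y -> z = [:: true]) ->
  (c * no_val d r y < tree_alpha (dblG (ncopy d r y) (relA_sym d r y)) -> z = [:: false]) ->
  ((if z is false :: _ then true else false) = true) <-> WCS 1 d x' k'.
Proof.
move=> yE zt zf; split.
  move=> za; have /relA_no[vy [a sza [cnt va]]] : no_val d r y < tree_alpha (dblG (ncopy d r y) (relA_sym d r y)).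
    by rewrite ltnNge; apply/negP => /zt zE; rewrite zE in za.
  have /and3P[ok wf dwo] := vy.
  have [ex ek] : x' = enc_circuit (circ y) /\ k' = num y 0.
    by apply: enc_param_inj; rewrite -yE; exact: parse_okP.
  have wfC := wfbP _ wf.
  have olt : outp y < ntot y by have [] := wfC; rewrite /= size_map size_iota.
  have := dwo; rewrite dw_depth_weft // => /andP[dle wle].
  exists (circ y); split => //.
  by exists (Tuple (introT eqP sza)); rewrite ek.
move=> [C [wfC wle dle ex [a [cnt va]]]].
rewrite ex in yE; have [ek eC ok] := parse_enc yE.
subst C.
have vy : valid d y.
  have wfy : wfb y by exact/wfbP.
  apply/and3P; split => //.
  have olt : outp y < ntot y by have [] := wfC; rewrite /= size_map size_iota.
  by rewrite dw_depth_weft // dle wle.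
have := relA_yes r vy (size_tuple a); rewrite cnt ek => /(_ erefl va) le.
by rewrite zf //; apply: leq_trans le; apply: yes_no_gap.
Qed.

Definition no_val_of (i : nat) := ((2 ^ (i + 3)) ^ arity d - (2 ^ (i + 3)) ^ arity d %/ (2 * arity d + 2)) ^ r.
(** The reduced parameter is only known to be at most [gR k], and [f] may fail to be monotone;
    summing over all candidates gives a computable bound. The [minn] is inert within the range of
    the sum and keeps the summand bounded for every index. *)
Definition gap_time (k : nat) := \sum_(i < (gR k).+1) f (no_val_of (minn i (gR k))).
Definition fpt_bound (W k : nat) := W * (gap_time k).+1 * (W + 2 * fR k + 2 ^ gR k) ^ W.

Lemma computable_fpt_bound W : computable (fpt_bound W).
Proof.
have [Mf [tf hf]] := computableE cf.
have [MR [tR hMR]] := computableE cfR.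
have [Mg [tg hMg]] := computableE cgR.
pose A' : finType := (tm_code Mf + (tm_code MR + tm_code Mg))%type.
(* The measure collects the running times of all calls, including those for every summand of
   [gap_time]. *)
pose S k := k + (tR k + tg k) + 2 ^ (gR k + 3) + \sum_(i < (gR k).+1) tf (no_val_of i).
apply: (@computable_of_pt A' S).
have bS (h : nat -> nat) : (forall k, h k <= S k) -> pbd S h.
  by move=> le; apply: pbd_le (pbd_size _).
have pid : pt A' (fun _ : nat => [::]) S [:: id] id.
  by apply: (@pt_var _ _ _ _ _ 0) => //; apply: bS => k /=; rewrite /S; lia.
have pR : pt A' (fun _ : nat => [::]) S [:: id] fR.
  apply: (pt_call (e := inr \o inl) _ hMR pid); first by move=> p q [].
  by apply: bS => k; rewrite /S; lia.
have pg : pt A' (fun _ : nat => [::]) S [:: id] gR.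
  apply: (pt_call (e := inr \o inr) _ hMg pid); first by move=> p q [].
  by apply: bS => k; rewrite /S; lia.
have p2g : pbd S (fun k => 2 ^ (gR k + 3)) by apply: bS => k; rewrite /S; lia.
apply: pt_mul.
  apply: pt_mul; first exact: pt_const.
  apply: pt_succ; apply: (pt_sum (g := fun k i => f (no_val_of (minn i (gR k))))); first exact: pt_succ.
  apply: (pt_call (e := inl) _ hf (a := fun p => no_val_of (minn p.2 (gR p.1)))); first by move=> p q [].
    have pp : pt A' (eX (fun _ : nat => [::])) (eS S) (eB [:: id]) (fun p => 2 ^ (minn p.2 (gR p.1) + 3)).
      apply: pt_pow2.
        by apply: pt_add; [apply: pt_minn; [exact: pt_var0|exact: (pt_weak pg)]|exact: pt_const].
      apply: pbd_le (pbd_weak p2g) => p.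
      by rewrite leq_exp2l // leq_add2r geq_minr.
    apply: pt_exp; apply: pt_sub; first exact: pt_exp.
    by apply: pt_divn; [exact: pt_exp|exact: pt_const].
  apply: pbd_le (pbd_weak (pbd_size S)) => p.
  have lt : minn p.2 (gR p.1) < (gR p.1).+1 by rewrite ltnS geq_minr.
  rewrite /S (bigD1 (Ordinal lt)) //= [tf _ + _]addnC addnA; exact: leq_addl.
apply: pt_exp; apply: pt_add; last first.
  by apply: pt_pow2 => //; apply: bS => k; rewrite /S expnD; move: (2 ^ gR k) => q; lia.
by apply: pt_add; [exact: pt_const|apply: pt_mul => //; exact: pt_const].
Qed.

(** After the reduction, everything is polynomial in [sizeA] of the reduced string except the factor
    [gap_time k]. *)
Lemma W1_FPT : FPT L.
Proof.
have eM_inj : injective (inr : tm_code M -> A) by move=> p q [].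
have eR_inj : injective (inl : tm_code R -> A) by move=> p q [].
have [cM [tau [btau hM]]] := decider eM_inj emits_gap.
have hX : pbd sizeA size by apply: pbd_le (pbd_size _) => y; exact: leq_addr.
have hk : pbd sizeA (fun y => 2 ^ num y 0) by apply: pbd_le (pbd_size _) => y; exact: leq_addl.
have bn : pbd sizeA (fun y => (ncopy d r y * 2) ^ e).
  by apply: pbd_exp; apply: pbd_mul; [exact: (pt_pbd (pt_ncopy A d r [::] hX hk))|exact: pbd_const].
have by_ : pbd sizeA (fun y => size (gap_string y)) by have [E [tau' []]] := emits_gap.
have [D hD] := pbd_add (pbd_add btau by_) (pbd_add bn hX).
pose K := call_cost R + call_cost M + 50.
pose W := 10 * K + D + 3.
exists (compile (Seq (call inl 0) (cM [::]))), (fpt_bound W), (dR.+1 * D.+1).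
split; first exact: computable_fpt_bound.
move=> x k; have [x' [k' [cw k'le hL]]] := hR x k.
set x0 := enc_param x k in cw *; set y := enc_param x' k' in cw.
have [t [z [tle cz zt zf]]] := dist (dblG (ncopy d r y) (relA_sym d r y)) (k := no_val d r y) ltac:(by rewrite muln_gt0 /ncopy expn_gt0 nbase_gt0) (no_val_gt0 d r y).
have sz (i : nat) : 0 < i -> init_st A x0 i = [::] by case: i.
have /(_ erefl sz)[h1 szy] := callP eR_inj cw (b := 0) (s := init_st A x0).
set s1 := upd _ _ _ in h1.
have s10 : s1 0 = [seq inl b | b <- y] by rewrite /s1 upd_same.
have s1z i : 0 < i -> s1 i = [::] by move=> i0; rewrite /s1 upd_other ?sz //; lia.
rewrite -gap_stringE in cz.
have [s2 h2 s20] := hM [::] y s1 t z s10 s1z erefl cz.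
exists (if z is false :: _ then true else false); split; last first.
  exact: iff_trans (@gap_answer y x' k' z erefl zt zf) (iff_sym hL).
have [T Tle rn] := runs_seq h1 h2.
suff le : T <= fpt_bound W k * size x0 ^ (dR.+1 * D.+1).
  by have := compileP rn le; rewrite s20.
apply: leq_trans Tle _ => {rn h1 h2 s20 hM hL zt zf cz cw}.
have x00 : 0 < size x0 by rewrite /x0 /enc_param size_cat size_rcons.
have num_y : num y 0 = k' by rewrite /y /enc_param num_cat_enc.
have tF : t <= gap_time k * (ncopy d r y * 2) ^ e.
  apply: leq_trans tle _; rewrite leq_mul2r; apply/orP; right.
  have lt : k' < (gR k).+1 by [].
  rewrite /gap_time (bigD1 (Ordinal lt)) //= (minn_idPl k'le).
  by apply: leq_trans (leq_addr _ _); rewrite /no_val /kap num_y.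
have yS : sizeA y + 2 <= (W + 2 * fR k + 2 ^ gR k) * size x0 ^ dR.+1.
  rewrite /sizeA num_y; have : 2 ^ k' <= 2 ^ gR k by rewrite leq_exp2l.
  move: szy; rewrite expnS; have : 0 < size x0 ^ dR by rewrite expn_gt0 x00.
  have : 3 <= W by rewrite /W; lia.
  move: (2 ^ k') (2 ^ gR k) (size x0 ^ dR) => p q u W3 u0 sy pq.
  have uZ : u <= size x0 * u by rewrite leq_pmull.
  have xZ : size x0 <= size x0 * u by rewrite leq_pmulr.
  move: (size x0 * u) uZ xZ => Z uZ xZ.
  have h3 : 3 * Z <= W * Z by rewrite leq_mul2r W3 orbT.
  have h4 : fR k * u <= fR k * Z by rewrite leq_mul2l uZ orbT.
  have h5 : q <= q * Z by rewrite leq_pmulr //; lia.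
  by rewrite !mulnDl -mulnA; lia.
have hDy := hD y.
have le1 : (sizeA y + 2) ^ D <= ((W + 2 * fR k + 2 ^ gR k) * size x0 ^ dR.+1) ^ D.
  by case: (D) => // D'; rewrite leq_exp2r.
have xR : fR k * size x0 ^ dR + size x0 + 1 <= (W + 2 * fR k + 2 ^ gR k) * size x0 ^ dR.+1.
  rewrite expnS; have : 0 < size x0 ^ dR by rewrite expn_gt0 x00.
  have : 3 <= W by rewrite /W; lia.
  move: (2 ^ gR k) (size x0 ^ dR) => q u W3 u0.
  have uZ : u <= size x0 * u by rewrite leq_pmull.
  have xZ : size x0 <= size x0 * u by rewrite leq_pmulr.
  move: (size x0 * u) uZ xZ => Z uZ xZ.
  have h3 : 3 * Z <= W * Z by rewrite leq_mul2r W3 orbT.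
  have h4 : fR k * u <= fR k * Z by rewrite leq_mul2l uZ orbT.
  by rewrite !mulnDl -mulnA; lia.
set P := (W + 2 * fR k + 2 ^ gR k) * size x0 ^ dR.+1 in yS le1 xR.
have P0 : 0 < P by lia.
have fin : W * (gap_time k).+1 * P ^ D.+1 <= fpt_bound W k * size x0 ^ (dR.+1 * D.+1).
  rewrite /fpt_bound /P expnMn -expnM mulnA leq_mul2r leq_mul2l; apply/orP; right; apply/orP; right.
  by rewrite leq_exp2l; [|lia]; rewrite /W; lia.
apply: leq_trans fin.
have WK : 10 * K <= W by rewrite /W -addnA leq_addr.
have K50 : 50 <= K by rewrite /K leq_addl.
have KR : call_cost R <= K by rewrite /K -addnA leq_addr.
have gen a b : b + 4 <= a + b + 50 by lia.
have KM : call_cost M + 4 <= K by exact: gen.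
clearbody W; clearbody K.
move: (call_cost R) (call_cost M) KR KM => cR cM' KR KM.
have : 0 < P ^ D by rewrite expn_gt0 P0.
rewrite expnS; move: (P ^ D) le1 => PD le1 PD0.
have h0 : tau y + size (gap_string y) + ((ncopy d r y * 2) ^ e + size y) <= PD := leq_trans hDy le1.
move: (size (gap_string y)) h0 => gs h0.
move: (gap_time k) tF => F tF.
have tF' : t <= F * PD by apply: leq_trans tF _; rewrite leq_mul2l; apply/orP; right; lia.
have e1 : cR * (fR k * size x0 ^ dR + size x0).+1 <= K * P by apply: leq_mul => //; lia.
have e2 : (cM' + 4) * (t + gs).+1 <= K * (F * PD + 2 * PD) by apply: leq_mul => //; lia.
apply: leq_trans (_ : 10 * K * F.+1 * (P * PD) <= _); last exact: leq_mul (leq_mul WK (leqnn _)) (leqnn _).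
have PPD : P <= P * PD /\ PD <= P * PD by split; [exact: leq_pmulr|exact: leq_pmull].
move: PPD; move: (P * PD) => Z [PZ DZ].
have e3 : K * P <= K * Z by rewrite leq_mul2l PZ orbT.
have e4 : K * (F * PD + 2 * PD) <= K * (F * Z + 2 * Z) by rewrite leq_mul2l leq_add ?orbT // leq_mul2l ?DZ ?orbT.
have Z1 : 0 < Z by lia.
have e5 : K <= K * Z by rewrite leq_pmulr.
rewrite /=; have e6 : Z <= K * Z by rewrite leq_pmull //; lia.
have -> : 10 * K * F.+1 * Z = 10 * (K * Z) + 10 * (K * (F * Z)) by nia.
have e7 : K * (F * Z + 2 * Z) = K * (F * Z) + 2 * (K * Z) by nia.
lia.
Qed.

End W1inFPT.

(** * The graphs of part (b) *)

Lemma big_block (N m : nat) (F : nat -> nat) :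
  \sum_(p < N * m) F p = \sum_(p < N) \sum_(b < m) F (p * m + b).
Proof.
elim: N => [|N IH]; first by rewrite mul0n !big_ord0.
rewrite mulSnr big_split_ord /= IH [in RHS]big_ord_recr /=; congr (_ + _).
Qed.

Lemma nth_flatten_const (T : Type) (x0 : T) w (ss : seq (seq T)) p l :
  all (fun s => size s == w) ss -> l < w -> nth x0 (flatten ss) (w * p + l) = nth x0 (nth [::] ss p) l.
Proof.
move=> + lw; elim: ss p => [|s ss IH] p /=; first by rewrite !nth_nil.
move=> /andP[/eqP sw als]; case: p => [|p] /=; first by rewrite muln0 nth_cat sw lw.
by rewrite nth_cat sw ltnNge mulnS -addnA leq_addr /= addKn IH.
Qed.

Lemma expn_half m c : 0 < m -> 2 ^ c * m ^ (c * m.+1) <= m.+1 ^ (c * m.+1).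
Proof.
move=> m0; rewrite mulnC [c * _]mulnC !expnM -expnMn; case: c => // c.
rewrite leq_exp2r //; apply: leq_trans (bernoulli m m.+1).
by rewrite muln2 -addnn leq_add2l /= expnS leq_mul2r ltnW ?orbT.
Qed.

Section Uncovered.
Variable t : nat.
Hypothesis t0 : 0 < t.

(** Over full periods of [t ^ q] the digits are independent and uniform, and each sample in [U]
    forbids one of the [t] values of its digit. *)
Lemma sum_avoid q h (U : nat -> bool) :
  \sum_(p < h * t ^ q) all (fun i => U i ==> ((p %/ t ^ i) %% t != 0)) (iota 0 q) =
  h * \prod_(i < q) (t - U i).
Proof.
elim: q U => [|q IH] U.
  by rewrite big_ord0 /= sum1_card card_ord expn0.
rewrite expnSr mulnA (big_block _ _ (fun p => nat_of_bool (all (fun i => U i ==> ((p %/ t ^ i) %% t != 0)) (iota 0 q.+1)))).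
rewrite [in RHS]big_ord_recl /=.
transitivity (\sum_(p < h * t ^ q) (all (fun i => U i.+1 ==> ((p %/ t ^ i) %% t != 0)) (iota 0 q) * (t - U 0))).
  apply: eq_bigr => p _.
  transitivity (\sum_(b < t) (all (fun i => U i.+1 ==> ((p %/ t ^ i) %% t != 0)) (iota 0 q) * (U 0 ==> (b != 0 :> nat)))).
    apply: eq_bigr => b _; rewrite expn0 divn1 modnMDl modn_small // mulnb [_ && (U 0 ==> _)]andbC.
    congr (nat_of_bool (_ && _)); rewrite -[1]addn0 iotaDl all_map; apply: eq_all => i /=.
    by rewrite add1n expnS divnMA divnMDl // (divn_small (ltn_ord b)) addn0.
  rewrite -big_distrr /=; congr (_ * _).
  case: (U 0); last by rewrite sum1_card card_ord subn0.
  by case: (t) t0 => // t' _; rewrite big_ord_recl /= sum1_card card_ord subn1.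
by rewrite -big_distrl /= (IH (fun i => U i.+1)) -mulnA; congr (_ * _); exact: mulnC.
Qed.

Lemma prod_avoid q (U : nat -> bool) :
  \prod_(i < q) (t - U i) * t ^ (\sum_(i < q) U i) = t.-1 ^ (\sum_(i < q) U i) * t ^ q.
Proof.
elim: q => [|q IH]; first by rewrite !big_ord0 !expn0.
rewrite !big_ord_recr /= !expnD mulnACA IH.
have -> : (t - U q) * t ^ U q = t.-1 ^ U q * t.
  by case: (U q); rewrite ?expn1 ?expn0 ?subn0 ?mul1n ?muln1 ?subn1.
by rewrite expnSr mulnACA.
Qed.

(** This is [(1 - 1/t) ^ (c * t) <= 2 ^ (-c)] without division; further samples only decrease the
    left-hand side. *)
Lemma avoid_bound q c (U : nat -> bool) : 1 < t -> c * t <= \sum_(i < q) U i ->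
  \prod_(i < q) (t - U i) * 2 ^ c <= t ^ q.
Proof.
move=> t1 le; set u := \sum_(i < q) U i in le *.
have tp : 0 < t.-1 by lia.
have tE : t.-1.+1 = t by lia.
have key : 2 ^ c * t.-1 ^ u <= t ^ u.
  rewrite -(subnKC le) !expnD mulnA; apply: leq_mul; last first.
    by case: (u - c * t) => // j; rewrite leq_exp2r // leq_pred.
  by have := expn_half c tp; rewrite tE.
have u0 : 0 < t.-1 ^ u by rewrite expn_gt0 tp.
rewrite -(leq_pmul2r u0) -mulnA; apply: leq_trans (_ : \prod_(i < q) (t - U i) * t ^ u <= _).
  by rewrite leq_mul2l key orbT.
by rewrite prod_avoid mulnC.
Qed.
End Uncovered.

Section GapB.
Variables (x : seq bool) (t q : nat).
Definition nclause := num x 1.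
Definition cvar (p l : nat) := num x (2 + 2 * (3 * p + l)).
Definition csgn (p l : nat) : bool := num x (2 + (2 * (3 * p + l) + 1)) == 1.
Definition csat (a : nat -> bool) (p : nat) : bool :=
  has (fun l => a (cvar p l) == csgn p l) (iota 0 3).

(* The clauses are repeated cyclically, so that there are more than [t ^ q] of
   them; the [i]-th sample consists of those whose index has base-[t] digit
   [i] equal to 0. *)
Definition nvirt := nclause * (t ^ q %/ nclause).+1.
Definition block := nvirt %/ t + t ^ q.
Definition sampled (i p : nat) : bool := (p %/ t ^ i) %% t == 0.
(** Deleting the digit [i], which is 0, numbers the sample without gaps, so about [nvirt / t]
    clauses have to be guessed. *)
Definition rank_in (i p : nat) := p %/ t ^ i.+1 * t ^ i + p %% t ^ i.
(* The vertex [v] belongs to sample [v %% q], and the bits of [v %/ q] are the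
   guessed values of the literals of the clauses in the sample. *)
Definition guess (v p l : nat) : bool := dig 2 (v %/ q) (3 * rank_in (v %% q) p + l) == 1.
Definition okv (v : nat) : bool := all (fun p => sampled (v %% q) p ==>
  has (fun l => guess v p l == csgn (p %% nclause) l) (iota 0 3)) (iota 0 nvirt).
Definition consv (v w : nat) : bool := all (fun p => sampled (v %% q) p ==>
  all (fun p' => sampled (w %% q) p' ==>
    all (fun l => all (fun l' => (cvar (p %% nclause) l == cvar (p' %% nclause) l') ==>
      (guess v p l == guess w p' l')) (iota 0 3)) (iota 0 3)) (iota 0 nvirt)) (iota 0 nvirt).
(** The last condition allows one vertex per sample, so the size of a clique is the number of
    samples that it meets. *)
Definition relB0 (v w : nat) : bool := [&& okv v, consv v w & (v %% q == w %% q) ==> (v == w)].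
Definition relB (v w : nat) : bool := [&& relB0 v w && relB0 w v, relB0 v v & relB0 w w].
Definition ncopyB := q * 2 ^ (3 * block).

Lemma relB_sym : symmetric relB.
Proof. by move=> v w; rewrite /relB [relB0 v w && _]andbC [relB0 v v && _]andbC. Qed.

Hypotheses (t1 : 1 < t) (q0 : 0 < q).
Let tgt0 : 0 < t := ltnW t1.
Let tp i : 0 < t ^ i. Proof. by rewrite expn_gt0 tgt0. Qed.

Lemma rank_lt i p : i < q -> p < nvirt -> rank_in i p < block.
Proof.
move=> iq pn; rewrite /rank_in /block; apply: leq_trans (_ : p %/ t + t ^ i.+1 <= _); last first.
  apply: leq_add; first by apply: leq_div2r; apply: ltnW.
  by rewrite leq_exp2l.
apply: leq_trans (_ : p %/ t + t ^ i <= _); last by rewrite leq_add2l leq_exp2l.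
by rewrite -addnS leq_add // ?ltn_pmod // expnS divnMA leq_trunc_div.
Qed.

Definition unrank (i r : nat) := r %/ t ^ i * t ^ i.+1 + r %% t ^ i.

Lemma rankK i p : sampled i p -> unrank i (rank_in i p) = p.
Proof.
move=> /eqP sp; rewrite /unrank /rank_in divnMDl // modnMDl modn_mod (@divn_small (p %% _)) ?ltn_pmod // addn0.
rewrite [in RHS](divn_eq p (t ^ i)) [in RHS](divn_eq (p %/ t ^ i) t) sp addn0 -divnMA -expnSr.
by rewrite -mulnA -expnS.
Qed.

Lemma relB_yes (a : nat -> bool) : (forall p, p < nclause -> csat a p) ->
  q <= tree_alpha (dblG ncopyB relB_sym).
Proof.
move=> sat.
have /choice[s hs] : forall i, exists s, s < 2 ^ (3 * block) /\
    forall j, j < 3 * block -> dig 2 s j = a (cvar (unrank i (j %/ 3) %% nclause) (j %% 3)).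
  move=> i; have [|s s1 s2] := @dig_exists 2 (3 * block) (fun j => nat_of_bool (a (cvar (unrank i (j %/ 3) %% nclause) (j %% 3)))) ; first by move=> j _; case: (a _).
  by exists s.
have lt (i : 'I_q) : s i * q + i < ncopyB.
  have [sl _] := hs i; rewrite /ncopyB [q * 2 ^ _]mulnC; apply: leq_trans (_ : (s i).+1 * q <= _).
    by rewrite mulSnr -addnS leq_add2l.
  by rewrite leq_mul2r sl orbT.
pose f i : 'I_ncopyB := Ordinal (lt i).
have fm (i : 'I_q) : f i %% q = i by rewrite /= modnMDl modn_small.
have fd (i : 'I_q) : f i %/ q = s i by rewrite /= divnMDl // divn_small // addn0.
have gE (i : 'I_q) p l : p < nvirt -> sampled i p -> l < 3 -> guess (f i) p l = a (cvar (p %% nclause) l).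
  move=> pn sp l3; rewrite /guess fm fd; have [_ ->] := hs i; last first.
    have := rank_lt (ltn_ord i) pn; move: (rank_in i p) block => r b; lia.
  rewrite mulnC divnMDl // modnMDl (divn_small l3) (modn_small l3) addn0 rankK //.
  by case: (a _).
have ncl p : p < nvirt -> p %% nclause < nclause.
  by move=> pn; rewrite ltn_pmod //; move: pn; rewrite /nvirt; case: nclause.
have ok i : okv (f i).
  apply/allP => p; rewrite mem_iota fm => pn; apply/implyP => sp.
  have /seq.hasP[l l3 e] := sat _ (ncl p pn).
  by apply/seq.hasP; exists l => //; rewrite gE //; move: l3; rewrite mem_iota.
have cons i j : consv (f i) (f j).
  apply/allP => p; rewrite mem_iota => pn; apply/implyP; rewrite fm => sp.
  apply/allP => p'; rewrite mem_iota => pn'; apply/implyP; rewrite fm => sp'.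
  apply/allP => l; rewrite mem_iota => /andP[_ l3]; apply/allP => l'; rewrite mem_iota => /andP[_ l3'].
  by apply/implyP => /eqP e; rewrite (gE i p l) // (gE j p' l') // e.
have rel i j : relB0 (f i) (f j).
  rewrite /relB0 ok cons !fm; apply/and3P; split=> //; apply/implyP => /eqP e.
  by have -> : i = j by apply: val_inj.
have finj : injective f by move=> i j e; apply: val_inj; rewrite -[LHS]fm -[RHS]fm e.
have <- : #|[set f i | i : 'I_q]| = q by rewrite card_imset // card_ord.
apply: tree_alpha_dbl_ge => _ _ /imsetP[i _ ->] /imsetP[j _ ->] _.
by rewrite /relB !rel.
Qed.

(** The guesses in a clique agree, so they define an assignment satisfying all clauses in more than
    [k] samples; the violated clauses avoid these samples. The factor 2 comes from completing the
    last period of [t ^ q]. *)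
Lemma relB_no k c : 0 < k -> c * t <= k -> k < tree_alpha (dblG ncopyB relB_sym) ->
  exists a : nat -> bool, (\sum_(p < nclause) ~~ csat a p) * 2 ^ c <= 2 * nclause.
Proof.
move=> k0 ctk klt.
have [|A cA hA] := @tree_alpha_dbl_gt ncopyB relB relB_sym k; first by rewrite k0.
have hA' : {in A &, forall v w : 'I_ncopyB, relB0 v w}.
  move=> v w vA wA; case: (eqVneq v w) => [<-|ne]; last by case/and3P: (hA v w vA wA ne) => /andP[].
  have [w' w'A ne] : exists2 w', w' \in A & v != w'.
    apply/exists_inP; rewrite -[[exists _ in _, _]]negbK negb_exists_in; apply/negP => /forall_inP h.
    have : A \subset [set v] by apply/fintype.subsetP => w' /h; rewrite negbK inE eq_sym.
    by move/subset_leq_card; rewrite cards1 leqNgt => /negP[]; apply: leq_ltn_trans cA.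
  by case/and3P: (hA v w' vA w'A ne).
(* Variables that no vertex guesses are false. *)
pose a y := [exists v in A, has (fun p => sampled (v %% q) p && has (fun l => (cvar (p %% nclause) l == y) && guess v p l) (iota 0 3)) (iota 0 nvirt)].
have aE v p l : v \in A -> p < nvirt -> sampled (v %% q) p -> l < 3 -> a (cvar (p %% nclause) l) = guess v p l.
  move=> vA pn sp l3; apply/exists_inP/idP => [[w wA /seq.hasP[p' p'n /andP[sp' /seq.hasP[l' l3' /andP[/eqP e gw]]]]]|gv].
    have /and3P[_ /allP/(_ p' p'n)/implyP/(_ sp')/allP/(_ p) c1 _] := hA' w v wA vA.
    have pi : p \in iota 0 nvirt by rewrite mem_iota.
    have /allP/(_ l' l3')/allP/(_ l) c2 := implyP (c1 pi) sp.
    have li : l \in iota 0 3 by rewrite mem_iota.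
    by have := c2 li; rewrite e eqxx => /eqP <-.
  exists v => //; apply/seq.hasP; exists p; rewrite ?mem_iota // sp.
  by apply/seq.hasP; exists l; rewrite ?mem_iota // eqxx.
have asat v p : v \in A -> p < nvirt -> sampled (v %% q) p -> csat a (p %% nclause).
  move=> vA pn sp; have /and3P[/allP/(_ p) c1 _ _] := hA' v v vA vA.
  have pi : p \in iota 0 nvirt by rewrite mem_iota.
  have /seq.hasP[l l3 e] := implyP (c1 pi) sp.
  apply/seq.hasP; exists l => //; rewrite (aE v) //.
  by move: l3; rewrite mem_iota.
pose U i := [exists v in A, v %% q == i].
have cU : k < \sum_(i < q) U i.
  apply: leq_trans cA _.
  have mq (v : 'I_ncopyB) : v %% q < q by rewrite ltn_pmod.
  pose h (v : 'I_ncopyB) : 'I_q := Ordinal (mq v).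
  have <- : #|[set h v | v in A]| = #|A|.
    apply: card_in_imset => v w vA wA /(congr1 val) /= e.
    by apply: val_inj; have /and3P[_ _] := hA' v w vA wA; rewrite e eqxx => /eqP.
  rewrite -sum1_card big_mkcond /=; apply: leq_sum => i _.
  case: ifP => // /imsetP[v vA ->].
  by rewrite (_ : U _ = true) //; apply/exists_inP; exists v.
exists a; set h := (t ^ q %/ nclause).+1.
have h0 : 0 < h by [].
rewrite -(leq_pmul2l h0) mulnA.
have -> : h * \sum_(p < nclause) ~~ csat a p = \sum_(p < nvirt) ~~ csat a (p %% nclause).
  rewrite /nvirt [nclause * _]mulnC (big_block _ _ (fun p => nat_of_bool (~~ csat a (p %% nclause)))).
  rewrite [RHS](eq_bigr (fun=> \sum_(p < nclause) ~~ csat a p)) => [|b _].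
    by rewrite sum_nat_const card_ord.
  by apply: eq_bigr => p _; rewrite modnMDl modn_small.
case: (posnP nclause) => [n0|n0].
  by rewrite /nvirt n0 mul0n big_ord0.
(* Enough full periods to cover all repeated clauses; the surplus is at most one period, and [nvirt]
   is larger than that. *)
pose hh := (nvirt %/ t ^ q).+1.
apply: leq_trans (_ : (\sum_(p < hh * t ^ q) all (fun i => U i ==> ((p %/ t ^ i) %% t != 0)) (iota 0 q)) * 2 ^ c <= _).
  rewrite leq_mul2r; apply/orP; right.
  have le : nvirt <= hh * t ^ q by apply: ltnW; rewrite /hh ltn_ceil.
  rewrite -(subnKC le) big_split_ord /=; apply: leq_trans (leq_addr _ _).
  apply: leq_sum => p _; case: (boolP (csat _ _)) => //= ns.
  rewrite (_ : all _ _ = true) //; apply/allP => i _; apply/implyP => /exists_inP[v vA /eqP e].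
  by apply/negP => sp; move: ns; rewrite (asat v) // e.
rewrite sum_avoid // -mulnA; apply: leq_trans (_ : hh * t ^ q <= _).
  rewrite leq_mul2l; apply/orP; right; apply: avoid_bound => //.
  by apply: leq_trans ctk (ltnW cU).
have e : h * (2 * nclause) = nvirt + nvirt by rewrite /nvirt -/h; lia.
rewrite e /hh mulSn addnC; apply: leq_add; first exact: leq_trunc_div.
by rewrite /nvirt mulnC; apply: ltnW; rewrite ltn_ceil.
Qed.

End GapB.

(** * Clauses read off from the encoding of a formula *)

Section Cnf.
Variables (n : nat) (phi : cnf3 n).
Notation x := (enc_cnf3 phi).

Lemma num_cnf j : num x j = nth 0 [:: n, size phi & flatten [seq [:: nat_of_ord l.1; nat_of_bool l.2]
            | l <- flatten (map (@tval _ _) phi)]] j.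
Proof. exact: num_enc_nats. Qed.

Lemma nclause_cnf : nclause x = size phi. Proof. by rewrite /nclause num_cnf. Qed.

Lemma csatE (a : nat -> bool) (b : {ffun 'I_n -> bool}) (C : 3.-tuple (literal n)) p :
  (forall i : 'I_n, a i = b i) -> p < size phi ->
  csat x a p = has (fun l : literal n => b l.1 == l.2) (nth C phi p).
Proof.
move=> ab pm.
have lit j : j < 3 -> forall l0, cvar x p j = (nth l0 (nth C phi p) j).1 /\ csgn x p j = (nth l0 (nth C phi p) j).2.
  move=> j3 l0; rewrite /cvar /csgn !num_cnf /=.
  have szl : size (flatten (map (@tval _ _) phi)) = 3 * size phi.
    by elim: (phi) => //= D ps IH; rewrite size_cat IH size_tuple; lia.
  have jl : 3 * p + j < size (flatten (map (@tval _ _) phi)) by rewrite szl; lia.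
  have e : nth l0 (flatten (map (@tval _ _) phi)) (3 * p + j) = nth l0 (nth C phi p) j.
    rewrite nth_flatten_const //; last by apply/allP => _ /mapP[D _ ->]; rewrite size_tuple.
    by rewrite (nth_map C).
  rewrite -[2 * _]addn0 -addnA add0n !nth_flatten_const ?(nth_map l0) ?e //=; try by apply/allP => _ /mapP[l _ ->].
  by split=> //; case: (_.2).
case eC: (nth C phi p) lit => [[|l0 [|l1 [|l2 [|? ?]]]] sC] // lit.
have [c0 s0] := lit 0 isT l0; have [c1 s1] := lit 1 isT l0; have [c2 s2] := lit 2 isT l0.
by rewrite /csat /= c0 c1 c2 s0 s1 s2 !ab.
Qed.

Lemma satisfied_sum (a : nat -> bool) (b : {ffun 'I_n -> bool}) : (forall i : 'I_n, a i = b i) ->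
  satisfied_clauses phi b = \sum_(p < size phi) csat x a p.
Proof.
move=> ab; rewrite /satisfied_clauses -sum1_count.
case: (posnP (size phi)) => [/size0nil e|m0].
  rewrite {1}e big_nil big1 // => -[i ilt] _ /=.
  by have := ilt; rewrite {1}e.
have [C _] : exists C, C \in phi by case: (phi) m0 => // C l _; exists C; rewrite mem_head.
rewrite (big_nth C) big_mkord big_mkcond /=; apply: eq_bigr => p _.
by rewrite (csatE C ab) //; case: has.
Qed.

Lemma max_sat_full : max_sat phi = size phi -> exists a, forall p, p < nclause x -> csat x a p.
Proof.
rewrite nclause_cnf /max_sat => e.
have [b eb] : exists b, satisfied_clauses phi b = size phi.
  have [|b eb] := @eq_bigmax _ (fun b => satisfied_clauses phi b); first by apply/card_gt0P; exists [ffun=> false].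
  by exists b; rewrite -eb.
pose a y := [exists i : 'I_n, (i == y :> nat) && b i].
have ab (i : 'I_n) : a i = b i.
  by apply/existsP/idP => [[j /andP[/eqP/val_inj ->]]|bi] //; exists i; rewrite eqxx.
exists a => p pm; move: eb; rewrite (satisfied_sum ab) => eb.
apply: contraT => ns.
have : \sum_(p < size phi) csat x a p < \sum_(p < size phi) 1.
  rewrite (bigD1 (Ordinal pm)) //= (negbTE ns) add0n [X in _ < X](bigD1 (Ordinal pm)) //= add1n ltnS.
  by apply: leq_sum => i _; case: csat.
by rewrite eb sum1_card card_ord ltnn.
Qed.

Lemma max_sat_unsat a : size phi <= max_sat phi + \sum_(p < nclause x) ~~ csat x a p.
Proof.
rewrite nclause_cnf; pose b := [ffun i : 'I_n => a i].
apply: leq_trans (_ : satisfied_clauses phi b + \sum_(p < size phi) ~~ csat x a p <= _); last first.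
  by rewrite leq_add2r; apply: (@leq_bigmax _ (fun b => satisfied_clauses phi b)).
rewrite (@satisfied_sum a) => [|i]; last by rewrite ffunE.
rewrite -big_split /= -[X in X <= _]card_ord -sum1_card.
by apply: leq_sum => i _; case: csat.
Qed.

End Cnf.

(** * Computing the graphs of part (b) *)

Section GapB_PT.
Variable A : finType.

(** The two parameters are stored minus one and used through their successors, which makes them
    positive in every context. *)
Definition paramB (T : Type) (X : T -> seq bool) (S : T -> nat) (B : seq (T -> nat)) (t q : T -> nat) : Prop :=
  [/\ pbd S (fun u => size (X u)), pt A X S B t, pt A X S B q & pbd S (fun u => (t u).+1 ^ (q u).+1)].

Lemma paramB_weak (T : Type) (X : T -> seq bool) (S : T -> nat) (B : seq (T -> nat)) (t q : T -> nat) :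
  paramB X S B t q -> paramB (eX X) (eS S) (eB B) (fun p => t p.1) (fun p => q p.1).
Proof.
move=> [hX ht hq hT]; split; [exact: pbd_sizeX|exact: pt_weak|exact: pt_weak|exact: (pbd_weak hT)].
Qed.

Section Ctx.
Variables (T : Type) (X : T -> seq bool) (S : T -> nat) (B : seq (T -> nat)) (t q : T -> nat).
Hypothesis hP : paramB X S B t q.

Lemma pt_nclause : pt A X S B (fun u => nclause (X u)).
Proof. by have [hX _ _ _] := hP; apply: pt_num => //; exact: pt_const. Qed.

Lemma pt_cvar p l : pt A X S B p -> pt A X S B l -> pt A X S B (fun u => cvar (X u) (p u) (l u)).
Proof. by move=> hp hl; have [hX _ _ _] := hP; apply: pt_num => //; pt_auto. Qed.

Lemma pt_csgn p l : pt A X S B p -> pt A X S B l -> pt A X S B (fun u => nat_of_bool (csgn (X u) (p u) (l u))).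
Proof.
move=> hp hl; have [hX _ _ _] := hP; apply: pt_eqn; last exact: pt_const.
by apply: pt_num => //; pt_auto.
Qed.

Lemma pt_tq : pt A X S B (fun u => (t u).+1 ^ (q u).+1).
Proof. by have [hX ht hq hT] := hP; apply: pt_expn => //; exact: pt_succ. Qed.

Lemma pt_nvirt : pt A X S B (fun u => nvirt (X u) (t u).+1 (q u).+1).
Proof.
have hn := pt_nclause; apply: pt_mul => //; apply: pt_succ; apply: pt_divn => //; exact: pt_tq.
Qed.

Lemma pt_block : pt A X S B (fun u => block (X u) (t u).+1 (q u).+1).
Proof.
have [hX ht hq hT] := hP; apply: pt_add; last exact: pt_tq.
by apply: pt_divn; [exact: pt_nvirt|exact: pt_succ].
Qed.

Lemma pt_tpow i : pt A X S B i -> (forall u, i u <= (q u).+1) -> pt A X S B (fun u => (t u).+1 ^ i u).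
Proof.
move=> hi le; have [hX ht hq hT] := hP; apply: pt_expn => //; first exact: pt_succ.
by apply: pbd_le hT => u; rewrite leq_pexp2l.
Qed.

Lemma pt_sampled v p : pt A X S B v -> pt A X S B p ->
  pt A X S B (fun u => nat_of_bool (sampled (t u).+1 (v u %% (q u).+1) (p u))).
Proof.
move=> hv hp; have [hX ht hq hT] := hP; have hsq := pt_succ hq.
apply: pt_eqn; last exact: pt_const.
apply: pt_modn; last exact: pt_succ.
apply: pt_divn => //; apply: pt_tpow; first exact: pt_modn.
by move=> u; apply: ltnW; rewrite ltn_pmod.
Qed.

Lemma pt_guess v p l : pt A X S B v -> pt A X S B p -> pt A X S B l ->
  pt A X S B (fun u => nat_of_bool (guess (t u).+1 (q u).+1 (v u) (p u) (l u))).
Proof.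
move=> hv hp hl; have [hX ht hq hT] := hP; have hsq := pt_succ hq.
apply: pt_eqn; last exact: pt_const.
apply: pt_dig; [exact: pt_const|exact: pt_divn|].
apply: pt_add => //; apply: pt_mul; first exact: pt_const.
have h1 : pt A X S B (fun u => (t u).+1 ^ (v u %% (q u).+1)).
  by apply: pt_tpow; [exact: pt_modn|move=> u; apply: ltnW; rewrite ltn_pmod].
have h2 : pt A X S B (fun u => (t u).+1 ^ (v u %% (q u).+1).+1).
  by apply: (pt_tpow (i := fun u => (v u %% (q u).+1).+1)); [apply: pt_succ; exact: pt_modn|move=> u; rewrite ltn_pmod].
by apply: pt_add; [apply: pt_mul => //; exact: pt_divn|exact: pt_modn].
Qed.
End Ctx.

Ltac pt_f := cbv beta; lazymatch goal with
  | |- paramB _ _ _ _ _ => eassumption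
  | |- pt _ _ _ _ (fun p => nat_of_bool (guess _ _ _ _ _)) => apply: pt_guess
  | |- pt _ _ _ _ (fun p => nat_of_bool (sampled _ _ _)) => apply: pt_sampled
  | |- pt _ _ _ _ (fun p => nat_of_bool (csgn _ _ _)) => apply: pt_csgn
  | |- pt _ _ _ _ (fun p => cvar _ _ _) => apply: pt_cvar
  | |- pt _ _ _ _ (fun p => nclause _) => apply: pt_nclause
  | |- pt _ _ _ _ (fun p => nvirt _ _ _) => apply: pt_nvirt
  | |- pt _ _ _ _ (fun p => nat_of_bool (all _ (iota 0 _))) => apply: pt_all
  | |- pt _ _ _ _ (fun p => nat_of_bool (has _ (iota 0 _))) => apply: pt_has
  | |- pt _ _ _ _ (fun p => modn _ _) => apply: pt_modn
  | |- pt _ _ _ _ (fun p => nat_of_bool (eq_op (_ : bool) _)) => apply: pt_eqb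
  | |- pt _ _ _ _ (fun p => nat_of_bool (eq_op (_ : nat) _)) => apply: pt_eqn
  end.
Ltac pt_all_f := repeat first [pt_f | pt_step].

Section Ctx2.
Variables (T : Type) (X : T -> seq bool) (S : T -> nat) (B : seq (T -> nat)) (t q : T -> nat).
Hypothesis hP : paramB X S B t q.

Lemma pt_okv v : pt A X S B v -> pt A X S B (fun u => nat_of_bool (okv (X u) (t u).+1 (q u).+1 (v u))).
Proof.
move=> hv; have [hX ht hq hT] := hP; rewrite /okv.
have hP1 := paramB_weak hP; have hP2 := paramB_weak hP1.
pt_all_f.
Qed.

Lemma pt_consv v w : pt A X S B v -> pt A X S B w ->
  pt A X S B (fun u => nat_of_bool (consv (X u) (t u).+1 (q u).+1 (v u) (w u))).
Proof.
move=> hv hw; have [hX ht hq hT] := hP; rewrite /consv.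
have hP1 := paramB_weak hP; have hP2 := paramB_weak hP1.
have hP3 := paramB_weak hP2; have hP4 := paramB_weak hP3.
pt_all_f.
Qed.

Lemma pt_relB0 v w : pt A X S B v -> pt A X S B w ->
  pt A X S B (fun u => nat_of_bool (relB0 (X u) (t u).+1 (q u).+1 (v u) (w u))).
Proof.
move=> hv hw; have [hX ht hq hT] := hP; have hsq := pt_succ hq.
apply: pt_and; first exact: pt_okv.
apply: pt_and; first exact: pt_consv.
by apply: pt_imply; apply: pt_eqn => //; exact: pt_modn.
Qed.

Lemma pt_adjB v w : pt A X S B v -> pt A X S B w ->
  pt A X S B (fun u => nat_of_bool (dbl (relB (X u) (t u).+1 (q u).+1) (v u) (w u))).
Proof.
move=> hv hw; have h1 := pt_half hv; have h2 := pt_half hw.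
have o1 := pt_odd hv; have o2 := pt_odd hw.
rewrite /dbl /relB; apply: pt_or; first by apply: pt_neg; apply: pt_eqb.
apply: pt_and; first by apply: pt_neg; apply: pt_eqn.
apply: pt_neg; apply: pt_and; first by apply: pt_and; apply: pt_relB0.
by apply: pt_and; apply: pt_relB0.
Qed.
End Ctx2.

Definition ctxB : Type := (seq bool * (nat * nat * nat))%type.
(** The last summand is the number of vertices belonging to one sample. *)
Definition sizeB (u : ctxB) : nat := size u.1 + (u.2.1.1 + u.2.1.2 + u.2.2) +
  u.2.1.1.+1 ^ u.2.1.2.+1 + 2 ^ (3 * block u.1 u.2.1.1.+1 u.2.1.2.+1).
Definition consts : seq (ctxB -> nat) := [:: fun u => u.2.1.1; fun u => u.2.1.2; fun u => u.2.2].
Definition gap_stringB (u : ctxB) : seq bool :=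
  let n := ncopyB u.1 u.2.1.1.+1 u.2.1.2.+1 * 2 in
  mkseq (graph_bit n u.2.2 (dbl (relB u.1 u.2.1.1.+1 u.2.1.2.+1))) (u.2.2.+1 + (n.+1 + n * n)).

Lemma gap_stringBE u : gap_stringB u =
  enc_graph_param (dblG (ncopyB u.1 u.2.1.1.+1 u.2.1.2.+1) (relB_sym u.1 u.2.1.1.+1 u.2.1.2.+1)) u.2.2.
Proof. by rewrite (@enc_graph_mkseq _ _ _ (dbl (relB u.1 u.2.1.1.+1 u.2.1.2.+1))). Qed.

Lemma emits_gapB : emits A fst sizeB consts gap_stringB.
Proof.
have bS (f : ctxB -> nat) : (forall u, f u <= sizeB u) -> pbd sizeB f.
  by move=> le; apply: pbd_le (pbd_size _).
have pc i : i < 3 -> pt A fst sizeB consts (nth (fun=> 0) consts i).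
  move=> i3; apply: pt_var => //; apply: bS => u; rewrite /sizeB.
  by case: i i3 => [|[|[|]]] //= _; lia.
have hP : paramB fst sizeB consts (fun u : ctxB => u.2.1.1) (fun u => u.2.1.2).
  split; [|exact: (pc 0)|exact: (pc 1)|]; by apply: bS => u; rewrite /sizeB; lia.
have pn : pt A fst sizeB consts (fun u => ncopyB u.1 u.2.1.1.+1 u.2.1.2.+1).
  apply: pt_mul; first by apply: pt_succ; exact: (pc 1).
  apply: pt_pow2; last by apply: bS => u; rewrite /sizeB; lia.
  by apply: pt_mul; [exact: pt_const|exact: (pt_block hP)].
apply: (@emit_graph A _ _ _ _ (fun u : ctxB => ncopyB u.1 u.2.1.1.+1 u.2.1.2.+1 * 2) (fun u => u.2.2)
  (fun u => dbl (relB u.1 u.2.1.1.+1 u.2.1.2.+1))).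
- by apply: pt_mul => //; exact: pt_const.
- exact: (pc 2).
- by move=> f g hf hg; apply: (pt_adjB (paramB_weak hP)).
Qed.

End GapB_PT.

(** * Running time in part (b) *)

(** Factors polynomial in [n] are absorbed by powers of [2 ^ (n %/ t)], at the price of a constant
    depending on [t]. *)
Lemma lin_exp t n : 0 < t -> n.+1 <= t * 2 ^ (n %/ t).
Proof.
move=> t0; apply: leq_trans (_ : t * (n %/ t).+1 <= _); first by rewrite mulnC ltn_ceil.
by rewrite leq_mul2l ltn_expl ?orbT.
Qed.

Lemma size_cnf n (phi : cnf3 n) : size (enc_cnf3 phi) <= n + size phi + 2 + size phi * (3 * (n + 2)).
Proof.
have sz s : size (enc_nats s) = sumn s + size s.
  by elim: s => //= a s IH; rewrite /enc_nats /= size_cat size_rcons size_nseq -/(enc_nats s) IH; lia.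
rewrite /enc_cnf3 sz /=.
set F := flatten _; suff : sumn F + size F <= size phi * (3 * (n + 2)) by lia.
have H (ls : seq (literal n)) : sumn (flatten [seq [:: nat_of_ord l.1; nat_of_bool l.2] | l <- ls]) +
   size (flatten [seq [:: nat_of_ord l.1; nat_of_bool l.2] | l <- ls]) <= size ls * (n + 2).
  elim: ls => //= l ls; have := ltn_ord l.1; have : l.2 <= 1 by case: l.2.
  by rewrite mulSn; lia.
apply: leq_trans (H _) _; rewrite mulnA leq_mul2r; apply/orP; right.
by elim: (phi) => //= C ps IH; rewrite size_cat size_tuple; lia.
Qed.

Section TimeB.
Variables (Bc t' q' k : nat).
Notation t := t'.+1.
Notation q := q'.+1.

Definition block_const := 3 * (Bc + 2 * t ^ q).
(** The first summand comes from the quadratic bound on the size of the formula, with [lin_exp]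
    applied to both factors. *)
Definition size_const := 12 * Bc.+1 * t * t + (t' + q' + k + t ^ q + 2) + 2 ^ block_const.

Variables (n : nat) (phi : cnf3 n).
Hypothesis sm : size phi <= Bc * n.
Notation x := (enc_cnf3 phi).
Notation w := (n %/ t).

Lemma block_bound : 3 * block x t q <= 3 * Bc * w + block_const.
Proof.
rewrite /block_const -mulnA -mulnDr leq_mul2l /= /block.
suff : nvirt x t q %/ t <= Bc * w + (Bc + t ^ q) by lia.
have nv : nvirt x t q <= t ^ q + Bc * n.
  rewrite /nvirt nclause_cnf mulnS addnC leq_add // mulnC; exact: leq_trunc_div.
have nt : n <= w.+1 * t by apply: ltnW; rewrite ltn_ceil.
rewrite -[X in _ <= X](@mulnK _ t) //; apply: leq_div2r; apply: leq_trans nv _.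
have : Bc * n <= Bc * (w.+1 * t) by rewrite leq_mul2l nt orbT.
have : t ^ q <= t ^ q * t by rewrite leq_pmulr.
by rewrite !mulnDl mulSn mulnDr; lia.
Qed.

Lemma sizeB_bound : sizeB (x, (t', q', k)) + 2 <= size_const * 2 ^ ((3 * Bc + 2) * w).
Proof.
rewrite /sizeB /=; set p := 2 ^ ((3 * Bc + 2) * w).
have p0 : 0 < p by rewrite expn_gt0.
have h1 : size x <= 12 * Bc.+1 * t * t * p.
  have e1 : n.+1 <= t * 2 ^ w by apply: lin_exp.
  apply: leq_trans (size_cnf phi) _; apply: leq_trans (_ : 12 * Bc.+1 * (n.+1 * n.+1) <= _).
    have : size phi * (3 * (n + 2)) <= Bc * n * (3 * (n + 2)) by rewrite leq_mul2r sm orbT.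
    by move: (size phi * _) => z hz; nia.
  rewrite -!mulnA !leq_mul2l /=; apply: leq_trans (leq_mul e1 e1) _.
  rewrite mulnACA -mulnA !leq_mul2l -expnD; apply/orP; right; apply/orP; right.
  by rewrite /p leq_exp2l // mulnDl mul2n -addnn leq_addl.
have h2 : 2 ^ (3 * block x t q) <= 2 ^ block_const * p.
  rewrite -expnD leq_exp2l //; apply: leq_trans block_bound _.
  by rewrite addnC leq_add2l mulnDl leq_addr.
have h3 : t' + q' + k + t ^ q + 2 <= (t' + q' + k + t ^ q + 2) * p by rewrite leq_pmulr.
by rewrite /size_const !mulnDl in h1 h2 h3 *; lia.
Qed.

Lemma ncopy_bound : ncopyB x t q * 2 <= (q * 2 ^ block_const * 2) * 2 ^ (3 * Bc * w).
Proof.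
rewrite /ncopyB [X in _ <= X]mulnAC leq_mul2r /= -mulnA leq_mul2l /= -expnD leq_exp2l //.
by rewrite addnC block_bound.
Qed.
End TimeB.

(** The order of quantifiers is the point: [e] is fixed before [t'], which later has to exceed
    [e / delta]. This works because [t'], [q'] and [k] are loaded into the registers of a program
    whose polynomial bound is uniform in them. *)
Lemma gapB_machine (M : TM) (Bc : nat) : exists e, forall t' q' k, exists (N : TM) (K : nat),
  forall n (phi : cnf3 n) time z, size phi <= Bc * n ->
    computes_within M time (gap_stringB (enc_cnf3 phi, (t', q', k))) z ->
    computes_within N (K * (2 ^ (e * (n %/ t'.+1)) + time)) (enc_cnf3 phi)
      [:: if z is false :: _ then true else false].
Proof.
have e_inj : injective (id : tm_code M -> tm_code M) by [].
have [c [tau [btau hc]]] := decider e_inj (emits_gapB (tm_code M)).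
have bY : pbd sizeB (fun u => size (gap_stringB u)) by have [E [tau' []]] := emits_gapB (tm_code M).
have bX : pbd sizeB (fun u => size u.1) by apply: pbd_le (pbd_size _) => u; rewrite /sizeB; lia.
have [d hd] := pbd_add (pbd_add btau bY) bX.
exists ((3 * Bc + 2) * d) => t' q' k.
pose cs := [:: t'; q'; k].
pose K1 := call_cost M + 4 * (sumn cs + size cs) + 30.
exists (compile (c cs)), (3 * K1 * (size_const Bc t' q' k ^ d).+1) => n phi time z sm cw.
set u := (enc_cnf3 phi, (t', q', k)) in cw.
have sz (i : nat) : 0 < i -> init_st (tm_code M) (enc_cnf3 phi) i = [::] by case: i.
have [s' h s0] := hc cs u (init_st (tm_code M) (enc_cnf3 phi)) time z erefl sz erefl cw.
have [T Tle rn] := h.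
suff le : T <= 3 * K1 * (size_const Bc t' q' k ^ d).+1 * (2 ^ ((3 * Bc + 2) * d * (n %/ t'.+1)) + time).
  by have := compileP rn le; rewrite s0.
apply: leq_trans Tle _ => {rn h hc s0 cw sz}.
have := hd u; have := sizeB_bound t' q' k sm; rewrite -/u => h1 h2.
have h3 : (sizeB u + 2) ^ d <= size_const Bc t' q' k ^ d * 2 ^ ((3 * Bc + 2) * d * (n %/ t'.+1)).
  rewrite mulnAC [2 ^ (_ * d)]expnM -expnMn; case: (d) => // d'; by rewrite leq_exp2r.
move: (size_const Bc t' q' k ^ d) (2 ^ ((3 * Bc + 2) * d * (n %/ t'.+1))) h3 (expn_gt0 2 ((3 * Bc + 2) * d * (n %/ t'.+1))) => C P h3 P0.
have {h1} h4 := leq_trans h2 h3; rewrite /= in P0.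
have K4 : call_cost M + 4 <= K1 by rewrite /K1; move: (call_cost M) (4 * _) => a b; lia.
have K5 : 4 * (sumn cs + size cs) + 20 <= K1 by rewrite /K1; move: (call_cost M) (4 * _) => a b; lia.
have K2 : 2 <= K1 by rewrite /K1; move: (call_cost M) (4 * _) => a b; lia.
move: (4 * (sumn cs + size cs)) K5 => L K5.
move: (size (gap_stringB u)) h4 => g h4.
have -> : size u.1 = size (enc_cnf3 phi) by [].
rewrite -[size u.1]/(size (enc_cnf3 phi)) in h4.
move: (tau u) (size (enc_cnf3 phi)) h4 => a b h4.
clearbody K1; move: (call_cost M) K4 => cc K4.
have e1 : (cc + 4) * (time + g).+1 <= K1 * (time + C * P).+1 by apply: leq_mul => //; lia.
have e2 : a + 2 * b <= K1 * (C * P) by apply: leq_trans (_ : 2 * (C * P) <= _); [lia|rewrite leq_mul2r K2 orbT].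
have e3 : K1 <= K1 * P by rewrite leq_pmulr.
have -> : 3 * K1 * C.+1 * (P + time) = 3 * (K1 * P) + 3 * (K1 * (C * P)) + 3 * (K1 * time) + 3 * (K1 * (C * time)) by nia.
rewrite mulnS mulnDr in e1; lia.
Qed.

(** * The two lower bounds *)

Import Order.TTheory GRing.Theory Num.Theory numFieldNormedType.Exports.
Local Open Scope classical_set_scope.
Local Open Scope ring_scope.

Lemma bound_le (R : realType) (x : R) : 0 <= x -> exists n : nat, x <= n%:R.
Proof. by move=> x0; exists (Num.bound x); apply: ltW; apply: archi_boundP. Qed.

Lemma powR_nat (R : realType) (j : nat) : (2 ^ j)%:R = 2 `^ (j%:R) :> R.
Proof. by rewrite powR_mulrn // natrX. Qed.

Lemma tree_alpha_gap_W1 (R : realType) (c : R) : 1 <= c -> FPT <> W 1%N ->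
  ~ exists (M : TM) (f : nat -> nat) (d : nat), computable f /\
      distinguishes_tree_alpha M (fun n k => (f k)%:R * n%:R ^+ d) (fun k => c * k%:R).
Proof.
move=> c1 ne [M [f [d [cf dist]]]]; apply: ne.
(* Rounding [c] up only narrows the negative case. *)
have [c' hc'] : exists c' : nat, c <= c'%:R by apply: bound_le; apply: le_trans c1.
have c'0 : (0 < c')%N by rewrite -(ltr_nat R); apply: lt_le_trans hc'; apply: lt_le_trans c1.
apply/funext => L; apply/propext; split; first exact: FPT_W1.
move=> [e [_ [N [fR [gR [dR [cfR cgR hR]]]]]]].
apply: (@W1_FPT c' M f d c'0 cf _ e L N fR gR dR) => // n G k n0 k0.
have [t [y [tle cw yt yf]]] := dist n G k n0 k0.
exists t, y; split=> //; first by move: tle; rewrite -natrX -natrM ler_nat.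
move=> lt; apply: yf; apply: le_lt_trans (_ : c'%:R * k%:R < _); first by rewrite ler_wpM2r.
by rewrite -natrM ltr_nat.
Qed.

(** In the exponent [3 * Bc * (n %/ t)] times [sigma], the factor [c * t] cancels against [c] and
    against the division by [t], and [(3 * Bc).+1] absorbs the [3 * Bc] guessed bits. *)
Lemma subexponential_time (R : realType) (delta sk : R) (Bc c t n NG C : nat) :
  0 < delta -> (0 < c)%N -> (0 < t)%N -> (0 < NG)%N ->
  sk <= delta / ((3 * Bc).+1 * c)%:R * (c * t)%:R ->
  (NG <= C * 2 ^ (3 * Bc * (n %/ t)))%N ->
  NG%:R `^ sk <= C%:R `^ (delta / ((3 * Bc).+1 * c)%:R * (c * t)%:R) * 2 `^ (delta * n%:R).
Proof.
move=> d0 c0 t0 N0 skle NGle.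
set sigma := delta / _ * _ in skle *.
have s0 : 0 <= sigma by rewrite /sigma mulr_ge0 // divr_ge0 // ltW.
apply: le_trans (_ : NG%:R `^ sigma <= _); first by apply: ler_powR => //; rewrite ler1n.
apply: le_trans (_ : (C * 2 ^ (3 * Bc * (n %/ t)))%:R `^ sigma <= _).
  by apply: ge0_ler_powR => //; rewrite ?nnegrE ?ler0n // ler_nat.
rewrite natrM powRM ?ler0n // powR_nat -powRrM ler_wpM2l ?powR_ge0 //.
apply: ler_powR; first by rewrite ler1n.
rewrite /sigma.
have D0 : (0 : R) < ((3 * Bc).+1 * c)%:R by rewrite ltr0n muln_gt0.
have gen (X Y D : R) : X * (delta / D * Y) = delta * (X * Y / D) by ring.
rewrite gen ler_pM2l // ler_pdivrMr // -!natrM ler_nat.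
have -> : (3 * Bc * (n %/ t) * (c * t) = n %/ t * t * (3 * Bc * c))%N by lia.
by apply: leq_mul; [exact: leq_trunc_div|rewrite mulSn leq_addl].
Qed.

Lemma tree_alpha_gap_GapETH (R : realType) : Gap_ETH R -> forall g : nat -> nat,
  ~ exists (M : TM) (f : nat -> nat) (s : nat -> R),
    [/\ computable f, (fun k => s k / k%:R) @ \oo --> (0 : R) &
      distinguishes_tree_alpha M (fun n k => (f k)%:R * n%:R `^ s k) (fun k => (g k)%:R)].
Proof.
move=> [delta [eps [Bc [d0 e0 H]]]] g [M [f [s [cf hs dist]]]]; apply: H.
have [e he] := gapB_machine M Bc.
(* Chosen so that the fraction [2 / 2 ^ c] of violated clauses is at most [eps]. *)
have [c1 hc1] : exists c : nat, 2 / eps <= c%:R by apply: bound_le; rewrite divr_ge0 // ltW.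
pose c := c1.+1.
have hc : 2 <= eps * (2 ^ c)%:R.
  rewrite mulrC -ler_pdivrMr //; apply: le_trans hc1 _; rewrite ler_nat.
  by apply: leq_trans (leqnSn c1) _; apply: ltnW; rewrite ltn_expl.
have [t1 ht1] : exists t : nat, e%:R / delta <= t%:R by apply: bound_le; rewrite divr_ge0 // ltW.
pose eta := delta / ((3 * Bc).+1 * c)%:R.
have eta0 : 0 < eta by rewrite divr_gt0 // ltr0n.
have [N _ hN] := (cvgrPdist_le _ _).1 hs eta eta0.
(* Two demands on [t']: [k] must pass the threshold beyond which [s k <= eta * k], and the overhead
   [2 ^ (e * (n %/ t'.+1))] must stay below [2 ^ (delta * n)]. *)
pose t' := (maxn N t1).+1; pose k := (c * t'.+1)%N.
have k0 : (0 < k)%N by rewrite muln_gt0.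
have kN : (N <= k)%N.
  by apply: leq_trans (leq_maxl N t1) _; rewrite /k mulSn; lia.
have sk : s k <= eta * k%:R.
  have kr : (0 : R) < k%:R by rewrite ltr0n.
  have := hN k kN; rewrite /= sub0r normrN => /(le_trans (ler_norm _)).
  by rewrite ler_pdivrMr.
have [Nm [K hNm]] := he t' (g k) k.
pose C := ((g k).+1 * 2 ^ block_const Bc t' (g k) * 2)%N.
exists Nm, (K%:R * (1 + (f k)%:R * C%:R `^ (eta * k%:R))) => n phi sm.
pose x := enc_cnf3 phi; pose NG := (ncopyB x t'.+1 (g k).+1 * 2)%N.
have NG0 : (0 < NG)%N by rewrite /NG /ncopyB !muln_gt0 expn_gt0.
have [time [z [tle cw zt zf]]] := dist _ (dblG (ncopyB x t'.+1 (g k).+1) (relB_sym x t'.+1 (g k).+1)) k NG0 k0.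
rewrite -(gap_stringBE (x, (t', g k, k))) in cw.
exists (K * (2 ^ (e * (n %/ t'.+1)) + time))%N, [:: if z is false :: _ then true else false]; split.
- rewrite natrM -mulrA ler_wpM2l // natrD mulrDl mul1r; apply: lerD.
    rewrite powR_nat; apply: ler_powR; first by rewrite ler1n.
    rewrite natrM; apply: le_trans (_ : delta * t1%:R * (n %/ t'.+1)%:R <= _).
      by rewrite ler_wpM2r // mulrC -ler_pdivrMr.
    rewrite -mulrA ler_pM2l // -natrM ler_nat mulnC.
    apply: leq_trans (leq_trunc_div n t'.+1); rewrite leq_mul2l /t'; apply/orP; right.
    by apply: leq_trans (leq_maxr N t1) _; lia.
  apply: le_trans tle _; rewrite -mulrA ler_wpM2l //.
  apply: subexponential_time => //; exact: ncopy_bound.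
- exact: hNm.
- move=> /max_sat_full[a ha].
  by rewrite zf // ltr_nat; exact: relB_yes ha.
(* If tree-alpha exceeded [k], the decoded assignment would violate at most an [eps] fraction of the
   clauses. *)
- move=> few; rewrite zt // leqNgt; apply/negP => lt.
  have [//|//|a ha] := relB_no _ _ k0 (leqnn k) lt.
  have := max_sat_unsat phi a; move: ha; rewrite nclause_cnf.
  set U := (\sum_(_ < _) _)%N => h1 h2.
  have h1' : U%:R * (2 ^ c)%:R <= 2 * (size phi)%:R :> R by rewrite -!natrM ler_nat.
  have h2' : (size phi)%:R <= (max_sat phi)%:R + U%:R :> R by rewrite -natrD ler_nat.
  have h3 : eps * (size phi)%:R < U%:R by lra.
  have p0 : (0 : R) < (2 ^ c)%:R by rewrite ltr0n expn_gt0.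
  have h4 : eps * (size phi)%:R * (2 ^ c)%:R < U%:R * (2 ^ c)%:R by rewrite ltr_pM2r.
  have h5 : 2 * (size phi)%:R <= eps * (2 ^ c)%:R * (size phi)%:R by rewrite ler_wpM2r.
  by nra.
Qed.

Theorem theorem15 (R : realType) :
  (forall c : R, 1 <= c -> FPT <> W 1%N ->
    ~ exists (M : TM) (f : nat -> nat) (d : nat),
        computable f /\
        distinguishes_tree_alpha M
          (fun n k => (f k)%:R * n%:R ^+ d) (fun k => c * k%:R))
  /\
  (Gap_ETH R ->
    forall g : nat -> nat, computable g ->
    (forall k, (0 < k)%N -> (k <= g k)%N) ->
    ~ exists (M : TM) (f : nat -> nat) (s : nat -> R),
        [/\ computable f,
            (fun k => s k / k%:R) @ \oo --> (0 : R) &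
            distinguishes_tree_alpha M
              (fun n k => (f k)%:R * n%:R `^ s k) (fun k => (g k)%:R)]).

Proof.
split; first exact: tree_alpha_gap_W1.
by move=> gap g _ _; exact: tree_alpha_gap_GapETH.
Qed.
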